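(* Let $V\in L^\infty(\mathbb{R}^+)$ be complex-valued, $V_R:=\operatorname{Re}V$, $V_I:=\operatorname{Im}V\ge0$ almost everywhere, with $V_I\not\equiv0$. Let $A_{min}$ be the operator in $L^2(\mathbb{R}^+)$ given by $$\mathcal{D}(A_{min})=\{f\in H^2(\mathbb{R}^+): f(0)=f'(0)=0\},\qquad (A_{min}f)(x)=-f''(x)+V(x)f(x),$$ and let $\lambda\in\mathbb{R}$. If there exists a non-zero solution $g\in H^2(\mathbb{R}^+)$ to the differential equation $$A_{min}^*g=-g''+V_Rg-iV_Ig=\lambda g,$$ then there exists a unique maximally dissipative extension $A_\lambda$ of $A_{min}$ for which $\ker(A_\lambda-\lambda)=\operatorname{span}\{g\}$ is a non-trivial reducing selfadjoint subspace.
   Context: $\mathbb{R}^+=(0,\infty)$, $H^2(\mathbb{R}^+)$ is the usual Sobolev space; the inner product is linear in the second component. A densely defined linear operator $A$ is dissipative if $\operatorname{Im}\langle u,Au\rangle\ge0$ for all $u\in\mathcal{D}(A)$, and maximally dissipative if moreover it has no non-trivial dissipative extension; a maximally dissipative extension of $A_{min}$ is a maximally dissipative operator extending $A_{min}$. It is known that the maximally dissipative extensions of $A_{min}$ are exactly the operators $A_{h,k}$ with $h\in\mathbb{C}$, $\operatorname{Im}h\ge0$, $k\in\operatorname{Ran}(V_I^{1/2})$, $\frac14\int_{\{V_I\ne0\}}\frac{|k|^2}{V_I}dx\le\operatorname{Im}h$, given by $\mathcal{D}(A_{h,k})=\{f\in H^2(\mathbb{R}^+):f'(0)=hf(0)\}$,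 $A_{h,k}f=-f''+Vf+f(0)k$, together with the Dirichlet extension $A_{\infty,0}$, $\mathcal{D}(A_{\infty,0})=\{f\in H^2(\mathbb{R}^+):f(0)=0\}$, $A_{\infty,0}f=-f''+Vf$. A closed subspace $\mathcal{M}$ of a Hilbert space is a reducing subspace of $A$ if $\mathcal{D}(A)=\mathcal{D}(A)\cap\mathcal{M}+\mathcal{D}(A)\cap\mathcal{M}^\perp$, $A(\mathcal{D}(A)\cap\mathcal{M})\subset\mathcal{M}$ and $A(\mathcal{D}(A)\cap\mathcal{M}^\perp)\subset\mathcal{M}^\perp$. A reducing selfadjoint subspace is a reducing subspace $\mathcal{M}$ such that the restriction of $A$ to $\mathcal{D}(A)\cap\mathcal{M}$ is selfadjoint in $\mathcal{M}$; non-trivial means $\neq\{0\}$. *)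

(* Defs.v *)
From HB Require Import structures.
From mathcomp Require Import all_boot all_order all_algebra.
From mathcomp Require Import all_classical all_reals all_analysis.
From mathcomp Require Import complex.

Set Implicit Arguments.
Unset Strict Implicit.
Unset Printing Implicit Defensive.

Import Order.TTheory GRing.Theory Num.Theory.
Import numFieldNormedType.Exports.

Local Open Scope classical_set_scope.
Local Open Scope ring_scope.
Local Open Scope complex_scope.

(** ** Unbounded operators in an inner product space *)

(* An unbounded operator in E is represented by its graph, a subset of E * E;
   extension of operators is then inclusion of graphs. *)
Section Operators.
Context (R : realType) (E : lmodType R[i]) (ip : E -> E -> R[i]).
Implicit Types (A B T : set (E * E)) (M D : set E).

Definition subspace (F : lmodType R[i]) (M : set F) : Prop :=
  M 0 /\ forall (a : R[i]) (u v : F), M u -> M v -> M (a *: u + v).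

Definition span1 (g : E) : set E := [set u | exists a : R[i], u = a *: g].

Definition hnorm (u : E) : R := Num.sqrt (complex.Re (ip u u)).

Definition adherence M : set E :=
  [set u | forall e : R, 0 < e -> exists2 v, M v & hnorm (u - v) < e].

Definition closed_subspace M : Prop := subspace M /\ adherence M `<=` M.

Definition orthogonal M : set E := [set u | forall v, M v -> ip v u = 0].

Definition linear_operator A : Prop :=
  subspace A /\ forall u v w, A (u, v) -> A (u, w) -> v = w.

Definition domain A : set E := [set u | exists v, A (u, v)].

Definition op_ker A (z : R[i]) : set E := [set u | A (u, z *: u)].

Definition op_restrict A M : set (E * E) := [set p | A p /\ M p.1].

Definition dissipative A : Prop :=
  [/\ linear_operator A, adherence (domain A) = setT &
      forall u v, A (u, v) -> 0 <= complex.Im (ip u v)].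

Definition maximally_dissipative A : Prop :=
  dissipative A /\ forall B, dissipative B -> A `<=` B -> B = A.

(* The graph of the adjoint, taken in the Hilbert space M, of T. *)
Definition adjoint_in M T : set (E * E) :=
  [set p | [/\ M p.1, M p.2 &
               forall u v, T (u, v) -> ip p.1 v = ip p.2 u]].

Definition selfadjoint_in M T : Prop :=
  [/\ linear_operator T, T `<=` [set p | M p.1 /\ M p.2],
      M `<=` adherence (domain T) & T = adjoint_in M T].

Definition reducing M A : Prop :=
  [/\ closed_subspace M,
      domain A = [set u | exists v w, [/\ (domain A `&` M) v,
                            (domain A `&` orthogonal M) w & u = v + w]],
      forall u v, A (u, v) -> M u -> M v &
      forall u v, A (u, v) -> orthogonal M u -> orthogonal M v].

Definition reducing_selfadjoint M A : Prop :=
  reducing M A /\ selfadjoint_in M (op_restrict A M).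

End Operators.

(** ** The Hilbert space L^2(R^+) of complex-valued functions *)

Section L2.
Context (R : realType).

Local Notation mu := (@lebesgue_measure R).
Local Notation Rplus := (`]0, +oo[%classic : set R).

(* f is a Borel representative of an element of L^p(R^+); only its values on R^+
   matter. *)
Definition LpC (p : \bar R) (f : R -> R[i]) : bool :=
  (((fun x => complex.Re (f x)) \_ Rplus) \in Lfun mu p) &&
  (((fun x => complex.Im (f x)) \_ Rplus) \in Lfun mu p).

Definition ae_plus (P : R -> Prop) : Prop := {ae mu, forall x, 0 < x -> P x}.

Lemma ae_plusS2 (P Q S : R -> Prop) :
  (forall x, 0 < x -> P x -> Q x -> S x) ->
  ae_plus P -> ae_plus Q -> ae_plus S.
Proof.
move=> PQS; rewrite /ae_plus.
by apply: (@filterS2 _ _ (ae_filter_ringOfSetsType mu)) => x P0 Q0 x0; auto.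
Qed.

Definition cintegral (f : R -> R[i]) : R[i] :=
  (\int[mu]_(x in Rplus) complex.Re (f x)) +i*
  (\int[mu]_(x in Rplus) complex.Im (f x)).

Definition L2pred : {pred R -> R[i]} := LpC 2%:E.

Lemma L2_submod_closed : submod_closed L2pred.
Proof.
have [L0 LD] := Lfun_submod_closed mu (lee1n 2).
split=> [|a f h /andP[fr fi] /andP[hr hi]].
  have L00 : (fun=> 0) \_ Rplus \in Lfun mu 2%:E.
    have -> : (fun=> 0) \_ Rplus = (fun=> 0 : R).
      by apply/funext => x; rewrite patchE; case: ifP.
    exact: L0.
  exact/andP.
apply/andP; split.
- have -> : (fun x => complex.Re ((a *: f + h) x)) \_ Rplus =
    complex.Re a *: ((fun x => complex.Re (f x)) \_ Rplus) +
    (- complex.Im a *: ((fun x => complex.Im (f x)) \_ Rplus) +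
    ((fun x => complex.Re (h x)) \_ Rplus)).
    apply/funext => x; rewrite !fctE !patch_indic /GRing.scale/=.
    case: a (f x) (h x) => [ar ai] [u v] [w z] /=.
    by rewrite !(mulrDl, mulrA, mulNr, addrA).
  exact: (LD _ _ _ fr (LD _ _ _ fi hr)).
- have -> : (fun x => complex.Im ((a *: f + h) x)) \_ Rplus =
    complex.Re a *: ((fun x => complex.Im (f x)) \_ Rplus) +
    (complex.Im a *: ((fun x => complex.Re (f x)) \_ Rplus) +
    ((fun x => complex.Im (h x)) \_ Rplus)).
    apply/funext => x; rewrite !fctE !patch_indic /GRing.scale/=.
    case: a (f x) (h x) => [ar ai] [u v] [w z] /=.
    by rewrite !(mulrDl, mulrA, addrA).
  exact: (LD _ _ _ fi (LD _ _ _ fr hi)).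
Qed.

HB.instance Definition _ :=
  GRing.isSubmodClosed.Build R[i] (R -> R[i]) L2pred L2_submod_closed.

Record L2fun : Type := MkL2fun { L2val :> R -> R[i]; _ : L2val \in L2pred }.

HB.instance Definition _ := [isSub for L2val].
HB.instance Definition _ := [Choice of L2fun by <:].
HB.instance Definition _ := [SubChoice_isSubLmodule of L2fun by <:].

Definition null_pred : {pred L2fun} :=
  fun f => `[< ae_plus (fun x => f x = 0) >].

Lemma null_submod_closed : submod_closed null_pred.
Proof.
split; first by apply/asboolP; exact: aeW.
move=> a f h /asboolP f0 /asboolP h0; apply/asboolP.
apply: ae_plusS2 f0 h0 => x _ f0 h0.
by rewrite /= !fctE f0 h0 scaler0 addr0.
Qed.

HB.instance Definition _ :=
  GRing.isSubmodClosed.Build R[i] L2fun null_pred null_submod_closed.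

(* L2fun modulo equality almost everywhere on R^+, see L2_eqP. *)
Definition L2 : Type := Quotient.quot null_pred.

HB.instance Definition _ := GRing.Zmodule.on L2.
HB.instance Definition _ := EqQuotient.on L2.

Local Open Scope quotient_scope.

Definition L2_scale (a : R[i]) (u : L2) : L2 := \pi_L2 (a *: repr u).

Lemma pi_L2_scale a (f : L2fun) : L2_scale a (\pi_L2 f) = \pi_L2 (a *: f).
Proof.
apply/eqP; rewrite /L2_scale -Quotient.idealrBE -scalerBr rpredZ//.
by rewrite Quotient.idealrBE reprK.
Qed.

Lemma L2_reprK (u : L2) : \pi_L2 (repr u) = u.
Proof. exact: reprK. Qed.

Lemma L2_scaleA a b u : L2_scale a (L2_scale b u) = L2_scale (a * b) u.
Proof. by rewrite -[u]L2_reprK !pi_L2_scale scalerA. Qed.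

Lemma L2_scale1 : left_id 1 L2_scale.
Proof. by move=> u; rewrite -[u]L2_reprK pi_L2_scale scale1r. Qed.

Lemma pi_L2D (f h : L2fun) : \pi_L2 (f + h) = \pi_L2 f + \pi_L2 h.
Proof. exact: Quotient.pi_add. Qed.

Lemma L2_scaleDr : right_distributive L2_scale +%R.
Proof.
move=> a u v; rewrite -[u]L2_reprK -[v]L2_reprK.
by rewrite -pi_L2D !pi_L2_scale scalerDr pi_L2D.
Qed.

Lemma L2_scaleDl u : {morph L2_scale^~ u : a b / a + b}.
Proof. by move=> a b; rewrite -[u]L2_reprK !pi_L2_scale scalerDl pi_L2D. Qed.

HB.instance Definition _ := GRing.Zmodule_isLmodule.Build R[i] L2
  L2_scaleA L2_scale1 L2_scaleDr L2_scaleDl.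

Definition L2_repr (u : L2) : R -> R[i] := repr u.
Coercion L2_repr : L2 >-> Funclass.

Lemma L2_eqP (u v : L2) : u = v <-> ae_plus (fun x => u x = v x).
Proof.
have uvE : (u == v) = (repr u - repr v \in null_pred).
  by rewrite (Quotient.idealrBE null_pred) !reprK.
split=> [-> | uv]; first exact: aeW.
apply/eqP; rewrite uvE; apply/asboolP.
apply: ae_plusS2 (uv) uv => x _ uvx _.
by apply/eqP; rewrite subr_eq0; apply/eqP.
Qed.

Definition L2_ip (u v : L2) : R[i] := cintegral (fun x => conjc (u x) * v x).

(** ** Sobolev spaces and the minimal operator *)

(* phi is in C_c^oo(R^+), real-valued. *)
Definition test_function (phi : R -> R) : Prop :=
  (forall n x, derivable (derive1n n phi) x 1) /\
  exists a b : R, 0 < a /\ forall x, x < a \/ b < x -> phi x = 0.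

(* v is the distributional derivative on R^+ of u. *)
Definition weak_derivative (u v : L2) : Prop :=
  forall phi, test_function phi ->
    cintegral (fun x => u x * (derive1 phi x)%:C) =
    - cintegral (fun x => v x * (phi x)%:C).

(* u is in H^2(R^+), with u' = u1 and u'' = u2. *)
Definition H2_derivatives (u u1 u2 : L2) : Prop :=
  weak_derivative u u1 /\ weak_derivative u1 u2.

(* u(0) = a, for the representative of u that is continuous on [0, +oo[. *)
Definition value_at0 (u : L2) (a : R[i]) : Prop :=
  exists f : R -> R[i],
    [/\ {within `[0, +oo[, continuous (fun x => complex.Re (f x))},
        {within `[0, +oo[, continuous (fun x => complex.Im (f x))},
        ae_plus (fun x => u x = f x) & f 0 = a].

Definition A_min (V : R -> R[i]) : set (L2 * L2) :=
  [set p : L2 * L2 | exists f1 f2 : L2,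
    [/\ H2_derivatives p.1 f1 f2, value_at0 p.1 0, value_at0 f1 0 &
        ae_plus (fun x => p.2 x = - f2 x + V x * p.1 x)]].

End L2.

(* Main.v *)
Require Import Defs.
From mathcomp Require Import all_boot all_order all_algebra.
From mathcomp Require Import all_classical all_reals all_analysis.
From mathcomp Require Import measurable_realfun ess_sup_inf complex ring lra.

Set Implicit Arguments.
Unset Strict Implicit.
Unset Printing Implicit Defensive.

Import Order.TTheory GRing.Theory Num.Theory.
Import numFieldNormedType.Exports ComplexField.Normc.

Local Open Scope classical_set_scope.
Local Open Scope ring_scope.
Local Open Scope complex_scope.

(* Write (g, lambda g) for the given eigenvector of A_min^* = -d^2/dx^2 + conj V
   on H^2, and let K be the graph A_min + span (g, lambda g).  Every extension of
   A_min with g as eigenvector contains K, so uniqueness follows once K is known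
   to be maximally dissipative.  A_min is the adjoint of A_min^*, hence K is the
   adjoint of the restriction of A_min^* to the kernel of the functional
   (p, q) |-> <g, q> - <lambda g, p>.  K is dissipative, since g is orthogonal to
   the range of A_min - lambda.  If p is orthogonal to the range of K + i, then
   A_min^* p = i p and <g, p> = 0; the boundary values of g do not both vanish, so
   x = p + t g has vanishing boundary term in Green's formula for a suitable
   t, and |p|^2 = Im <x, A_min^* x> = - \int Im V |x|^2 <= 0.  Thus K + i is onto and
   K is maximal. *)

(** * Operators in a complete inner product space *)

(** The classification by [h] and [k] is bypassed. What matters is that [K] is an adjoint: adjoints
    are closed, and since dissipativity bounds the inverse of [K + i], the range of [K + i] is
    closed too. Writing [K] as an adjoint needs the functional to be non-zero on the maximal
    operator; otherwise [(g, lambda g)] would lie in the graph of [A_min], and [g] would have zero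
    Cauchy data at [0] and vanish by uniqueness for the differential equation. The same uniqueness
    shows that the boundary values of [g] do not both vanish and that the eigenspace of [K] is
    exactly the span of [g]. Adding [t g] to [p] does not disturb the quadratic form: the cross
    terms die with [<g, p> = 0] and [lambda |g|^2] is real. The analytic obstacle is that [H^2] is
    defined by distributional derivatives of classes, while Green's formula speaks of values at [0].
    Hence classes are first represented by iterated Lebesgue primitives; the boundary term at
    infinity vanishes because it is integrable together with its derivative. *)

Record inner_product (R : realType) (E : lmodType R[i]) (ip : E -> E -> R[i]) :
  Prop := InnerProduct {
  ip_linear : forall u a v w, ip u (a *: v + w) = a * ip u v + ip u w;
  ip_conj : forall u v, ip v u = conjc (ip u v);
  ip_ge0 : forall u, 0 <= complex.Re (ip u u);
  ip_eq0 : forall u, complex.Re (ip u u) = 0 -> u = 0 }.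

Definition ip_complete (R : realType) (E : lmodType R[i]) (ip : E -> E -> R[i]) :=
  forall u : nat -> E,
    (forall e, 0 < e -> exists N, forall m n, (N <= m)%N -> (N <= n)%N ->
       hnorm ip (u m - u n) < e) ->
    exists l, forall e, 0 < e -> exists N, forall n, (N <= n)%N ->
       hnorm ip (u n - l) < e.

Lemma complexP (R : realType) (x y : R[i]) :
  complex.Re x = complex.Re y -> complex.Im x = complex.Im y -> x = y.
Proof. by case: x => a b; case: y => c d /= -> ->. Qed.

Lemma conjcR (R : realType) (x : R) : conjc x%:C = x%:C.
Proof. by rewrite /= oppr0. Qed.

Lemma conjcM (R : realType) (x y : R[i]) : conjc (x * y) = conjc x * conjc y.
Proof. exact: rmorphM. Qed.

Section InnerProductTheory.
Context (R : realType) (E : lmodType R[i]) (ip : E -> E -> R[i]).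
Context (ipP : inner_product ip).
Implicit Types (u v w p q : E) (a : R[i]).

Lemma ipDr u v w : ip u (v + w) = ip u v + ip u w.
Proof. by rewrite -[v]scale1r (ip_linear ipP) mul1r scale1r. Qed.

Lemma ip0r u : ip u 0 = 0.
Proof. by apply: (@addrI _ (ip u 0)); rewrite -ipDr !addr0. Qed.

Lemma ipZr u a v : ip u (a *: v) = a * ip u v.
Proof. by rewrite -[a *: v]addr0 (ip_linear ipP) ip0r addr0. Qed.

Lemma ipNr u v : ip u (- v) = - ip u v.
Proof. by rewrite -scaleN1r ipZr mulN1r. Qed.

Lemma ipBr u v w : ip u (v - w) = ip u v - ip u w.
Proof. by rewrite ipDr ipNr. Qed.

Lemma ipDl u v w : ip (u + v) w = ip u w + ip v w.
Proof. by rewrite (ip_conj ipP w) ipDr rmorphD /= -!(ip_conj ipP). Qed.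

Lemma ipZl a u v : ip (a *: u) v = conjc a * ip u v.
Proof. by rewrite (ip_conj ipP v) ipZr rmorphM /= -(ip_conj ipP). Qed.

Lemma ip0l u : ip 0 u = 0.
Proof. by rewrite (ip_conj ipP u) ip0r conjc0. Qed.

Lemma ipNl u v : ip (- u) v = - ip u v.
Proof. by rewrite (ip_conj ipP v) ipNr rmorphN /= -(ip_conj ipP). Qed.

Lemma ipBl u v w : ip (u - v) w = ip u w - ip v w.
Proof. by rewrite ipDl ipNl. Qed.

Lemma ip_Im0 u : complex.Im (ip u u) = 0.
Proof.
have := congr1 (@complex.Im R) (ip_conj ipP u u).
by case: (ip u u) => x y /= ?; lra.
Qed.

Lemma ip_self u : ip u u = (complex.Re (ip u u))%:C.
Proof. by apply: complexP; rewrite /= ?ip_Im0. Qed.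

Lemma normc_sqr (z : R[i]) : normc z ^+ 2 = complex.Re z ^+ 2 + complex.Im z ^+ 2.
Proof. by case: z => x y /=; rewrite sqr_sqrtr // addr_ge0 ?sqr_ge0. Qed.

Lemma normc_ge0 (z : R[i]) : 0 <= normc z.
Proof. by case: z => x y; exact: sqrtr_ge0. Qed.

Lemma hnorm_sqr u : hnorm ip u ^+ 2 = complex.Re (ip u u).
Proof. by rewrite /hnorm sqr_sqrtr // (ip_ge0 ipP). Qed.

Lemma hnorm_ge0 u : 0 <= hnorm ip u.
Proof. exact: sqrtr_ge0. Qed.

Lemma hnorm_eq0 u : hnorm ip u = 0 -> u = 0.
Proof. by move=> u0; apply: (ip_eq0 ipP); rewrite -hnorm_sqr u0 expr0n. Qed.

(* The infimum over multiples of [m] being nearly attained at [0] makes [x]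
   nearly orthogonal to [m]; [d = |x|^2] gives Cauchy-Schwarz. *)
Lemma ip_near_min x m (d : R) :
  (forall a, hnorm ip x ^+ 2 - d <= hnorm ip (x - a *: m) ^+ 2) ->
  normc (ip m x) ^+ 2 <= d * hnorm ip m ^+ 2.
Proof.
move=> min.
have [m0|m0] := eqVneq (hnorm ip m) 0.
  by rewrite (hnorm_eq0 m0) ip0l normc_sqr /= /hnorm ip0l /= sqrtr0 !expr0n /= mulr0 addr0.
have mgt0 : 0 < hnorm ip m ^+ 2 by rewrite exprn_gt0 // lt_neqAle eq_sym m0 hnorm_ge0.
(* This scalar is the coefficient of the orthogonal projection of [x] on [m]; subtracting that
   multiple lowers the squared norm by exactly [|<m, x>|^2 / |m|^2]. *)
have := min ((hnorm ip m ^+ 2)^-1%:C * ip m x).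
rewrite [leRHS]hnorm_sqr !(ipBl, ipBr, ipZl, ipZr) (ip_conj ipP m x).
rewrite (ip_self x) (ip_self m) -!hnorm_sqr.
set M := hnorm ip m ^+ 2 in mgt0 *; set X := hnorm ip x ^+ 2.
rewrite normc_sqr; case: (ip m x) => z w /=.
rewrite !(mul0r, mulr0, subr0, add0r, addr0, oppr0).
set rhs := (X in _ <= X -> _); have -> : rhs = X - (z ^+ 2 + w ^+ 2) / M.
  by rewrite /rhs; field; rewrite gt_eqF.
rewrite lerD2l lerN2.
by rewrite ler_pdivrMr.
Qed.

Lemma cauchy_schwarz u v : normc (ip u v) <= hnorm ip u * hnorm ip v.
Proof.
rewrite -(@ler_pXn2r _ 2) ?nnegrE ?mulr_ge0 ?normc_ge0 ?hnorm_ge0 //.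
rewrite exprMn mulrC; apply: ip_near_min => a.
by rewrite subrr exprn_ge0 // hnorm_ge0.
Qed.

Lemma hnormN u : hnorm ip (- u) = hnorm ip u.
Proof. by rewrite /hnorm ipNl ipNr opprK. Qed.

Lemma hnormZ a u : hnorm ip (a *: u) = normc a * hnorm ip u.
Proof.
apply/eqP; rewrite -(@eqrXn2 _ 2) ?mulr_ge0 ?normc_ge0 ?hnorm_ge0 //.
rewrite exprMn !hnorm_sqr ipZl ipZr ip_self normc_sqr; apply/eqP.
by case: a => x y /=; ring.
Qed.

Lemma hnormD u v : hnorm ip (u + v) <= hnorm ip u + hnorm ip v.
Proof.
rewrite -(@ler_pXn2r _ 2) ?nnegrE ?addr_ge0 ?hnorm_ge0 //.
rewrite sqrrD !hnorm_sqr !(ipDl, ipDr) (ip_conj ipP u v).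
have : complex.Re (ip u v) <= hnorm ip u * hnorm ip v.
  apply: le_trans (cauchy_schwarz u v).
  case: (ip u v) => x y /=; apply: le_trans (ler_norm x) _.
  by rewrite -sqrtr_sqr ler_wsqrtr // lerDl sqr_ge0.
rewrite (ip_self u) (ip_self v); case: (ip u v) => x y /= h; rewrite mulr2n; lra.
Qed.

Lemma ler_hnormB u v w : hnorm ip (u - w) <= hnorm ip (u - v) + hnorm ip (v - w).
Proof. by apply: le_trans (hnormD _ _); rewrite addrA subrK. Qed.

Lemma hnormC u v : hnorm ip (u - v) = hnorm ip (v - u).
Proof. by rewrite -hnormN opprB. Qed.

Lemma normc_small0 (z : R[i]) (C : R) :
  (forall e, 0 < e -> normc z <= C * e) -> z = 0.
Proof.
move=> zC; apply: eq0_normc; apply/eqP.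
rewrite eq_le normc_ge0 andbT; apply/ler_addgt0Pr => e e0; rewrite add0r.
have C1 : 0 < `|C| + 1 by rewrite ltr_wpDl.
apply: le_trans (zC (e / (`|C| + 1)) _) _; first by rewrite divr_gt0.
rewrite mulrA ler_pdivrMr // mulrC ler_pM2l //.
by apply: le_trans (ler_norm _) _; rewrite lerDl.
Qed.

(** Adjoints are closed: for fixed [(p, q)] in [T] the defect [<w, q> - <z, p>] is continuous in
    [(w, z)] by Cauchy-Schwarz and vanishes on the approximating pairs. *)
Lemma adjoint_closed (T : set (E * E)) w z :
  (forall e, 0 < e -> exists w' z', [/\ adjoint_in ip setT T (w', z'),
     hnorm ip (w - w') < e & hnorm ip (z - z') < e]) ->
  adjoint_in ip setT T (w, z).
Proof.
move=> appr; split=> // p q Tpq /=; apply/eqP; rewrite -subr_eq0; apply/eqP.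
apply: (@normc_small0 _ (hnorm ip q + hnorm ip p)) => e e0.
have [w' [z' [[_ _ adj] ww zz]]] := appr e e0.
have := adj p q Tpq => /= adjE.
have -> : ip w q - ip z p = ip (w - w') q - ip (z - z') p.
  by rewrite !ipBl adjE; ring.
apply: le_trans (le_normcD _ _) _; rewrite normcN mulrDl; apply: lerD.
  by apply: le_trans (cauchy_schwarz _ _) _; rewrite mulrC ler_wpM2l ?hnorm_ge0 // ltW.
by apply: le_trans (cauchy_schwarz _ _) _; rewrite mulrC ler_wpM2l ?hnorm_ge0 // ltW.
Qed.

Lemma subspaceZ (F : lmodType R[i]) (M : set F) a (u : F) :
  Defs.subspace M -> M u -> M (a *: u).
Proof. by case=> M0 ML Mu; rewrite -[_ *: _]addr0; exact: ML. Qed.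

Lemma subspaceD (F : lmodType R[i]) (M : set F) (u v : F) :
  Defs.subspace M -> M u -> M v -> M (u + v).
Proof. by case=> M0 ML Mu Mv; rewrite -[u]scale1r; exact: ML. Qed.

Lemma subspaceB (F : lmodType R[i]) (M : set F) (u v : F) :
  Defs.subspace M -> M u -> M v -> M (u - v).
Proof. by case=> M0 ML Mu Mv; rewrite addrC -scaleN1r; exact: ML. Qed.

Lemma natSinv_small (e : R) : 0 < e ->
  exists N, forall n, (N <= n)%N -> n.+1%:R^-1 < e.
Proof.
move=> e0; have [N _ NP] := near_infty_natSinv_lt (PosNum e0).
by exists N => n Nn; apply: NP.
Qed.

Lemma sqrt_natSinv_small (e : R) : 0 < e ->
  exists N, forall n, (N <= n)%N -> Num.sqrt n.+1%:R^-1 < e.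
Proof.
move=> e0; have [|N NP] := @natSinv_small (e ^+ 2); first by rewrite exprn_gt0.
exists N => n Nn; rewrite -[e]gtr0_norm // -sqrtr_sqr.
by rewrite ltr_sqrt ?NP // exprn_gt0.
Qed.

(** [M] need not be closed, so the foot point lies in its adherence. A minimising sequence is Cauchy
    without the parallelogram law: near-minimality makes [x - m n] nearly orthogonal to [M], with
    factor [s n], and testing this on [v = m j - m k] gives [|v|^2 <= (s j + s k) |v|]. *)
Lemma projection M x : ip_complete ip -> Defs.subspace M ->
  exists2 y, adherence ip M y & forall m, M m -> ip m (x - y) = 0.
Proof.
move=> cplt Ms; have [M0 _] := Ms.
pose D : set R := [set r | exists2 m, M m & r = hnorm ip (x - m) ^+ 2].
have Dlb : lbound D 0 by move=> _ [m _ ->]; rewrite exprn_ge0 // hnorm_ge0.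
have Dinf : has_inf D by split; [exists (hnorm ip (x - 0) ^+ 2), 0|exists 0].
have /choice[m mP] : forall n, exists m, M m /\ hnorm ip (x - m) ^+ 2 < inf D + n.+1%:R^-1.
  move=> n; have [|_ [m Mm ->] mn] := @inf_adherent _ D n.+1%:R^-1 _ Dinf.
    by rewrite invr_gt0.
  by exists m.
pose s n : R := Num.sqrt n.+1%:R^-1.
have near_orth n v : M v -> normc (ip v (x - m n)) <= s n * hnorm ip v.
  move=> Mv; have [Mm mn] := mP n.
  rewrite -(@ler_pXn2r _ 2) ?nnegrE ?mulr_ge0 ?normc_ge0 ?sqrtr_ge0 //.
  rewrite exprMn sqr_sqrtr ?invr_ge0 //; apply: ip_near_min => a.
  rewrite lerBlDr; apply: le_trans (ltW mn) _; rewrite lerD2r.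
  apply: ge_inf; first by case: Dinf.
  exists (m n + a *: v); last by rewrite opprD addrA.
  by apply: subspaceD => //; exact: subspaceZ.
have mcau j k : hnorm ip (m j - m k) <= s j + s k.
  have Md : M (m j - m k) by apply: subspaceB => //; case: (mP j); case: (mP k).
  have [->|d0] := eqVneq (hnorm ip (m j - m k)) 0.
    by rewrite addr_ge0 ?sqrtr_ge0.
  have dgt0 : 0 < hnorm ip (m j - m k) by rewrite lt_neqAle eq_sym d0 hnorm_ge0.
  rewrite -(ler_pM2r dgt0) -expr2 hnorm_sqr.
  apply: (@le_trans _ _ (normc (ip (m j - m k) (m j - m k)))).
    by rewrite ip_self /= expr0n /= addr0 sqrtr_sqr ler_norm.
  have -> : ip (m j - m k) (m j - m k) =
      ip (m j - m k) (x - m k) - ip (m j - m k) (x - m j).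
    by rewrite -ipBr; congr (ip _ _); rewrite opprB [RHS]addrC addrA subrK.
  apply: le_trans (le_normcD _ _) _; rewrite normcN mulrDl addrC.
  by apply: lerD; exact: near_orth.
have [|y ylim] := cplt m.
  move=> e e0; have [|N NP] := @sqrt_natSinv_small (e / 2); first by rewrite divr_gt0.
  exists N => j k Nj Nk; apply: le_lt_trans (mcau j k) _.
  by rewrite [e]splitr ltrD // NP.
exists y.
  move=> e e0; have [N NP] := ylim e e0.
  by exists (m N); [case: (mP N)|rewrite hnormC NP].
move=> v Mv; apply: (@normc_small0 _ (2 * hnorm ip v)) => e e0.
have [N NP] := ylim e e0; have [N' NP'] := sqrt_natSinv_small e0.
set n := maxn N N'.
have -> : ip v (x - y) = ip v (x - m n) + ip v (m n - y).
  by rewrite -ipDr addrA subrK.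
apply: le_trans (le_normcD _ _) _.
rewrite -mulrA [2 * _]mulr_natl mulr2n; apply: lerD.
  apply: le_trans (near_orth _ _ Mv) _; rewrite mulrC ler_wpM2l ?hnorm_ge0 //.
  by rewrite ltW // NP' // leq_maxr.
apply: le_trans (cauchy_schwarz _ _) _; rewrite ler_wpM2l ?hnorm_ge0 //.
by rewrite ltW // NP // leq_maxl.
Qed.

Lemma dense_of_orthogonal M : ip_complete ip -> Defs.subspace M ->
  (forall x, (forall m, M m -> ip m x = 0) -> x = 0) -> adherence ip M = setT.
Proof.
move=> cplt Ms M0; apply/seteqP; split=> // x _.
have [y My xy] := projection x cplt Ms.
by have /eqP := M0 _ xy; rewrite subr_eq0 => /eqP ->.
Qed.

(** [Im <w, z + i w> = Im <w, z> + |w|^2 >= |w|^2], and Cauchy-Schwarz bounds the left-hand side.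
    This is the a priori bound on the inverse of [K + i]. *)
Lemma hnorm_le_dissipative K w z : dissipative ip K -> K (w, z) ->
  hnorm ip w <= hnorm ip (z + 'i *: w).
Proof.
case=> _ _ Kd Kwz; have [->|w0] := eqVneq (hnorm ip w) 0; first exact: hnorm_ge0.
have wgt0 : 0 < hnorm ip w by rewrite lt_neqAle eq_sym w0 hnorm_ge0.
rewrite -(ler_pM2l wgt0) -expr2; apply: le_trans (cauchy_schwarz _ _).
have := Kd _ _ Kwz; rewrite hnorm_sqr ipDr ipZr (ip_self w) /=.
case: (ip w z) => x y /= y0; apply: (@le_trans _ _ `|y + complex.Re (ip w w)|).
  by apply: le_trans (ler_norm _); rewrite lerDr.
rewrite -sqrtr_sqr ler_wsqrtr // !(mul0r, mul1r, mulr0, add0r, addr0, subr0).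
by rewrite lerDr sqr_ge0.
Qed.

(** The hypothesis on [p] makes the range of [K + i] dense; the a priori bound makes preimages of a
    convergent sequence Cauchy; and [K], being an adjoint, is closed and contains the limit. *)
Lemma resolvent_surjective (T K : set (E * E)) : ip_complete ip ->
  dissipative ip K -> K = adjoint_in ip setT T ->
  (forall p, (forall w z, K (w, z) -> ip (z + 'i *: w) p = 0) -> p = 0) ->
  forall F, exists w, K (w, F - 'i *: w).
Proof.
move=> cplt Kd KT defi F; have [[Ks _] _ _] := Kd; have [K0 KL] := Ks.
pose Ran : set E := [set y | exists w z, K (w, z) /\ y = z + 'i *: w].
have Rans : Defs.subspace Ran.
  split=> [|a _ _ [w [z [Kwz ->]]] [w' [z' [Kwz' ->]]]].
    by exists 0, 0; rewrite scaler0 addr0.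
  exists (a *: w + w'), (a *: z + z'); split; first exact: (KL a _ _ Kwz Kwz').
  by rewrite !scalerDr !scalerA mulrC addrACA.
have RanF : adherence ip Ran F.
  rewrite (dense_of_orthogonal cplt Rans) // => p pR; apply: defi => w z Kwz.
  by apply: pR; exists w, z.
have /choice[f fP] : forall n, exists f, K f /\ hnorm ip (F - (f.2 + 'i *: f.1)) < n.+1%:R^-1.
  move=> n; have [|_ [w [z [Kwz ->]]] Fn] := RanF n.+1%:R^-1.
    by rewrite invr_gt0.
  by exists (w, z).
have [|l lP] := cplt (fun n => (f n).1).
  move=> e e0; have [|N NP] := @natSinv_small (e / 2); first by rewrite divr_gt0.
  exists N => j k Nj Nk.
  have Kjk : K ((f j).1 - (f k).1, (f j).2 - (f k).2).
    have := subspaceB Ks (fP j).1 (fP k).1.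
    by case: (f j) (f k) => a b [].
  apply: le_lt_trans (hnorm_le_dissipative Kd Kjk) _.
  rewrite scalerBr addrACA -opprD.
  apply: le_lt_trans (ler_hnormB _ F _) _; rewrite [e]splitr ltrD //.
    by rewrite hnormC; apply: lt_trans (fP j).2 _; exact: NP.
  by apply: lt_trans (fP k).2 _; exact: NP.
exists l; rewrite KT; apply: adjoint_closed => e e0.
have e20 : 0 < e / 2 by rewrite divr_gt0.
have [N NP] := lP _ e20; have [N' NP'] := natSinv_small e20.
set n := maxn N N'; exists (f n).1, (f n).2; split.
- by rewrite -KT -surjective_pairing; case: (fP n).
- rewrite hnormC; apply: lt_trans (NP _ _) _; first exact: leq_maxl.
  by rewrite ltr_pdivrMr // ltr_pMr // ltr1n.
have -> : F - 'i *: l - (f n).2 = F - ((f n).2 + 'i *: (f n).1) + 'i *: ((f n).1 - l).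
  by rewrite scalerBr opprD !addrA subrK addrAC.
apply: le_lt_trans (hnormD _ _) _; rewrite [e]splitr ltrD //.
  by apply: lt_trans (fP n).2 _; apply: NP'; exact: leq_maxr.
rewrite hnormZ /= expr0n expr1n add0r sqrtr1 mul1r.
by apply: NP; exact: leq_maxl.
Qed.

(** For [(u, v)] in a dissipative extension [B], solve [(K + i) w = v + i u]. Then [u - w] is an
    eigenvector of [B] for [-i], so that [- |u - w|^2 >= 0] and [u = w] already belongs to the
    domain of [K]. *)
Lemma maximally_dissipative_adjoint (T K : set (E * E)) : ip_complete ip ->
  dissipative ip K -> K = adjoint_in ip setT T ->
  (forall p, (forall w z, K (w, z) -> ip (z + 'i *: w) p = 0) -> p = 0) ->
  maximally_dissipative ip K.
Proof.
move=> cplt Kd KT defi; split=> // B [[Bs _] _ Bd] KB.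
apply/seteqP; split=> // -[u v] Buv.
have [w Kw] := resolvent_surjective cplt Kd KT defi (v + 'i *: u).
have Buw : B (u - w, - ('i *: (u - w))).
  have := subspaceB Bs Buv (KB _ Kw).
  rewrite -[X in B X]/(u - w, v - (v + 'i *: u - 'i *: w)).
  by rewrite scalerBr !opprB opprD addrCA addNKr.
have uw : u = w.
  apply/eqP; rewrite -subr_eq0; apply/eqP; apply: (ip_eq0 ipP).
  have := Bd _ _ Buw; rewrite ipNr ipZr (ip_self (u - w)) /=.
  by have := ip_ge0 ipP (u - w); lra.
by rewrite uw in Buv *; move: Kw; rewrite uw addrK.
Qed.

Lemma span1_subspace g : @Defs.subspace R E (span1 g).
Proof.
split=> [|a _ _ [b ->] [c ->]]; first by exists 0; rewrite scale0r.
by exists (a * b + c); rewrite scalerDl scalerA.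
Qed.

Lemma ip_neq0 g : g <> 0 -> ip g g != 0.
Proof.
by move=> g0; apply/eqP => gg; apply: g0; apply: (ip_eq0 ipP); rewrite gg.
Qed.

Lemma orthogonal_part g u : g <> 0 -> ip g (u - (ip g u / ip g g) *: g) = 0.
Proof. by move=> g0; rewrite ipBr ipZr divfK ?subrr // ip_neq0. Qed.

(** By Pythagoras the component [d] of [u] orthogonal to [g] satisfies [|d| <= |u - b g|] for every
    scalar [b], so it vanishes when [u] is adherent to the line. *)
Lemma span1_closed g : g <> 0 -> closed_subspace ip (span1 g).
Proof.
move=> g0; split=> [|u uadh]; first exact: span1_subspace.
set c := ip g u / ip g g; set d := u - c *: g.
have gd : ip g d = 0 by exact: orthogonal_part.
suff : d = 0 by move=> /eqP; rewrite subr_eq0 => /eqP ->; exists c.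
apply: hnorm_eq0; apply/eqP; rewrite eq_le hnorm_ge0 andbT.
apply/ler_addgt0Pr => e e0; rewrite add0r; have [_ [b ->] ub] := uadh e e0.
apply: le_trans (ltW ub); rewrite -(@ler_pXn2r _ 2) ?nnegrE ?hnorm_ge0 //.
have -> : u - b *: g = d + (c - b) *: g by rewrite scalerBl addrA subrK.
move: gd; clearbody d => gd;
  rewrite !hnorm_sqr !(ipDl, ipDr, ipZl, ipZr) gd (ip_conj ipP g d) gd conjc0.
rewrite !(mulr0, addr0, add0r) (ip_self g); have := ip_ge0 ipP g.
case: (c - b) (ip d d) => x y [z w] /= gg.
by rewrite !(mul0r, subr0, addr0, mulr0, add0r) lerDl; nra.
Qed.

(** The symmetry hypothesis is what keeps the orthogonal complement of [g] invariant; on the line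
    itself [K] is multiplication by [l], which is selfadjoint because [l] is real. *)
Lemma span1_reducing_selfadjoint (K : set (E * E)) g (l : R) : g <> 0 ->
  linear_operator K -> K (g, l%:C *: g) ->
  (forall w z, K (w, z) -> ip g z = l%:C * ip g w) ->
  reducing_selfadjoint ip (span1 g) K.
Proof.
move=> g0 Klin Kg symm; have [Ks Kfun] := Klin; have [K0 KL] := Ks.
have Kag a : K (a *: g, l%:C *: (a *: g)).
  by have := subspaceZ a Ks Kg; rewrite scalerA mulrC -scalerA.
have Kval a v : K (a *: g, v) -> v = l%:C *: (a *: g).
  by move=> Kv; exact: Kfun Kv (Kag a).
split; split.
- exact: span1_closed.
- apply/seteqP; split=> u /=.
    move=> [v Kuv]; set c := ip g u / ip g g.
    exists (c *: g), (u - c *: g); split; last by rewrite addrC subrK.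
      by split; [exists (l%:C *: (c *: g))|exists c].
    split; first by exists (v - l%:C *: (c *: g)); exact: (subspaceB Ks Kuv (Kag c)).
    by move=> _ [b ->]; rewrite ipZl orthogonal_part // mulr0.
  move=> [v [w [[[v' Kv] _] [[w' Kw] _] ->]]].
  by exists (v' + w'); exact: (subspaceD Ks Kv Kw).
- by move=> u v Kuv [a ua]; subst u; rewrite (Kval _ _ Kuv) scalerA; exists (l%:C * a).
- move=> u v Kuv uorth _ [b ->]; rewrite ipZl (symm _ _ Kuv).
  by rewrite (uorth g) ?mulr0 //; exists 1; rewrite scale1r.
- split; last by move=> u v w [Kuv _] [Kuw _]; exact: Kfun Kuv Kuw.
  split; first by split=> //; have [] := span1_subspace g.
  move=> a [u v] [u' v'] [Kuv Mu] [Kuv' Mu']; split; first exact: KL.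
  by have [_] := span1_subspace g; apply.
- by move=> [u v] [Kuv [a /= ua]]; subst u; rewrite (Kval _ _ Kuv) scalerA; split;
    [exists a|exists (l%:C * a)].
- move=> u [a ->] e e0; exists (a *: g); last by rewrite subrr /hnorm ip0r sqrtr0.
  by exists (l%:C *: (a *: g)); split=> //; exists a.
apply/seteqP; split=> -[u v] /=.
  move=> [Kuv [a /= ua]]; subst u; rewrite (Kval _ _ Kuv); split=> /=.
  - by exists a.
  - by rewrite scalerA; exists (l%:C * a).
  move=> w z [Kwz [b /= wb]]; subst w; rewrite (Kval _ _ Kwz).
  rewrite !(ipZl, ipZr). by rewrite conjcR; ring.
move=> [/= [a ->] [b ->] adj]; split; last by exists a.
(* Testing on [g] alone suffices in a one-dimensional space: it yields [conj a * l = conj b], that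
   is [b = l a]. *)
have := adj _ _ (conj (Kag 1) (ex_intro _ 1 erefl)).
rewrite !scale1r !(ipZl, ipZr) mulrCA mulrA => /(mulIf (ip_neq0 g0)) ab.
have -> : b = l%:C * a by rewrite -[b]conjcK -ab conjcM conjcR conjcK.
by rewrite -scalerA.
Qed.

End InnerProductTheory.

(** * Primitives of locally integrable functions *)

Section Integrable.
Context d (T : measurableType d) (R : realType) (mu : {measure set T -> \bar R}).
Implicit Types (f g : T -> R) (D : set T).

Lemma integrableRD D f g : measurable D ->
  mu.-integrable D (EFin \o f) -> mu.-integrable D (EFin \o g) ->
  mu.-integrable D (EFin \o (fun x => f x + g x)).
Proof. by move=> mD fi gi; exact: integrableD fi gi. Qed.

Lemma integrableRB D f g : measurable D ->
  mu.-integrable D (EFin \o f) -> mu.-integrable D (EFin \o g) ->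
  mu.-integrable D (EFin \o (fun x => f x - g x)).
Proof. by move=> mD fi gi; exact: integrableB fi gi. Qed.

Lemma integrableRZ D f (c : R) : measurable D ->
  mu.-integrable D (EFin \o f) -> mu.-integrable D (EFin \o (fun x => c * f x)).
Proof. by move=> mD fi; exact: integrableZl fi. Qed.

Lemma integrable_measurable D f : mu.-integrable D (EFin \o f) -> measurable_fun D f.
Proof. by move=> /measurable_int /measurable_EFinP. Qed.

Lemma integrable_bounded_mul D f g (M : R) : measurable D ->
  measurable_fun D f -> (forall x, D x -> `|f x| <= M) ->
  mu.-integrable D (EFin \o g) -> mu.-integrable D (EFin \o (fun x => f x * g x)).
Proof.
move=> mD mf fM gi; have := @integrableMr _ _ R mu D mD f (EFin \o g) mf _ gi.
apply; exists M; split; first exact: num_real.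
by move=> N MN x Dx; apply: le_trans (fM x Dx) (ltW MN).
Qed.

End Integrable.

Section Fubini.
Context d1 d2 (T1 : measurableType d1) (T2 : measurableType d2) (R : realType).
Context (m1 : {sigma_finite_measure set T1 -> \bar R})
  (m2 : {sigma_finite_measure set T2 -> \bar R}).

(** For a product weight cut by a set, integrability on the product space is automatic, since the
    integrand is dominated by [|P x| |Q y|]. *)
Lemma Rintegral_fubini (P : T1 -> R) (Q : T2 -> R) (A : set (T1 * T2)) :
  m1.-integrable setT (EFin \o P) -> m2.-integrable setT (EFin \o Q) ->
  measurable A ->
  \int[m1]_x (P x * \int[m2]_y (Q y * \1_A (x, y))) =
  \int[m2]_y (Q y * \int[m1]_x (P x * \1_A (x, y))).
Proof.
move=> Pi Qi mA.
have mP : measurable_fun setT P by exact: integrable_measurable Pi.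
have mQ : measurable_fun setT Q by exact: integrable_measurable Qi.
pose h (z : T1 * T2) : \bar R := (P z.1 * Q z.2 * \1_A z)%:E.
have mh : measurable_fun setT h.
  apply/measurable_EFinP; apply: measurable_funM; last exact: measurable_indic.
  apply: measurable_funM.
    exact: (measurableT_comp mP measurable_fst).
  exact: (measurableT_comp mQ measurable_snd).
have mAx x : measurable_fun setT (fun y : T2 => \1_A (x, y) : R).
  by apply: measurableT_comp => //; exact: measurable_pair1.
have mAy y : measurable_fun setT (fun x : T1 => \1_A (x, y) : R).
  by apply: measurableT_comp => //; exact: measurable_pair2.
have Q1 x : m2.-integrable setT (EFin \o (fun y => Q y * \1_A (x, y))).
  under [X in _ \o X]eq_fun do rewrite mulrC.
  apply: (@integrable_bounded_mul _ _ _ _ _ _ _ 1) => // y _.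
  by rewrite indicE; case: (_ \in _); rewrite ?normr1 ?normr0.
have P1 y : m1.-integrable setT (EFin \o (fun x => P x * \1_A (x, y))).
  under [X in _ \o X]eq_fun do rewrite mulrC.
  apply: (@integrable_bounded_mul _ _ _ _ _ _ _ 1) => // x _.
  by rewrite indicE; case: (_ \in _); rewrite ?normr1 ?normr0.
have hi : (m1 \x m2)%E.-integrable setT h.
  apply: (integrable12ltyP m1 m2 mh).2 => /=.
  apply: (@le_lt_trans _ _ (\int[m1]_x (`|P x|%:E * \int[m2]_y `|Q y|%:E))%E).
    apply: ge0_le_integral => //.
    - by move=> x _; exact: integral_ge0.
    - have := measurable_fun_fubini_tonelli_F (m2 := m2) (abse \o h); apply.
        exact: measurableT_comp.
      by move=> x; exact: abse_ge0.
    - apply: emeasurable_funM => //.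
      by apply/measurable_EFinP; exact: measurableT_comp.
    move=> x _; rewrite -ge0_integralZl //; last first.
      by apply/measurable_EFinP; exact: measurableT_comp.
    apply: ge0_le_integral => //.
    - apply/measurable_EFinP; apply: measurableT_comp => //.
      by apply: measurable_funM => //; exact: measurable_funM.
    - apply: emeasurable_funM => //.
      by apply/measurable_EFinP; exact: measurableT_comp.
    move=> y _; rewrite /h /= -EFinM lee_fin normrM normrM -[leRHS]mulr1.
    rewrite ler_wpM2l // indicE; case: (_ \in _); by rewrite ?normr1 ?normr0.
  have /integrableP[_ Plt] := Pi; have /integrableP[_ Qlt] := Qi.
  rewrite ge0_integralZr //; first 1 last.
  - by apply/measurable_EFinP; exact: measurableT_comp.
  - exact: integral_ge0.
  by apply: lte_mul_pinfty => //; [exact: integral_ge0|rewrite ge0_fin_numE // integral_ge0].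
have := integral12_prod_meas1 hi; rewrite -(integral21_prod_meas1 hi) /fubini_F /fubini_G.
move=> /(congr1 fine).
congr (_ = _).
- congr fine; apply: eq_integral => x _; rewrite /h.
  under eq_integral do rewrite /= -mulrA EFinM.
  rewrite (integralZl measurableT (Q1 x)) [RHS]EFinM; congr (_ * _)%E.
  by rewrite /Rintegral fineK // integrable_fin_num // Q1.
- congr fine; apply: eq_integral => y _; rewrite /h.
  under eq_integral do rewrite /= [_ * Q _]mulrC -mulrA EFinM.
  rewrite (integralZl measurableT (P1 y)) [RHS]EFinM; congr (_ * _)%E.
  by rewrite /Rintegral fineK // integrable_fin_num // P1.
Qed.

End Fubini.

Section RealLine.
Context (R : realType).
Local Notation mu := (@lebesgue_measure R).
Implicit Types (f g : R -> R) (D : set R).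

Lemma integrable_continuous_mul (a b : R) f g :
  {within `[a, b], continuous f} -> mu.-integrable `[a, b] (EFin \o g) ->
  mu.-integrable `[a, b] (EFin \o (fun x => f x * g x)).
Proof.
move=> cf gi; have cpt := @segment_compact R a b.
have /compact_bounded[M [_ Mf]] := continuous_compact cf cpt.
apply: (@integrable_bounded_mul _ _ _ _ _ _ _ (M + 1)) => //.
  exact: subspace_continuous_measurable_fun.
by move=> x xab; apply: (Mf (M + 1)); [rewrite ltrDl|exists x].
Qed.

(** Fubini on the triangle [0 <= t <= s <= X]: exchanging the order leaves the integral of [p] over
    [[t, X]], written as a difference of two primitives. *)
Lemma integral_by_parts_integral (p q : R -> R) (X : R) :
  mu.-integrable `[0, X] (EFin \o p) -> mu.-integrable `[0, X] (EFin \o q) ->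
  \int[mu]_(s in `[0, X]) (p s * \int[mu]_(t in `[0, s]) q t) =
  \int[mu]_(t in `[0, X])
    (q t * (\int[mu]_(s in `[0, X]) p s - \int[mu]_(s in `[0, t]) p s)).
Proof.
move=> pI qI; set I := `[0, X]%classic.
pose T := measurableTypeR R.
pose A := [set z : T * T | z.2 <= z.1].
have mA : measurable A.
  have := @measurable_fun_le _ (T * T)%type R setT snd fst measurableT.
  by rewrite setTI; apply; [exact: measurable_snd|exact: measurable_fst].
have PI : mu.-integrable setT (EFin \o (p \_ I)).
  by rewrite -restrict_EFin; apply/integrable_restrict; rewrite ?setTI //; exact: measurable_itv.
have QI : mu.-integrable setT (EFin \o (q \_ I)).
  by rewrite -restrict_EFin; apply/integrable_restrict; rewrite ?setTI //; exact: measurable_itv.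
have := Rintegral_fubini (m1 := mu) (m2 := mu) PI QI mA.
congr (_ = _).
- rewrite [RHS]Rintegral_mkcond; apply: eq_Rintegral => s _.
  rewrite !patchE; case: ifPn => [/set_mem sI|_]; last by rewrite mul0r.
  congr (_ * _); rewrite [RHS]Rintegral_mkcond; apply: eq_Rintegral => t _.
  rewrite !patchE indicE /A.
  move: sI; rewrite /I /= in_itv /= => /andP[s0 sX].
  case: (boolP (t \in `[0, s]%classic)).
    rewrite inE /= in_itv /= => /andP[t0 ts].
    rewrite !mem_set ?mulr1 //=.
    by rewrite in_itv /= t0 (le_trans ts).
  move=> ts; have [tI|tI] := boolP (t \in I); last by rewrite mul0r.
  rewrite memNset ?mulr0 //= => ts'; move: ts; rewrite notin_setE; apply.
  by move: tI => /set_mem; rewrite /I /= !in_itv /= ts' => /andP[->].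
- rewrite [RHS]Rintegral_mkcond; apply: eq_Rintegral => t _.
  rewrite !patchE; case: ifPn => [/set_mem tI|_]; last by rewrite mul0r.
  congr (_ * _); move: tI; rewrite /I /= in_itv /= => /andP[t0 tX].
  rewrite (Rintegral_itvB pI) ?bnd_simp // Rintegral_itv_obnd_cbnd; last first.
    by apply: integrableS pI => //; apply: subset_itvr; rewrite bnd_simp.
  rewrite [RHS]Rintegral_mkcond; apply: eq_Rintegral => s _.
  rewrite !patchE indicE /A.
  case: (boolP (s \in `[t, X]%classic)).
    rewrite inE /= in_itv /= => /andP[ts sX].
    rewrite !mem_set ?mulr1 //=.
    by rewrite /I /= in_itv /= sX (le_trans t0).
  move=> ts; have [tI|tI] := boolP (s \in I); last by rewrite mul0r.
  rewrite memNset ?mulr0 //= => ts'; move: ts; rewrite notin_setE; apply.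
  by move: tI => /set_mem; rewrite /I /= !in_itv /= ts' => /andP[_ ->].
Qed.

End RealLine.

(* [f] is locally absolutely continuous on [0, +oo[ with derivative [f']. *)
Definition is_primitive (R : realType) (f f' : R -> R) : Prop :=
  (forall x, 0 <= x -> (@lebesgue_measure R).-integrable `[0, x] (EFin \o f')) /\
  (forall x, 0 <= x -> f x = f 0 + \int[@lebesgue_measure R]_(t in `[0, x]) f' t).

Section Primitives.
Context (R : realType).
Local Notation mu := (@lebesgue_measure R).
Local Notation Rplus := (`]0, +oo[%classic : set R).
Implicit Types (f g : R -> R) (D : set R).

Lemma is_primitive_integral f' c :
  (forall x, 0 <= x -> mu.-integrable `[0, x] (EFin \o f')) ->
  is_primitive (fun x => c + \int[mu]_(t in `[0, x]) f' t) f'.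
Proof. by move=> fi; split=> // x x0; rewrite set_itv1 Rintegral_set1 addr0. Qed.

Lemma is_primitiveD f f' g g' : is_primitive f f' -> is_primitive g g' ->
  is_primitive (fun x => f x + g x) (fun x => f' x + g' x).
Proof.
move=> [fi fE] [gi gE]; split=> x x0; first exact: integrableRD (fi x x0) (gi x x0).
by rewrite fE // gE // RintegralD ?(fi, gi) //; ring.
Qed.

Lemma is_primitiveZ f f' (c : R) : is_primitive f f' ->
  is_primitive (fun x => c * f x) (fun x => c * f' x).
Proof.
move=> [fi fE]; split=> x x0; first exact: integrableRZ (fi x x0).
by rewrite fE // RintegralZl ?fi //; ring.
Qed.

Lemma is_primitive_continuous_itv f f' b : is_primitive f f' ->
  {within `[0, b], continuous f}.
Proof.
move=> [fi fE]; have [b0|b0] := leP 0 b; last first.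
  by rewrite set_itv_ge ?bnd_simp -?ltNge //; exact: continuous_subspace0.
have ff : {in `[0, b]%classic, (fun x => f 0 + \int[mu]_(t in `[0, x]) f' t) =1 f}.
  by move=> x /set_mem /=; rewrite in_itv /= => /andP[x0 _]; rewrite -fE.
have := subspace_eq_continuous ff; apply => x.
have c1 := parameterized_integral_continuous b0 (fi b b0).
by apply: cvgD; [exact: cvg_cst|exact: c1].
Qed.

Lemma is_primitive_continuous f f' : is_primitive f f' ->
  {within `[0, +oo[, continuous f}.
Proof.
move=> pf; apply/subspace_continuousP => x /=; rewrite in_itv /= andbT => x0.
have /subspace_continuousP/(_ x) := is_primitive_continuous_itv (b := x + 1) pf.
rewrite /= in_itv /= x0 lerDl ler01 => /(_ isT).
move=> fx A fA.
have hA : nbhs x (fun y => `[0, x + 1]%classic y -> A (f y)) := fx A fA.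
change (nbhs x (fun y => `[0, +oo[%classic y -> A (f y))).
have : nbhs x [set y | y < x + 1] by apply: lt_nbhsl; rewrite ltrDl.
move=> /(filterI hA); apply: filterS => y [yA /= yx]; rewrite in_itv /= andbT => y0.
by apply: yA; rewrite /= in_itv /= y0 ltW.
Qed.

(** The product rule for absolutely continuous functions, obtained without pointwise derivatives.
    After the initial values are split off, what remains is the product of the two integrals, which
    the triangle identity distributes over the two terms. *)
Lemma is_primitiveM f f' g g' : is_primitive f f' -> is_primitive g g' ->
  is_primitive (fun x => f x * g x) (fun x => f' x * g x + f x * g' x).
Proof.
move=> pf pg; have [fi fE] := pf; have [gi gE] := pg.
have fg'i x : 0 <= x -> mu.-integrable `[0, x] (EFin \o (fun x => f x * g' x)).
  move=> x0; apply: integrable_continuous_mul (gi x x0).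
  exact: is_primitive_continuous_itv pf.
have f'gi x : 0 <= x -> mu.-integrable `[0, x] (EFin \o (fun x => f' x * g x)).
  move=> x0; under [X in _ \o X]eq_fun do rewrite mulrC.
  apply: integrable_continuous_mul (fi x x0).
  exact: is_primitive_continuous_itv pg.
split=> x x0; first exact: integrableRD (f'gi x x0) (fg'i x x0).
rewrite RintegralD ?(f'gi, fg'i) // (fE x) // (gE x) //.
set F := \int[mu]_(t in _) f' t; set G := \int[mu]_(t in _) g' t.
have -> : \int[mu]_(t in `[0, x]) (f' t * g t) =
    g 0 * F + \int[mu]_(t in `[0, x]) (f' t * (g t - g 0)).
  rewrite -RintegralZl ?fi // -RintegralD //; first last.
  - under [X in _ \o X]eq_fun do rewrite mulrBr; apply: integrableRB => //.
      exact: f'gi.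
    by under [X in _ \o X]eq_fun do rewrite mulrC; apply: integrableRZ => //; exact: fi.
  - by apply: integrableRZ => //; exact: fi.
  by apply: eq_Rintegral => t _; ring.
have -> : \int[mu]_(t in `[0, x]) (f t * g' t) =
    (f 0 + F) * G - \int[mu]_(t in `[0, x]) (g' t * (F - (f t - f 0))).
  rewrite -RintegralZl ?gi // -RintegralB //; first last.
  - have -> : (fun t => g' t * (F - (f t - f 0))) =
      (fun t => (F + f 0) * g' t - f t * g' t) by apply/funext => t; ring.
    apply: integrableRB => //; last exact: fg'i.
    by apply: integrableRZ => //; exact: gi.
  - by apply: integrableRZ => //; exact: gi.
  by apply: eq_Rintegral => t _; ring.
have -> : \int[mu]_(t in `[0, x]) (f' t * (g t - g 0)) =
    \int[mu]_(t in `[0, x]) (f' t * \int[mu]_(s in `[0, t]) g' s).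
  apply: eq_Rintegral => t /set_mem /=; rewrite in_itv /= => /andP[t0 _].
  by rewrite (gE t) // addrC addKr.
rewrite (integral_by_parts_integral (fi x x0) (gi x x0)).
have -> : \int[mu]_(t in `[0, x]) (g' t * (F - (f t - f 0))) =
    \int[mu]_(t in `[0, x]) (g' t * (F - \int[mu]_(s in `[0, t]) f' s)).
  apply: eq_Rintegral => t /set_mem /=; rewrite in_itv /= => /andP[t0 _].
  by rewrite (fE t) // [f 0 + _]addrC addrK.
ring.
Qed.

End Primitives.

(** * Test functions on the half-line *)

Section SmoothFunctions.
Context (R : realType).
Local Notation mu := (@lebesgue_measure R).
Implicit Types (f g : R -> R).

Definition smooth f := forall n x, derivable (derive1n n f) x 1.

(** Serves at the points where a bump function is glued to [0], in particular at the ends of its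
    support. *)
Lemma is_derive_quadratic f x (C : R) :
  (forall y, `|f y| <= C * (y - x) ^+ 2) -> is_derive x 1 f 0.
Proof.
move=> fC; have fx0 : f x = 0.
  by apply/eqP; rewrite -normr_eq0 eq_le normr_ge0 andbT (le_trans (fC x)) // subrr expr0n mulr0.
(* At [y = x] the slope function reads [0 / 0], which is [0] by convention and hence equals the
   derivative sought. *)
apply/is_derive1_caratheodory; exists (fun y => f y / (y - x)); split.
- move=> z; rewrite fx0 subr0; have [->|zx] := eqVneq z x.
    by rewrite fx0 !mul0r.
  by rewrite divfK // subr_eq0.
- apply/cvgrPdist_le => /= e e0; rewrite fx0 mul0r.
  have C0 : 0 < `|C| + 1 by rewrite ltr_wpDl.
  exists (e / (`|C| + 1)); first by rewrite /= divr_gt0.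
  move=> y /= xy; rewrite sub0r normrN normrM normfV.
  have [->|yx] := eqVneq y x; first by rewrite fx0 normr0 mul0r ltW.
  have yx0 : 0 < `|y - x| by rewrite normr_gt0 subr_eq0.
  rewrite ler_pdivrMr //; apply: le_trans (fC y) _.
  rewrite -real_normK ?num_real // expr2 mulrA ler_pM2r //.
  apply: (@le_trans _ _ ((`|C| + 1) * `|y - x|)).
    by rewrite ler_pM2r // (le_trans (ler_norm _)) // lerDl.
  by rewrite mulrC -ler_pdivlMr // distrC ltW.
by rewrite fx0 mul0r.
Qed.

Definition bump_poly (a b : R) : {poly R} := ('X - a%:P) * (b%:P - 'X).

(* Iterated derivatives of the bump [exp (- t / ((x - a) * (b - x)))] stay in
   this family. *)
Definition bump_fun (a b t : R) (P : {poly R}) n (x : R) : R :=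
  if a < x < b then
    P.[x] * (bump_poly a b).[x]^-1 ^+ n * expR (- t * (bump_poly a b).[x]^-1)
  else 0.

Lemma bump_polyE a b x : (bump_poly a b).[x] = (x - a) * (b - x).
Proof. by rewrite /bump_poly !hornerE. Qed.

Lemma bump_poly_gt0 a b x : a < x < b -> 0 < (bump_poly a b).[x].
Proof. by move=> /andP[ax xb]; rewrite bump_polyE mulr_gt0 // subr_gt0. Qed.

(** With [r = (x - a) (b - x)], the term of order [n + 2] of the exponential series gives [exp (- t
    / r) <= (n + 2)! (r / t)^(n + 2)]. This absorbs the pole [r^(- n)] and leaves a factor [r^2]. *)
Lemma bump_fun_quadratic a b t P n : 0 < t ->
  exists C, 0 <= C /\ forall x, a < x < b ->
    `|bump_fun a b t P n x| <= C * ((x - a) * (b - x)) ^+ 2.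
Proof.
move=> t0.
have cP : {within `[a, b], continuous (horner P)}.
  by apply: continuous_subspaceT; exact: continuous_horner.
have /compact_bounded[M [_ MP]] := continuous_compact cP (@segment_compact R a b).
have {}MP x : a < x < b -> `|P.[x]| <= `|M| + 1.
  move=> /andP[ax xb]; apply: (MP (`|M| + 1)).
    by rewrite (le_lt_trans (ler_norm _)) // ltrDl.
  by exists x => //=; rewrite in_itv /= !ltW.
have M0 : 0 <= `|M| + 1 by rewrite addr_ge0.
exists ((`|M| + 1) * (n.+2`!%:R / t ^+ n.+2)); split.
  by rewrite mulr_ge0 // divr_ge0 // exprn_ge0 // ltW.
move=> x xab; rewrite /bump_fun xab; have r0 := bump_poly_gt0 xab.
move: r0; rewrite bump_polyE; set r := (_ * _ : R) => r0.
rewrite normrM normrM -!mulrA ler_pM ?mulr_ge0 // ?MP //.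
rewrite [X in _ * X]gtr0_norm ?expR_gt0 // ger0_norm ?exprn_ge0 ?invr_ge0 ?(ltW r0) //.
have ge := @expR_ge1Dxn R (t * r^-1) n.+1 _.
have {}ge : (t * r^-1) ^+ n.+2 / n.+2`!%:R <= expR (t * r^-1).
  apply: le_trans (ge _); first by rewrite lerDr.
  by apply: mulr_ge0; rewrite ?invr_ge0 ltW.
rewrite mulNr expRN exprVn ler_pdivrMl ?exprn_gt0 //.
have fpos : 0 < (n.+2`!)%:R :> R by rewrite ltr0n fact_gt0.
have tpos : 0 < (t * r^-1) ^+ n.+2 / n.+2`!%:R.
  by rewrite divr_gt0 // exprn_gt0 // mulr_gt0 // invr_gt0.
apply: (@le_trans _ _ ((t * r^-1) ^+ n.+2 / n.+2`!%:R)^-1).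
  by rewrite lef_pV2 ?posrE ?expR_gt0.
rewrite le_eqVlt; apply/orP; left; apply/eqP.
rewrite exprMn invf_div exprVn !exprS; field.
by rewrite !gt_eqF // exprn_gt0.
Qed.

Lemma bump_fun_derive (a b t : R) (P : {poly R}) n : 0 < t ->
  exists Q, forall x : R, is_derive x 1 (bump_fun a b t P n) (bump_fun a b t Q n.+2 x).
Proof.
move=> t0; pose r := bump_poly a b.
(* The derivative of [P r^(- n) exp (- t / r)], put over the common denominator [r^(n + 2)]. *)
exists (P^`() * r ^+ 2 - n%:R *: (P * r^`() * r) + t *: (r^`() * P)) => x.
have [xab|xab] := boolP (a < x < b); last first.
  rewrite {2}/bump_fun (negbTE xab).
  have [C [C0 CP]] := bump_fun_quadratic a b P n t0.
  (* Since [x] lies outside [(a, b)], one of the factors [y - a] and [b - y] is at most [|y - x|],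
     and the other is at most [b - a]. *)
  apply: (@is_derive_quadratic _ _ (C * (b - a) ^+ 2)) => y.
  have [yab|yab] := boolP (a < y < b); last first.
    by rewrite /bump_fun (negbTE yab) normr0 mulr_ge0 ?sqr_ge0 // mulr_ge0 ?sqr_ge0.
  apply: le_trans (CP y yab) _; rewrite -mulrA ler_wpM2l // -exprMn.
  move: xab yab; rewrite negb_and -!leNgt => /orP[xa|bx] /andP[ay yb].
    rewrite ler_pXn2r ?nnegrE //; [|by apply: mulr_ge0; lra..].
    by rewrite mulrC; apply: ler_pM; lra.
  rewrite -(sqrrN ((b - a) * _)) -mulrN opprB ler_pXn2r ?nnegrE //; [|by apply: mulr_ge0; lra..].
  by apply: ler_pM; lra.
have r0 : r.[x] != 0 by rewrite gt_eqF // bump_poly_gt0.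
pose q y : R := r.[y]^-1.
pose G y : R := P.[y] * q y ^+ n * expR (- t * q y).
have dr := is_derive_poly r x.
pose d := - q x ^+ 2 * (r^`()).[x].
have dq : is_derive x 1 q d.
  have rder : derivable (horner r) x 1 by case: dr.
  apply: DeriveDef; first exact: derivableV.
  by rewrite deriveV // (@derive_val _ _ _ _ _ _ _ dr) /d /q exprVn.
have dqn : is_derive x 1 (fun y => q y ^+ n) (n%:R * q x ^+ n.-1 * d).
  have -> : (fun y => q y ^+ n) = q ^+ n by rewrite exprfctE.
  exact: is_deriveX.
have dtq : is_derive x 1 (fun y => - t * q y) (- t * d) by exact: is_deriveZ.
have de : is_derive x 1 (fun y => expR (- t * q y)) (expR (- t * q x) * (- t * d)).
  exact: (@is_derive1_comp _ expR (fun y => - t * q y)).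
have dG := is_deriveM (is_deriveM (is_derive_poly P x) dqn) de.
have nearG : \forall y \near x, G y = bump_fun a b t P n y.
  have xI : x \in `]a, b[ by rewrite in_itv.
  near=> y; rewrite /G /bump_fun /q ifT //.
  by near: y; have := near_in_itvoo xI; apply: filterS => y; rewrite in_itv.
apply: near_eq_is_derive nearG _; apply: is_derive_eq dG _.
rewrite /bump_fun xab -/r /GRing.scale /= -/(q x) /d; clearbody r.
rewrite mulrfctE !(hornerD, hornerN, hornerM, hornerZ, horner_exp).
have -> : r.[x] = (q x)^-1 by rewrite /q invrK.
have q0 : q x != 0 by rewrite invr_eq0.
case: (n) => [|m]; rewrite /= ?exprS; field.
Unshelve. all: by end_near. Qed.

End SmoothFunctions.

Section SmoothTheory.
Context (R : realType).
Local Notation mu := (@lebesgue_measure R).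
Local Notation Rplus := (`]0, +oo[%classic : set R).
Implicit Types (f g phi psi : R -> R).

Lemma smooth_bump_fun (a b t : R) P n : 0 < t -> smooth (bump_fun a b t P n).
Proof.
move=> t0 m; elim: m P n => [|m IH] P n x.
  by have [Q QP] := bump_fun_derive a b P n t0; have [] := QP x.
have [Q QP] := bump_fun_derive a b P n t0.
rewrite derive1Sn; have -> : derive1 (bump_fun a b t P n) = bump_fun a b t Q n.+2.
  by apply/funext => y; rewrite derive1E; exact: derive_val.
exact: IH.
Qed.

Lemma smooth_derive1 f : smooth f -> smooth (derive1 f).
Proof. by move=> sf n x; rewrite -derive1Sn; exact: sf. Qed.

Lemma smooth_continuous f : smooth f -> continuous f.
Proof.
by move=> sf x; apply/differentiable_continuous/derivable1_diffP; exact: (sf 0%N).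
Qed.

Lemma smooth_comb f g c : smooth f -> smooth g -> smooth (fun x => f x + c * g x).
Proof.
move=> sf sg; suff E n : derive1n n (fun x => f x + c * g x) =
    (fun x => derive1n n f x + c * derive1n n g x).
  by move=> n x; rewrite E; apply: derivableD; [exact: sf|apply: derivableZ; exact: sg].
elim: n => [//|n IH]; rewrite derive1nS IH; apply/funext => x.
rewrite derive1E (@deriveD _ _ _ (derive1n n f) (c *: derive1n n g)).
- by rewrite deriveZ ?[_ *: _]/(_ * _) -?derive1E //; exact: sg.
- exact: sf.
- by apply: derivableZ; exact: sg.
Qed.

Lemma derive1_comb f g c : smooth f -> smooth g ->
  derive1 (fun x => f x + c * g x) = (fun x => derive1 f x + c * derive1 g x).
Proof.
move=> sf sg; apply/funext => x.
rewrite derive1E (@deriveD _ _ _ f (c *: g)).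
- by rewrite deriveZ ?[_ *: _]/(_ * _) -?derive1E //; exact: (sg 0%N).
- exact: (sf 0%N).
- by apply: derivableZ; exact: (sg 0%N).
Qed.

Lemma is_primitive_C1 f f' : (forall x : R, is_derive x 1 f (f' x)) -> continuous f' ->
  is_primitive f f'.
Proof.
move=> df cf'; have df1 x : derivable f x 1 by case: (df x).
have cw (a b : R) : {within `[a, b], continuous f'} by exact: continuous_subspaceT.
split=> x x0.
  by apply: continuous_compact_integrable => //; exact: segment_compact.
move: x0; rewrite le_eqVlt => /predU1P[<-|x0].
  by rewrite set_itv1 Rintegral_set1 addr0.
rewrite /Rintegral (@continuous_FTC2 _ _ f 0 x) //=.
- by rewrite [RHS]addrC subrK.
- have cf : continuous f.
    by move=> y; apply/differentiable_continuous/derivable1_diffP.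
  split; [by move=> y _| |].
  + by apply: cvg_at_right_filter; exact: cf.
  + by apply: cvg_at_left_filter; exact: cf.
by move=> y _; rewrite derive1E; exact: derive_val.
Qed.

Lemma smooth_is_primitive f : smooth f -> is_primitive f (derive1 f).
Proof.
move=> sf; apply: is_primitive_C1; last exact/smooth_continuous/smooth_derive1.
by move=> x; apply: DeriveDef; [exact: (sf 0%N)|rewrite derive1E].
Qed.

Lemma test_bump (a b t : R) : 0 < a -> 0 < t -> test_function (bump_fun a b t 1 0).
Proof.
move=> a0 t0; split; first exact: smooth_bump_fun.
exists a, b; split=> // x ab; rewrite /bump_fun ifF //.
by apply/negbTE; rewrite negb_and -!leNgt; case: ab => /ltW ->; rewrite ?orbT.
Qed.

Lemma test_smooth phi : test_function phi -> smooth phi.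
Proof. by case. Qed.

Lemma test_supp phi : test_function phi ->
  exists a b, [/\ 0 < a, a < b & forall x, ~ (a <= x <= b) -> phi x = 0].
Proof.
(* The right end is enlarged because nothing forces [a < b] in the definition; when [b < a] the
   function is identically zero. *)
case=> _ [a [b [a0 ab]]]; exists a, (`|b| + a + 1); split=> //.
  by rewrite -addrA addrC -addrA ltrDl ltr_wpDr.
move=> x xab; apply: ab; have [ax|ax] := leP a x; last by left.
right; rewrite ltNge; apply/negP => xb; apply: xab; rewrite ax /=.
by apply: le_trans xb _; rewrite -addrA (le_trans (ler_norm b)) // lerDl addr_ge0 // ltW.
Qed.

Lemma test_comb phi psi c : test_function phi -> test_function psi ->
  test_function (fun x => phi x + c * psi x).
Proof.
move=> tp tq; split; first by apply: smooth_comb; exact: test_smooth.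
have [_ [a [b [a0 ab]]]] := tp; have [_ [a' [b' [a'0 ab']]]] := tq.
exists (Num.min a a'), (Num.max b b'); split; first by rewrite lt_min a0.
move=> x; rewrite lt_min gt_max => h; rewrite ab ?ab' ?mulr0 ?addr0 //.
  by case: h => /andP[]; [left|right].
by case: h => /andP[]; [left|right].
Qed.

Lemma test_derive1 phi : test_function phi -> test_function (derive1 phi).
Proof.
move=> tp; split; first exact/smooth_derive1/test_smooth.
have [_ [a [b [a0 ab]]]] := tp; exists a, b; split=> // x xab.
have phi0 : \forall y \near x, (fun=> 0) y = phi y.
  case: xab => [xa|bx].
    have : nbhs x [set y | y < a] by exact: lt_nbhsl.
    by apply: filterS => y /= ya; rewrite ab //; left.
  have : nbhs x [set y | b < y] by exact: lt_nbhsr.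
  by apply: filterS => y /= ya; rewrite ab //; right.
by rewrite derive1E -(near_eq_derive _ phi0) derive_cst.
Qed.

Lemma Rintegral_supp (D : set R) a b f : measurable D -> `[a, b]%classic `<=` D ->
  (forall x, ~ (a <= x <= b) -> f x = 0) ->
  \int[mu]_(x in D) f x = \int[mu]_(x in `[a, b]) f x.
Proof.
move=> mD abD f0; rewrite [LHS]Rintegral_mkcond [RHS]Rintegral_mkcond.
congr (Rintegral _ _ _); apply/funext => x; rewrite !patchE.
have [xab|xab] := boolP (a <= x <= b).
  by rewrite !mem_set //=; apply: abD; rewrite /= in_itv.
by rewrite f0 ?if_same //; apply/negP.
Qed.

Lemma integrable_supp (D : set R) a b f : measurable D -> `[a, b]%classic `<=` D ->
  (forall x, ~ (a <= x <= b) -> f x = 0) ->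
  mu.-integrable `[a, b] (EFin \o f) -> mu.-integrable D (EFin \o f).
Proof.
move=> mD abD f0 fi.
have fE : EFin \o f = (EFin \o f) \_ `[a, b].
  apply/funext => x; rewrite patchE; case: ifPn => // xab /=.
  by rewrite f0 // => xab'; move: xab; rewrite notin_setE; apply; rewrite /= in_itv.
rewrite fE; apply/integrable_restrict => //.
by rewrite setIidr.
Qed.

Lemma subset_Rplus (a b : R) : 0 < a -> `[a, b]%classic `<=` Rplus.
Proof.
move=> a0 x /=; rewrite !in_itv /= andbT => /andP[ax _].
exact: lt_le_trans ax.
Qed.

Definition locally_int (w : R -> R) :=
  forall a b : R, 0 < a -> mu.-integrable `[a, b] (EFin \o w).

Lemma integrable_test w phi : locally_int w -> test_function phi ->
  mu.-integrable Rplus (EFin \o (fun x => w x * phi x)).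
Proof.
move=> wi tp; have [a [b [a0 _ phi0]]] := test_supp tp.
apply: (@integrable_supp _ a b) => //; first exact: subset_Rplus.
  by move=> x xab; rewrite phi0 // mulr0.
under [X in _ \o X]eq_fun do rewrite mulrC.
apply: integrable_continuous_mul; last exact: wi.
by apply: continuous_subspaceT; exact/smooth_continuous/test_smooth.
Qed.

Lemma locally_int_cst (c : R) : locally_int (fun=> c).
Proof.
move=> a b _; apply: continuous_compact_integrable; first exact: segment_compact.
by apply: continuous_subspaceT => x; exact: cvg_cst.
Qed.

Lemma integrable_testT phi : test_function phi -> mu.-integrable Rplus (EFin \o phi).
Proof.
move=> /(integrable_test (@locally_int_cst 1)).
by under [X in _ \o X]eq_fun do rewrite mul1r.
Qed.

(** The primitive from [-oo] vanishes to the left of the support trivially and to its right because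
    the total integral is zero. *)
Lemma test_primitive psi : test_function psi -> \int[mu]_(x in Rplus) psi x = 0 ->
  exists2 phi, test_function phi & derive1 phi = psi.
Proof.
move=> tp int0; have [a [b [a0 _ psi0]]] := test_supp tp.
have spsi := test_smooth tp; have cpsi := smooth_continuous spsi.
have iab : mu.-integrable `[a, b] (EFin \o psi).
  apply: continuous_compact_integrable; first exact: segment_compact.
  exact: continuous_subspaceT.
have iT : mu.-integrable setT (EFin \o psi) by exact: (@integrable_supp _ a b).
pose phi (x : R) := \int[mu]_(t in `]-oo, x]) psi t.
have dphi x : derivable phi x 1 /\ derive1 phi x = psi x.
  apply: (@continuous_FTC1 _ _ -oo%O x (x + 1)) => //.
  - by rewrite ltrDl.
  - by apply: integrableS iT.
  - by rewrite ltNyr.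
  - exact: cpsi.
have phi'E : derive1 phi = psi by apply/funext => x; have [] := dphi x.
exists phi => //; split.
  move=> [|n] x; first by have [] := dphi x.
  by rewrite derive1Sn phi'E; exact: spsi.
exists a, b; split=> // x [xa|bx].
  rewrite /phi -[RHS](@Rintegral_set0 _ _ _ mu psi) [LHS]Rintegral_mkcond [RHS]Rintegral_mkcond.
  congr (Rintegral _ _ _); apply/funext => y; rewrite !patchE in_set0; case: ifPn => // /set_mem /=.
  rewrite in_itv /= => yx; apply: psi0 => /andP[ay _].
  by move: (le_lt_trans yx xa); rewrite ltNge ay.
rewrite /phi -int0 (@Rintegral_supp Rplus a b) //; last exact: subset_Rplus.
apply: Rintegral_supp => //.
by move=> y /=; rewrite !in_itv /= => /andP[_ yb]; exact: le_trans yb (ltW bx).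
Qed.

(** The product rule on an interval at both ends of which [phi] vanishes, so that no boundary term
    is left. *)
Lemma test_by_parts F f phi : is_primitive F f -> test_function phi ->
  \int[mu]_(x in Rplus) (F x * derive1 phi x) = - \int[mu]_(x in Rplus) (f x * phi x).
Proof.
move=> pF tp; have [a [b [a0 ab phi0]]] := test_supp tp.
have tp' := test_derive1 tp.
have [fi _] := pF; have sphi := test_smooth tp.
have phi'0 x : ~ (a <= x <= b) -> derive1 phi x = 0.
  move=> xab; have [_ [a' [b' _]]] := tp'.
  have phi00 : \forall y \near x, (fun=> 0) y = phi y.
    have [ax|ax] := leP a x; last first.
      have : nbhs x [set y | y < a] by exact: lt_nbhsl.
      by apply: filterS => y /= ya; rewrite phi0 // => /andP[]; rewrite leNgt ya.
    have bx : b < x by rewrite ltNge; apply/negP => xb; apply: xab; rewrite ax.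
    have : nbhs x [set y | b < y] by exact: lt_nbhsr.
    by apply: filterS => y /= ya; rewrite phi0 // => /andP[_]; rewrite leNgt ya.
  by rewrite derive1E -(near_eq_derive _ phi00) derive_cst.
(* The interval ends at [b + 1]: [phi] is only known to vanish strictly beyond [b]. *)
have b0 : 0 <= b + 1 by lra.
have [prodi prodE] := is_primitiveM pF (smooth_is_primitive sphi).
have := prodE _ b0; rewrite !phi0 ?mulr0 ?add0r; [|by lra..].
have sub0 : `[a, b]%classic `<=` `[0, b + 1]%classic.
  by move=> x /=; rewrite !in_itv /= => /andP[ax xb]; lra.
have cI (D : set R) : measurable D -> `[a, b]%classic `<=` D ->
    \int[mu]_(x in D) (f x * phi x + F x * derive1 phi x) =
    \int[mu]_(x in `[a, b]) (f x * phi x + F x * derive1 phi x).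
  move=> mD abD; apply: Rintegral_supp => // x xab.
  by rewrite phi0 // phi'0 // !mulr0 addr0.
rewrite cI // -(cI Rplus) //; last exact: subset_Rplus.
have lf : locally_int f.
  move=> c d c0; have [cd|cd] := leP 0 d; last first.
    by rewrite set_itv_ge ?bnd_simp -?ltNge ?(lt_trans cd) //; exact: integrable_set0.
  apply: integrableS (fi d cd) => //; apply: subset_itvr; rewrite bnd_simp; exact: ltW.
have lF : locally_int F.
  move=> c d c0; apply: continuous_compact_integrable; first exact: segment_compact.
  apply: continuous_subspaceW (is_primitive_continuous_itv (b := d) pF).
  by apply: subset_itvr; rewrite bnd_simp; exact: ltW.
rewrite RintegralD //; [|exact: integrable_test..].
by move=> /eqP; rewrite eq_sym addrC addr_eq0 => /eqP.
Qed.

End SmoothTheory.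

(** * Weak derivatives *)

Section FundamentalLemma.
Context (R : realType).
Local Notation mu := (@lebesgue_measure R).
Local Notation Rplus := (`]0, +oo[%classic : set R).
Implicit Types (f g w phi psi : R -> R).

Lemma integrable_locally_int w (a b : R) : 0 < a -> locally_int w ->
  mu.-integrable `]a, b[ (EFin \o w).
Proof.
move=> a0 wi; apply: integrableS (wi a b a0) => //.
by apply: subset_itv; rewrite bnd_simp.
Qed.

Lemma bump_fun1E a b t (x : R) : a < x < b ->
  bump_fun a b t 1 0 x = expR (- t * (bump_poly a b).[x]^-1).
Proof. by move=> xab; rewrite /bump_fun xab hornerC expr0 !mul1r. Qed.

(** The bumps [exp (- t / r)] with [t = 1 / (n + 1)] are bounded by [1] and tend to [1] on [(a, b)],
    so dominated convergence replaces the test function by the indicator of the interval. *)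
Lemma integral_test0_itv w (a b : R) : 0 < a -> locally_int w ->
  (forall phi, test_function phi -> \int[mu]_(x in Rplus) (w x * phi x) = 0) ->
  \int[mu]_(x in `]a, b[) w x = 0.
Proof.
move=> a0 wi w0.
pose phi n := bump_fun a b n.+1%:R^-1 1 0.
have tphi n : test_function (phi n) by apply: test_bump.
have phi01 n x : `|phi n x| <= 1.
  rewrite /phi; have [xab|xab] := boolP (a < x < b); last first.
    by rewrite /bump_fun (negbTE xab) normr0.
  rewrite bump_fun1E // gtr0_norm ?expR_gt0 // -expR0 ler_expR mulNr oppr_le0.
  by rewrite mulr_ge0 // invr_ge0 // ltW // bump_poly_gt0.
have int0 n : \int[mu]_(x in `]a, b[) (w x * phi n x) = 0.
  rewrite -(w0 (phi n)) // [LHS]Rintegral_mkcond [RHS]Rintegral_mkcond.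
  congr (Rintegral _ _ _); apply/funext => x; rewrite !patchE.
  have [xab|xab] := boolP (a < x < b).
    by rewrite !mem_set //= in_itv /= andbT; case/andP: xab => /(lt_trans a0).
  by rewrite /phi /bump_fun (negbTE xab) !mulr0 !if_same.
have wI : mu.-integrable `]a, b[ (EFin \o w) by exact: integrable_locally_int.
have mw := integrable_measurable wI.
have [] := @dominated_convergence _ _ R mu `]a, b[%classic (measurable_itv _)
  (fun n x => (w x * phi n x)%:E) (EFin \o w) (EFin \o (fun x => `|w x|)).
- move=> n; apply/measurable_EFinP; apply: measurable_funM => //.
  apply: measurable_funS (measurableT) _ _ => //.
  apply: continuous_measurable_fun; exact/smooth_continuous/test_smooth.
- exact/measurable_EFinP.
- apply: aeW => x /=; rewrite in_itv /= => xab.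
  apply: cvg_EFin; first by apply: nearW.
  rewrite -[X in _ --> X]mulr1; apply: cvgM; first exact: cvg_cst.
  have pE : phi ^~ x = fun n => expR (- n.+1%:R^-1 * (bump_poly a b).[x]^-1).
    by apply/funext => n; rewrite /phi bump_fun1E.
  rewrite -/(phi ^~ x) pE.
  rewrite -[X in _ --> X]expR0; apply: continuous_cvg; first exact: continuous_expR.
  rewrite -[X in _ --> X](mul0r (bump_poly a b).[x]^-1); apply: cvgM; last exact: cvg_cst.
  by rewrite -[X in _ --> X]oppr0; apply: cvgN; exact: cvg_harmonic.
- exact: integrable_norm.
- apply: aeW => x n _ /=; rewrite lee_fin normrM -[leRHS]mulr1.
  by rewrite ler_wpM2l.
move=> _ _; have -> : (fun n => \int[mu]_(x in `]a, b[) (w x * phi n x)%:E)%E = (fun=> 0%E).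
  apply/funext => n /=; move: (congr1 EFin (int0 n)).
  rewrite /Rintegral fineK //; apply: integrable_fin_num => //.
  apply: integrableS (integrable_test wi (tphi n)) => // x /=;
    rewrite !in_itv /= andbT => /andP[ax _].
  exact: lt_trans ax.
move=> cvw; rewrite /Rintegral.
suff -> : (\int[mu]_(x in `]a, b[) (w x)%:E = 0)%E by [].
exact: (cvg_unique (@ereal_hausdorff R) cvw (cvg_cst _)).
Qed.

(** All integrals of [w] over [(a, y)] vanish, and by Lebesgue differentiation their derivative in
    [y] is [w] almost everywhere. The intervals [(1 / (n + 1), n + 1)] exhaust the half-line. *)
Lemma fundamental_lemma w : locally_int w ->
  (forall phi, test_function phi -> \int[mu]_(x in Rplus) (w x * phi x) = 0) ->
  ae_plus (fun x => w x = 0).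
Proof.
move=> wi w0.
have key n : {ae mu, forall x, n.+1%:R^-1 < x < n.+1%:R -> w x = 0}.
  set a : R := n.+1%:R^-1; set b : R := n.+1%:R; have a0 : 0 < a by rewrite invr_gt0.
  pose I := `]a, b[%classic : set R; pose f := w \_ I.
  have wI : mu.-integrable I (EFin \o w) by exact: integrable_locally_int.
  have fT : mu.-integrable setT (EFin \o f).
    by rewrite -restrict_EFin; apply/integrable_restrict; rewrite ?setTI //; exact: measurable_itv.
  have fy (y : R) : mu.-integrable `]a, y] (EFin \o f) by apply: integrableS fT.
  have lf : locally_integrable setT f by apply: integrable_locally => //; exact: measurable_itv.
  have := FTC1 (a := BRight a) fy lf.
  apply: (@filterS _ _ (ae_filter_ringOfSetsType mu)) => x /= FTCx /andP[ax xb].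
  have <- : f x = w x by rewrite /f patchE mem_set // /I /= in_itv /= ax.
  have [|_ <-] := FTCx; first exact: ax.
  have F0 : \forall y \near x,
      (fun=> 0) y = \int[mu]_(t in [set` Interval (BRight a) (BRight y)]) f t.
    have xI : x \in `]a, b[ by rewrite in_itv /= ax.
    have := near_in_itvoo xI; apply: filterS => y; rewrite in_itv /= => /andP[ay yb].
    rewrite -(integral_test0_itv y a0 wi w0) Rintegral_itv_bndo_bndc; last first.
      exact: integrable_locally_int.
    apply: eq_Rintegral => z /set_mem /=; rewrite in_itv /= => /andP[az zy].
    by rewrite /f patchE mem_set // /I /= in_itv /= az (le_lt_trans zy).
  by rewrite derive1E -(near_eq_derive _ F0) derive_cst.
have /ae_foralln := key; apply: (@filterS _ _ (ae_filter_ringOfSetsType mu)) => x h x0.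
have [N NP] := natSinv_small x0.
have [|M MP] := @natSinv_small R x^-1; first by rewrite invr_gt0.
apply: (h (maxn N M)); rewrite NP ?leq_maxl //=.
by rewrite -ltf_pV2 ?posrE // MP // leq_maxr.
Qed.

End FundamentalLemma.

(** * Distributions with vanishing first or second derivative, and primitives of weak derivatives *)

Section DuBoisReymond.
Context (R : realType).
Local Notation mu := (@lebesgue_measure R).
Local Notation Rplus := (`]0, +oo[%classic : set R).
Implicit Types (f g w u v phi psi : R -> R).

Lemma ae_plusS (P Q : R -> Prop) :
  (forall x, 0 < x -> P x -> Q x) -> ae_plus P -> ae_plus Q.
Proof. move=> PQ Pae; apply: (ae_plusS2 _ Pae (Pae)) => x x0 Px _; exact: PQ. Qed.

Lemma ae_plus_exists (P : R -> Prop) a b : 0 <= a -> a < b -> ae_plus P ->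
  exists x, a < x < b /\ P x.
Proof.
move=> a0 ab [N [mN N0 PN]]; apply: contrapT => nP.
have IN : `]a, b[%classic `<=` N.
  move=> x /=; rewrite in_itv /= => xab; apply: PN => /= Px.
  by apply: nP; exists x; split=> //; apply: Px; case/andP: xab => /(le_lt_trans a0).
have : (mu `]a, b[ <= mu N)%E by apply: le_measure; rewrite ?inE.
rewrite [leRHS](_ : _ = 0%E) // lebesgue_measure_itv /= lte_fin ab -EFinB lee_fin.
by rewrite subr_le0 leNgt ab.
Qed.

Lemma locally_intB w v : locally_int w -> locally_int v ->
  locally_int (fun x => w x - v x).
Proof. by move=> wi vi a b a0; apply: integrableRB => //; [exact: wi|exact: vi]. Qed.

Lemma locally_int_is_primitive F f : is_primitive F f -> locally_int F.
Proof.
move=> pF c d c0; apply: continuous_compact_integrable; first exact: segment_compact.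
apply: continuous_subspaceW (is_primitive_continuous_itv (b := d) pF).
by apply: subset_itvr; rewrite bnd_simp; exact: ltW.
Qed.

(** If no test function had integral [1], then by scaling all integrals would be [0], and the
    fundamental lemma applied to the constant [1] would give [1 = 0]. *)
Lemma exists_test_integral1 : exists2 theta : R -> R, test_function theta &
  \int[mu]_(x in Rplus) theta x = 1.
Proof.
apply: contrapT => no.
have int0 phi : test_function phi -> \int[mu]_(x in Rplus) (1 * phi x) = 0.
  move=> tp; under eq_Rintegral do rewrite mul1r.
  apply: contrapT => /eqP I0; apply: no.
  set I := (X in X != 0) in I0.
  (* This is [phi / I], written in the form of a combination covered by [test_comb]. *)
  exists (fun x => phi x + (I^-1 - 1) * phi x); first exact: test_comb.
  have pI := integrable_testT tp.
  rewrite RintegralD //; last exact: integrableRZ.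
  by rewrite RintegralZl // -/I; field.
have := fundamental_lemma (@locally_int_cst R 1) int0.
by move=> /(@ae_plus_exists _ 0 1 (lexx _) ltr01) [x [_ /eqP]]; rewrite oner_eq0.
Qed.

(** Subtracting the multiple of [theta] that carries the integral of [psi] leaves a mean-zero test
    function, which has a test primitive. *)
Lemma test_decomposition theta psi : test_function theta ->
  \int[mu]_(x in Rplus) theta x = 1 -> test_function psi ->
  exists2 phi, test_function phi &
    forall x, psi x = derive1 phi x + (\int[mu]_(x in Rplus) psi x) * theta x.
Proof.
move=> tt t1 tp; set I := \int[mu]_(x in _) psi x.
have [||phi tphi phi'] := @test_primitive R (fun x => psi x + (- I) * theta x).
- exact: test_comb.
- have ti := integrable_testT tt; have pi := integrable_testT tp.
  rewrite RintegralD //; last exact: integrableRZ.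
  by rewrite RintegralZl // t1 -/I; ring.
by exists phi => // x; rewrite phi'; ring.
Qed.

(** Decomposing a test function as [phi' + I theta] kills the first part, so [w] acts as [c] times
    the integral, where [c] is its pairing with [theta]. *)
Lemma du_bois_reymond w : locally_int w ->
  (forall phi, test_function phi -> \int[mu]_(x in Rplus) (w x * derive1 phi x) = 0) ->
  exists c, ae_plus (fun x => w x = c).
Proof.
move=> wi w0; have [theta tt t1] := exists_test_integral1.
set c := \int[mu]_(x in Rplus) (w x * theta x); exists c.
suff : ae_plus (fun x => w x - c = 0).
  by apply: ae_plusS => x _ /eqP; rewrite subr_eq0 => /eqP.
apply: fundamental_lemma; first exact: locally_intB wi (locally_int_cst _).
move=> psi tp; have [phi tphi psiE] := test_decomposition tt t1 tp.
set I := \int[mu]_(x in _) psi x in psiE.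
have wt := integrable_test wi tt; have wp := integrable_test wi (test_derive1 tphi).
have pi := integrable_testT tp.
transitivity (\int[mu]_(x in Rplus)
    ((w x * derive1 phi x + I * (w x * theta x)) - c * psi x)).
  by apply: eq_Rintegral => x _; rewrite mulrBl {1}psiE; ring.
rewrite RintegralB //; [|by apply: integrableRD => //; exact: integrableRZ
  |exact: integrableRZ].
rewrite RintegralD //; last exact: integrableRZ.
by rewrite w0 // !RintegralZl // -/c -/I; ring.
Qed.

Lemma is_primitive_id : is_primitive (fun x : R => x) (fun=> 1).
Proof.
split=> x x0.
  apply: continuous_compact_integrable; first exact: segment_compact.
  by apply: continuous_subspaceT => y; exact: cvg_cst.
rewrite Rintegral_cst // add0r mul1r [X in fine X]lebesgue_measure_itv /= lte_fin.
by move: x0; rewrite le_eqVlt => /predU1P[<-|->] /=; rewrite ?ltxx ?oppr0 ?addr0.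
Qed.

Lemma is_primitive_cst (c : R) : is_primitive (fun=> c) (fun=> 0).
Proof.
have := is_primitive_integral (f' := fun=> 0 : R) c _.
rewrite [X in is_primitive X](_ : _ = fun=> c); last first.
  by apply/funext => x; rewrite Rintegral_cst // mul0r addr0.
by apply=> x _; exact: integrable0.
Qed.

(** The slope [c] is the distributional derivative of [w] paired with [theta]. By the same
    decomposition [w - c x] annihilates all derivatives of test functions, which reduces the claim
    to the first-order case. *)
Lemma du_bois_reymond2 w : locally_int w ->
  (forall phi, test_function phi ->
    \int[mu]_(x in Rplus) (w x * derive1 (derive1 phi) x) = 0) ->
  exists c d, ae_plus (fun x => w x = d + c * x).
Proof.
move=> wi w0; have [theta tt t1] := exists_test_integral1.
set c := - \int[mu]_(x in Rplus) (w x * derive1 theta x).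
have lin : is_primitive (fun x : R => c * x) (fun=> c * 1).
  exact: is_primitiveZ is_primitive_id.
have [||d dP] := @du_bois_reymond (fun x => w x - c * x).
- by apply: locally_intB => //; exact: locally_int_is_primitive lin.
- move=> psi tp; have [phi tphi psiE] := test_decomposition tt t1 tp.
  set I := \int[mu]_(x in _) psi x in psiE.
  have psi'E x : derive1 psi x = derive1 (derive1 phi) x + I * derive1 theta x.
    rewrite [psi](_ : _ = (fun x => derive1 phi x + I * theta x)); last exact/funext.
    by rewrite derive1_comb //; [exact/smooth_derive1/test_smooth|exact: test_smooth].
  have wt := integrable_test wi (test_derive1 tt).
  have wp := integrable_test wi (test_derive1 (test_derive1 tphi)).
  have li := integrable_test (locally_int_is_primitive lin) (test_derive1 tp).
  transitivity (\int[mu]_(x in Rplus)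
    ((w x * derive1 (derive1 phi) x + I * (w x * derive1 theta x))
       - (c * x) * derive1 psi x)).
    by apply: eq_Rintegral => x _; rewrite mulrBl {1}psi'E; ring.
  rewrite RintegralB //; last by apply: integrableRD => //; exact: integrableRZ.
  rewrite (test_by_parts lin tp) RintegralD //; last exact: integrableRZ.
  rewrite w0 // !RintegralZl // -/I; last exact: integrable_testT.
  by rewrite -[X in I * X]opprK -/c; ring.
exists c, d; apply: ae_plusS dP => x _ /eqP; rewrite subr_eq addrC => /eqP ->.
by rewrite addrC.
Qed.

Definition weak_derivativeR u v := forall phi, test_function phi ->
  \int[mu]_(x in Rplus) (u x * derive1 phi x) = - \int[mu]_(x in Rplus) (v x * phi x).

Lemma eq_ae_plus_Rintegral f g : measurable_fun Rplus f -> measurable_fun Rplus g ->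
  ae_plus (fun x => f x = g x) ->
  \int[mu]_(x in Rplus) f x = \int[mu]_(x in Rplus) g x.
Proof.
move=> mf mg fg; congr fine; apply: ae_eq_integral => //; try exact/measurable_EFinP.
apply: (@filterS _ _ (ae_filter_ringOfSetsType mu)) fg => x fgx /=.
by rewrite in_itv /= andbT => /fgx ->.
Qed.

Lemma is_primitive_weak u f v : locally_int u -> is_primitive f v ->
  ae_plus (fun x => u x = f x) -> weak_derivativeR u v.
Proof.
move=> ui pf uf phi tp; rewrite -(test_by_parts pf tp).
have tp' := test_derive1 tp; have fi := locally_int_is_primitive pf.
apply: eq_ae_plus_Rintegral.
- exact: integrable_measurable (integrable_test ui tp').
- exact: integrable_measurable (integrable_test fi tp').
by apply: ae_plusS uf => x _ ->.
Qed.

(** The difference between [u] and the integral of [v] from [0] has zero weak derivative, hence is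
    constant. Integrability of [v] down to [0] is what gives a representative continuous at the
    boundary. *)
Lemma weak_derivative_is_primitive u v :
  locally_int u -> (forall x, 0 <= x -> mu.-integrable `[0, x] (EFin \o v)) ->
  weak_derivativeR u v ->
  exists2 f, is_primitive f v & ae_plus (fun x => u x = f x).
Proof.
move=> ui vi uv; have pv := is_primitive_integral 0 vi.
set F := (fun x => _) in pv.
have lF := locally_int_is_primitive pv.
have [||c cP] := @du_bois_reymond (fun x => u x - F x).
- exact: locally_intB.
- move=> phi tp; have tp' := test_derive1 tp.
  under eq_Rintegral do rewrite mulrBl.
  rewrite RintegralB //; [|exact: integrable_test..].
  by rewrite uv // (test_by_parts pv tp) subrr.
exists (fun x => F x + c).
  have := is_primitiveD pv (is_primitive_cst c).
  by rewrite [X in is_primitive _ X](_ : _ = v) //; apply/funext => x; rewrite addr0.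
by apply: ae_plusS cP => x _ /eqP; rewrite subr_eq addrC => /eqP.
Qed.

(** For elements of an adjoint only the second derivative is known. Subtracting the double integral
    of [q] leaves an affine function, so the first derivative comes for free. *)
Lemma weak_second_derivative u q :
  locally_int u -> (forall x, 0 <= x -> mu.-integrable `[0, x] (EFin \o q)) ->
  (forall phi, test_function phi ->
    \int[mu]_(x in Rplus) (u x * derive1 (derive1 phi) x) =
    \int[mu]_(x in Rplus) (q x * phi x)) ->
  exists f0 f1, [/\ is_primitive f0 f1, is_primitive f1 q & ae_plus (fun x => u x = f0 x)].
Proof.
move=> ui qi uq; have pq := is_primitive_integral 0 qi.
set F := (fun x => _) in pq.
have Fi x : 0 <= x -> mu.-integrable `[0, x] (EFin \o F).
  move=> _; apply: continuous_compact_integrable; first exact: segment_compact.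
  exact: is_primitive_continuous_itv pq.
have pF := is_primitive_integral 0 Fi; set G := (fun x => _) in pF.
have [||c [d cd]] := @du_bois_reymond2 (fun x => u x - G x).
- by apply: locally_intB => //; exact: locally_int_is_primitive pF.
- move=> phi tp; have tp' := test_derive1 tp; have tp'' := test_derive1 tp'.
  under eq_Rintegral do rewrite mulrBl.
  rewrite RintegralB //; [|exact: integrable_test|
    by apply: integrable_test => //; exact: locally_int_is_primitive pF].
  by rewrite uq // (test_by_parts pF tp') (test_by_parts pq tp) opprK subrr.
exists (fun x => G x + (d + c * x)), (fun x => F x + c); split.
- have := is_primitiveD pF (is_primitiveD (is_primitive_cst d) (is_primitiveZ c is_primitive_id)).
  by rewrite [X in is_primitive _ X](_ : _ = fun x => F x + c) //; apply/funext => x;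
    rewrite add0r mulr1.
- have := is_primitiveD pq (is_primitive_cst c).
  by rewrite [X in is_primitive _ X](_ : _ = q) //; apply/funext => x; rewrite addr0.
by apply: ae_plusS cd => x _ /eqP; rewrite subr_eq addrC => /eqP.
Qed.

End DuBoisReymond.

(** * Completeness of L^2(R^+) *)

Section SquareIntegrable.
Context (R : realType).
Local Notation mu := (@lebesgue_measure R).
Local Notation Rplus := (`]0, +oo[%classic : set R).
Implicit Types (f g h : R -> R).

Lemma ae_plus_filter (P : R -> Prop) : ae_plus P <-> {ae mu, forall x, Rplus x -> P x}.
Proof.
split; apply: (@filterS _ _ (ae_filter_ringOfSetsType mu)) => x Px x0; apply: Px.
  by move: x0 => /=; rewrite in_itv /= andbT.
by rewrite /= in_itv /= andbT.
Qed.

Lemma ae_le_integrable f g : measurable_fun Rplus f ->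
  ae_plus (fun x => `|f x| <= `|g x|) ->
  mu.-integrable Rplus (EFin \o g) -> mu.-integrable Rplus (EFin \o f).
Proof.
move=> mf fg /integrableP[mg gi]; apply/integrableP; split; first exact/measurable_EFinP.
apply: le_lt_trans gi; apply: ae_ge0_le_integral => //.
- by apply: measurableT_comp => //; exact/measurable_EFinP.
- exact: measurableT_comp.
by apply: (ae_plus_filter _).1.
Qed.

Definition sq_int f := measurable_fun Rplus f /\
  mu.-integrable Rplus (EFin \o (fun x => f x ^+ 2)).

Lemma sq_intP f : f \_ Rplus \in Lfun mu 2%:E <-> sq_int f.
Proof.
have fE : (fun x => (f \_ Rplus) x ^+ 2) = (fun x => f x ^+ 2) \_ Rplus.
  by apply/funext => x; rewrite !patchE; case: ifP => // _; rewrite expr0n.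
split=> [fL|[mf fi]].
  have mf : measurable_fun setT (f \_ Rplus).
    by have := sub_Lfun_mfun fL; rewrite inE.
  have f2i := Lfun2_integrable_sqr fL; split; first exact/(measurable_restrictT _ _).2.
  move: f2i; rewrite fE -restrict_EFin => /integrable_restrict.
  by rewrite setTI; apply.
rewrite inE; apply/andP; split; rewrite inE /=; first exact/(measurable_restrictT _ _).1.
rewrite /finite_norm unlock /Lnorm; apply: poweR_lty.
have -> : (fun x : R => `|(EFin \o f \_ Rplus) x| `^ 2)%E =
    (fun x => ((f x ^+ 2)%:E)) \_ Rplus.
  apply/funext => x; rewrite /= !patchE; case: ifP => _ /=.
    by rewrite powR_mulrn // real_normK // num_real.
  by rewrite normr0 powR0.
rewrite -integral_mkcond; have /integrableP[_] := fi.
apply: le_lt_trans; rewrite le_eqVlt; apply/orP; left; apply/eqP.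
by apply: eq_integral => x _; rewrite /= ger0_norm ?sqr_ge0.
Qed.

Lemma integrable_sq_mul f g : sq_int f -> sq_int g ->
  mu.-integrable Rplus (EFin \o (fun x => f x * g x)).
Proof.
move=> [mf fi] [mg gi]; apply: (ae_le_integrable (g := fun x => f x ^+ 2 + g x ^+ 2)).
- exact: measurable_funM.
- apply: aeW => x _; rewrite [leRHS]ger0_norm ?addr_ge0 ?sqr_ge0 //.
  rewrite ler_norml; apply/andP; split.
    have := sqr_ge0 (f x + g x); nra.
  have := sqr_ge0 (f x - g x); nra.
exact: integrableRD.
Qed.

Lemma sq_intD f g : sq_int f -> sq_int g -> sq_int (fun x => f x + g x).
Proof.
move=> fs gs; have [mf fi] := fs; have [mg gi] := gs; split; first exact: measurable_funD.
have -> : (fun x => (f x + g x) ^+ 2) =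
  (fun x => f x ^+ 2 + (g x ^+ 2 + 2 * (f x * g x))) by apply/funext => x; ring.
apply: integrableRD => //; apply: integrableRD => //; apply: integrableRZ => //.
exact: integrable_sq_mul.
Qed.

Lemma sq_intZ f (c : R) : sq_int f -> sq_int (fun x => c * f x).
Proof.
move=> [mf fi]; split; first exact: measurable_funM.
have -> : (fun x => (c * f x) ^+ 2) = (fun x => c ^+ 2 * f x ^+ 2).
  by apply/funext => x; rewrite exprMn.
exact: integrableRZ.
Qed.

Lemma sq_intN f : sq_int f -> sq_int (fun x => - f x).
Proof.
by move=> /(sq_intZ (-1)); under [X in sq_int X -> _]eq_fun do rewrite mulN1r.
Qed.

Lemma sq_intB f g : sq_int f -> sq_int g -> sq_int (fun x => f x - g x).
Proof. by move=> fs gs; apply: sq_intD fs (sq_intN gs). Qed.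

Lemma sq_int_bounded_mul h f (M : R) : measurable_fun Rplus h ->
  ae_plus (fun x => `|h x| <= M) -> sq_int f -> sq_int (fun x => h x * f x).
Proof.
move=> mh hM [mf fi]; split; first exact: measurable_funM.
apply: (ae_le_integrable (g := fun x => M ^+ 2 * f x ^+ 2)); last exact: integrableRZ.
  by apply: measurable_funX; exact: measurable_funM.
apply: ae_plusS hM => x _ hM; rewrite exprMn normrM [leRHS]normrM ler_wpM2r //.
by rewrite !normrX ler_pXn2r ?nnegrE ?normr_ge0 // (le_trans hM) // ler_norm.
Qed.

(** On a bounded interval [|f| <= 1 + f^2]. The endpoint [0], at which nothing is assumed on [f], is
    a null set. *)
Lemma sq_int_integrable0 f x : sq_int f -> mu.-integrable `[0, x] (EFin \o f).
Proof.
move=> [mf fi].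
have sub : `]0, x]%classic `<=` Rplus by apply: subset_itvl; rewrite bnd_simp.
have i1 : mu.-integrable `]0, x] (EFin \o (fun y => 1 + f y ^+ 2)).
  apply: integrableRD => //; last exact: integrableS fi.
  apply: (@integrableS _ _ _ mu `[0, x]%classic) => //.
    by apply: subset_itvr; rewrite bnd_simp.
  apply: continuous_compact_integrable; first exact: segment_compact.
  by apply: continuous_subspaceT => y; exact: cvg_cst.
have i2 : mu.-integrable `]0, x] (EFin \o f).
  apply: le_integrable i1 => //; first by apply/measurable_EFinP; exact: measurable_funS mf.
  move=> y _ /=; rewrite lee_fin [leRHS]ger0_norm ?addr_ge0 ?sqr_ge0 //.
  rewrite -[f y ^+ 2]real_normK ?num_real //.
  have := normr_ge0 (f y); move: `|f y| => a a0; have := sqr_ge0 (a - 1); nra.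
have mf0 : measurable_fun `[0, x] f.
  by apply/measurable_fun_itv_obnd_cbndP; exact: integrable_measurable i2.
move/integrableP : i2 => [_ i2]; apply/integrableP; split; first exact/measurable_EFinP.
rewrite -integral_itv_obnd_cbnd //.
by apply: measurableT_comp => //; apply/measurable_EFinP; exact: measurable_funS mf.
Qed.

Lemma sq_int_locally_int f : sq_int f -> locally_int f.
Proof.
move=> fs a b a0; apply: integrableS (sq_int_integrable0 b fs) => //.
by apply: subset_itvr; rewrite bnd_simp ltW.
Qed.

Lemma sq_int_ae_eq f g : measurable_fun Rplus f -> sq_int g ->
  ae_plus (fun x => f x = g x) -> sq_int f.
Proof.
move=> mf [mg gi] fg; split=> //; apply: ae_le_integrable gi; first exact: measurable_funX.
by apply: ae_plusS fg => x _ ->.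
Qed.

End SquareIntegrable.

(** * Complex integrals and the inner product of [L^2] *)

Section ComplexIntegral.
Context (R : realType).
Local Notation mu := (@lebesgue_measure R).
Local Notation Rplus := (`]0, +oo[%classic : set R).
Local Notation Re := (@complex.Re R).
Local Notation Im := (@complex.Im R).
Implicit Types (F G u v : R -> R[i]).

Lemma ReM (a b : R[i]) : Re (a * b) = Re a * Re b - Im a * Im b.
Proof. by case: a b => [x y] []. Qed.

Lemma ImM (a b : R[i]) : Im (a * b) = Re a * Im b + Im a * Re b.
Proof. by case: a b => [x y] []. Qed.

Lemma ReD (a b : R[i]) : Re (a + b) = Re a + Re b.
Proof. by case: a b => [x y] []. Qed.

Lemma ImD (a b : R[i]) : Im (a + b) = Im a + Im b.
Proof. by case: a b => [x y] []. Qed.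

Lemma ReN (a : R[i]) : Re (- a) = - Re a.
Proof. by case: a. Qed.

Lemma ImN (a : R[i]) : Im (- a) = - Im a.
Proof. by case: a. Qed.

Lemma ReJ (a : R[i]) : Re (conjc a) = Re a.
Proof. by case: a. Qed.

Lemma ImJ (a : R[i]) : Im (conjc a) = - Im a.
Proof. by case: a. Qed.

Definition ReImE := (ReM, ImM, ReD, ImD, ReN, ImN, ReJ, ImJ).

Definition cintegrable F := mu.-integrable Rplus (EFin \o (fun x => Re (F x))) /\
  mu.-integrable Rplus (EFin \o (fun x => Im (F x))).

Lemma cintegrable_comb a F G : cintegrable F -> cintegrable G ->
  cintegrable (fun x => a * F x + G x).
Proof.
move=> [FR FI] [GR GI]; split.
  under [X in _ \o X]eq_fun do rewrite ReD ReM.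
  by apply: integrableRD => //; apply: integrableRB => //; exact: integrableRZ.
under [X in _ \o X]eq_fun do rewrite ImD ImM.
by apply: integrableRD => //; apply: integrableRD => //; exact: integrableRZ.
Qed.

Lemma cintegral_comb a F G : cintegrable F -> cintegrable G ->
  cintegral (fun x => a * F x + G x) = a * cintegral F + cintegral G.
Proof.
move=> [FR FI] [GR GI]; have Z k (f : R -> R) : mu.-integrable Rplus (EFin \o f) ->
  mu.-integrable Rplus (EFin \o (fun x => k * f x)) by exact: integrableRZ.
apply: complexP; rewrite ReImE /cintegral /=.
  under eq_Rintegral do rewrite ReD ReM.
  rewrite RintegralD //; last by apply: integrableRB => //; exact: Z.
  by rewrite ReImE RintegralB ?RintegralZl //; exact: Z.
under eq_Rintegral do rewrite ImD ImM.
rewrite RintegralD //; last by apply: integrableRD => //; exact: Z.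
by rewrite ReImE RintegralD ?RintegralZl //; exact: Z.
Qed.

Lemma cintegral_ae F G : cintegrable F -> cintegrable G ->
  ae_plus (fun x => F x = G x) -> cintegral F = cintegral G.
Proof.
move=> [FR FI] [GR GI] FG; apply: complexP => /=.
  apply: eq_ae_plus_Rintegral; [exact: integrable_measurable FR|exact: integrable_measurable GR|].
  by apply: ae_plusS FG => x _ ->.
apply: eq_ae_plus_Rintegral; [exact: integrable_measurable FI|exact: integrable_measurable GI|].
by apply: ae_plusS FG => x _ ->.
Qed.

Lemma cintegral_conj F : cintegrable F -> cintegral (fun x => conjc (F x)) = conjc (cintegral F).
Proof.
move=> [FR FI]; apply: complexP; rewrite ReImE /=.
  by apply: eq_Rintegral => x _; rewrite ReJ.
under eq_Rintegral do rewrite ImJ -mulN1r.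
by rewrite RintegralZl // mulN1r.
Qed.

Lemma cintegrableD F G : cintegrable F -> cintegrable G -> cintegrable (fun x => F x + G x).
Proof.
by move=> Fi Gi; have := cintegrable_comb 1 Fi Gi;
  under [X in cintegrable X -> _]eq_fun do rewrite mul1r.
Qed.

Lemma cintegralD F G : cintegrable F -> cintegrable G ->
  cintegral (fun x => F x + G x) = cintegral F + cintegral G.
Proof.
move=> Fi Gi; have := cintegral_comb 1 Fi Gi; rewrite mul1r => <-.
by congr cintegral; apply/funext => x; rewrite mul1r.
Qed.

Lemma cintegrable0 : cintegrable (fun=> 0).
Proof. by split; exact: integrable0. Qed.

Lemma cintegral0 : @cintegral R (fun=> 0) = 0.
Proof. by apply: complexP; rewrite /= Rintegral_cst // mul0r. Qed.

Lemma cintegrableZ a F : cintegrable F -> cintegrable (fun x => a * F x).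
Proof.
by move=> Fi; have := cintegrable_comb a Fi cintegrable0;
  under [X in cintegrable X -> _]eq_fun do rewrite addr0.
Qed.

Lemma cintegralZ a F : cintegrable F -> cintegral (fun x => a * F x) = a * cintegral F.
Proof.
move=> Fi; have := cintegral_comb a Fi cintegrable0; rewrite cintegral0 addr0 => <-.
by congr cintegral; apply/funext => x; rewrite addr0.
Qed.

Lemma cintegrableN F : cintegrable F -> cintegrable (fun x => - F x).
Proof.
by move=> Fi; have := cintegrableZ (-1) Fi; under [X in cintegrable X -> _]eq_fun do rewrite mulN1r.
Qed.

Lemma cintegralN F : cintegrable F -> cintegral (fun x => - F x) = - cintegral F.
Proof.
move=> Fi; have := cintegralZ (-1) Fi; rewrite mulN1r => <-.
by congr cintegral; apply/funext => x; rewrite mulN1r.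
Qed.

Definition csq_int u := sq_int (fun x => Re (u x)) /\ sq_int (fun x => Im (u x)).

Lemma LpC2P u : LpC 2%:E u <-> csq_int u.
Proof.
split=> [/andP[uR uI]|[uR uI]]; first by split; exact/sq_intP.
by apply/andP; split; exact/sq_intP.
Qed.

Lemma csq_int_comb a u v : csq_int u -> csq_int v -> csq_int (fun x => a * u x + v x).
Proof.
move=> [uR uI] [vR vI]; split.
  under [X in sq_int X]eq_fun do rewrite ReD ReM.
  by apply: sq_intD => //; apply: sq_intB; exact: sq_intZ.
under [X in sq_int X]eq_fun do rewrite ImD ImM.
by apply: sq_intD => //; apply: sq_intD; exact: sq_intZ.
Qed.

Lemma csq_intJ u : csq_int u -> csq_int (fun x => conjc (u x)).
Proof.
move=> [uR uI]; split; first by under [X in sq_int X]eq_fun do rewrite ReJ.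
by under [X in sq_int X]eq_fun do rewrite ImJ; exact: sq_intN.
Qed.

Lemma cintegrable_mul u v : csq_int u -> csq_int v -> cintegrable (fun x => u x * v x).
Proof.
move=> [uR uI] [vR vI]; split.
  by under [X in _ \o X]eq_fun do rewrite ReM; apply: integrableRB => //; exact: integrable_sq_mul.
by under [X in _ \o X]eq_fun do rewrite ImM; apply: integrableRD => //; exact: integrable_sq_mul.
Qed.

Lemma cintegrable_ip u v : csq_int u -> csq_int v -> cintegrable (fun x => conjc (u x) * v x).
Proof. by move=> us vs; apply: cintegrable_mul => //; exact: csq_intJ. Qed.

Lemma L2_csq (u : L2 R) : csq_int u.
Proof. by apply/LpC2P; rewrite /L2_repr; case: (repr u). Qed.

Lemma pi_reprE (f : L2fun R) : ae_plus (fun x => L2_repr (\pi_(L2 R)%qT f) x = f x).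
Proof.
have : (repr (\pi_(L2 R)%qT f) - f \in @null_pred R).
  by rewrite Quotient.idealrBE reprK.
by move=> /asboolP; apply: ae_plusS => x _ /= /eqP; rewrite subr_eq0 => /eqP.
Qed.

Lemma L2_of_fun u : csq_int u -> exists v : L2 R, ae_plus (fun x => v x = u x).
Proof.
move=> /LpC2P us; exists (\pi_(L2 R)%qT (MkL2fun us)); exact: pi_reprE.
Qed.

Lemma L2_combE a (u v : L2 R) : ae_plus (fun x => (a *: u + v : L2 R) x = a * u x + v x).
Proof.
have -> : a *: u + v = (\pi_(L2 R)%qT (a *: repr u + repr v)).
  by rewrite pi_L2D; congr (_ + _); rewrite L2_reprK.
exact: pi_reprE.
Qed.

Lemma L2_zeroE : ae_plus (fun x => (0 : L2 R) x = 0).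
Proof.
have := L2_combE (-1) (0 : L2 R) 0; rewrite scaleN1r oppr0 addr0.
by apply: ae_plusS => x _ ->; ring.
Qed.

Lemma L2_ip_ae (u v : L2 R) (u' v' : R -> R[i]) : csq_int u' -> csq_int v' ->
  ae_plus (fun x => u x = u' x) -> ae_plus (fun x => v x = v' x) ->
  L2_ip u v = cintegral (fun x => conjc (u' x) * v' x).
Proof.
move=> us vs uu vv; apply: cintegral_ae.
- by apply: cintegrable_ip; exact: L2_csq.
- exact: cintegrable_ip.
by apply: ae_plusS2 uu vv => x _ -> ->.
Qed.

Lemma L2_ip_selfE (u : L2 R) : Re (L2_ip u u) =
  \int[mu]_(x in Rplus) (Re (u x) ^+ 2 + Im (u x) ^+ 2).
Proof. by apply: eq_Rintegral => x _; rewrite !ReImE; ring. Qed.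

Lemma Rintegral_eq0 (f : R -> R) : measurable_fun Rplus f -> (forall x, 0 <= f x) ->
  mu.-integrable Rplus (EFin \o f) -> \int[mu]_(x in Rplus) f x = 0 ->
  ae_plus (fun x => f x = 0).
Proof.
move=> mf f0 fi int0.
have int0' : (\int[mu]_(x in Rplus) `|(EFin \o f) x| = 0)%E.
  transitivity (\int[mu]_(x in Rplus) (f x)%:E)%E.
    by apply: eq_integral => x _ /=; rewrite ger0_norm.
  by rewrite -[LHS]fineK ?integrable_fin_num // -/(Rintegral _ _ _) int0.
have mRplus : measurable Rplus by [].
have h := (ae_eq_integral_abs mu mRplus ((measurable_EFinP _ _).2 mf)).1 int0'.
apply/ae_plus_filter; move: h.
by apply: (@filterS _ _ (ae_filter_ringOfSetsType mu)) => x fx Rx; have [] := fx Rx.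
Qed.

Lemma L2_inner_product : inner_product (@L2_ip R).
Proof.
split.
- move=> u a v w.
  have us := L2_csq u; have vs := L2_csq v; have ws := L2_csq w.
  rewrite (L2_ip_ae us (csq_int_comb a vs ws) (aeW _ (fun _ _ => erefl)) (L2_combE a v w)).
  rewrite -cintegral_comb; [|exact: cintegrable_ip..].
  by congr cintegral; apply/funext => x; ring.
- move=> u v; rewrite /L2_ip -cintegral_conj; last by apply: cintegrable_ip; exact: L2_csq.
  by congr cintegral; apply/funext => x; rewrite conjcM conjcK mulrC.
- by move=> u; rewrite L2_ip_selfE; apply: Rintegral_ge0 => x _; rewrite addr_ge0 ?sqr_ge0.
move=> u; rewrite L2_ip_selfE => int0; apply/L2_eqP.
have [[mR Ri] [mI Ii]] := L2_csq u.
have u0 : ae_plus (fun x => Re ((u : L2 R) x) ^+ 2 + Im ((u : L2 R) x) ^+ 2 = 0).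
  apply: Rintegral_eq0 => //.
  - by apply: measurable_funD; exact: measurable_funX.
  - by move=> x; rewrite addr_ge0 ?sqr_ge0.
  - exact: integrableRD.
have z0 : ae_plus (fun x => (0 : L2 R) x = 0).
  by have := L2_combE (-1) 0 0; rewrite scaleN1r oppr0 addr0; apply: ae_plusS => x _ ->; ring.
apply: ae_plusS2 u0 z0 => x _ /eqP; rewrite paddr_eq0 ?sqr_ge0 //.
rewrite !sqrf_eq0 => /andP[/eqP R0 /eqP I0] ->.
by apply: complexP.
Qed.

End ComplexIntegral.

Section Completeness.
Context (R : realType).
Local Notation mu := (@lebesgue_measure R).
Local Notation Rplus := (`]0, +oo[%classic : set R).
Implicit Types (f h l : R -> R).

Lemma geometric_cauchy (g : nat -> R) (c : R) : 0 <= c ->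
  (forall j, `|g j.+1 - g j| <= c * 2^-1 ^+ j) ->
  exists2 l, g @ \oo --> l & forall j, `|g j - l| <= 2 * c * 2^-1 ^+ j.
Proof.
move=> c0 gc.
have step j k : `|g (j + k)%N - g j| <= 2 * c * 2^-1 ^+ j * (1 - 2^-1 ^+ k).
  elim: k => [|k IH]; first by rewrite addn0 subrr normr0 expr0 subrr mulr0.
  rewrite addnS -[g _ - _](subrKA (g (j + k)%N)).
  apply: le_trans (ler_normD _ _) _; apply: le_trans (lerD (gc _) IH) _.
  rewrite exprD exprS le_eqVlt; apply/orP; left; apply/eqP; by field.
have dist i n : (i <= n)%N -> `|g n - g i| <= 2 * c * 2^-1 ^+ i.
  move=> jn; rewrite -(subnKC jn); apply: le_trans (step _ _) _.
  rewrite -[leRHS]mulr1; apply: ler_wpM2l; first by rewrite !mulr_ge0 ?exprn_ge0 ?invr_ge0.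
  by rewrite gerBl exprn_ge0 // invr_ge0.
have small e : 0 < e -> exists j, 2 * c * 2^-1 ^+ j < e.
  move=> e0; have h : `|2^-1| < 1 :> R by rewrite ger0_norm ?invr_ge0 // invf_lt1 // ltr1n.
  have /cvgrPdist_lt/(_ e e0) := cvg_geometric (2 * c) h.
  case=> N _ /(_ N (leqnn _)) /=; rewrite sub0r normrN => hN; exists N.
  by apply: le_lt_trans hN; exact: ler_norm.
have /cvg_ex[l gl] : cvg (g @ \oo).
  apply/cauchy_cvgP/cauchy_exP => e e0; have [N NP] := small e e0.
  exists (g N); exists N => // n /= Nn; rewrite /ball /= distrC.
  exact: le_lt_trans (dist _ _ Nn) NP.
exists l => // j; apply/ler_addgt0Pr => e e0.
move/cvgrPdist_lt : gl => /(_ e e0)[N _ NP].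
have := NP (maxn j N) (leq_maxr _ _); rewrite /= => lN.
rewrite -[_ - l](subrKA (g (maxn j N))); apply: le_trans (ler_normD _ _) _.
by apply: lerD; [rewrite distrC dist // leq_maxl|rewrite distrC ltW].
Qed.

(* The weights [4 ^ j] turn summability of the squared increments into a
   geometric pointwise bound on the increments. *)
Lemma sq_int_fast_cauchy (g : nat -> R -> R) : (forall j, sq_int (g j)) ->
  (forall j, \int[mu]_(x in Rplus) (g j.+1 x - g j x) ^+ 2 <= 8^-1 ^+ j) ->
  exists l, sq_int l /\ exists K, forall j,
    \int[mu]_(x in Rplus) (g j x - l x) ^+ 2 <= K * 4^-1 ^+ j.
Proof.
move=> gs gc.
pose d j x := g j.+1 x - g j x.
have ds j : sq_int (d j) by exact: sq_intB.
pose h j x : \bar R := (4 ^+ j * d j x ^+ 2)%:E.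
have h0 j x : (0 <= h j x)%E by rewrite lee_fin mulr_ge0 ?sqr_ge0 ?exprn_ge0.
have mh j : measurable_fun Rplus (h j).
  by apply/measurable_EFinP; apply: measurable_funM => //; apply: measurable_funX; case: (ds j).
pose S x : \bar R := (\sum_(j <oo) h j x)%E.
have S0 x : (0 <= S x)%E by apply: nneseries_ge0.
have mS : measurable_fun Rplus S by apply: (@ge0_emeasurable_sum _ _ R Rplus h xpredT).
have inth j : (\int[mu]_(x in Rplus) h j x <= (2^-1 ^+ j)%:E)%E.
  have [_ di] := ds j.
  rewrite -[leLHS]fineK; last by apply: integrable_fin_num => //; exact: integrableRZ.
  rewrite lee_fin -[leLHS]/(\int[mu]_(x in Rplus) (4 ^+ j * d j x ^+ 2)).
  rewrite RintegralZl //; apply: le_trans (ler_wpM2l _ (gc j)) _; first exact: exprn_ge0.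
  rewrite -exprMn le_eqVlt; apply/orP; left; apply/eqP; congr (_ ^+ _); by field.
have intS : (\int[mu]_(x in Rplus) S x <= 2%:E)%E.
  rewrite integral_nneseries //; apply: lime_le.
    by apply: is_cvg_nneseries => n _ _; exact: integral_ge0.
  apply: nearW => n; apply: (@le_trans _ _ (\sum_(0 <= i < n) (2^-1 ^+ i)%:E)%E).
    by apply: lee_sum => i _; exact: inth.
  rewrite sumEFin lee_fin; suff -> : \sum_(0 <= i < n) (2^-1 : R) ^+ i = 2 - 2 * 2^-1 ^+ n.
    by rewrite lerBlDr lerDl mulr_ge0 // exprn_ge0 // invr_ge0.
  elim: n => [|n IH]; first by rewrite big_geq // expr0 mulr1 subrr.
  by rewrite big_nat_recr //= IH exprS; field.
have Sy : (\int[mu]_(x in Rplus) S x < +oo)%E by exact: le_lt_trans intS (ltry _).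
have iS : mu.-integrable Rplus S.
  apply/integrableP; split => //.
  apply: le_lt_trans Sy; rewrite le_eqVlt; apply/orP; left; apply/eqP.
  by apply: eq_integral => x _; rewrite gee0_abs.
pose A := Rplus `&` [set x | (S x < +oo)%E].
have mA : measurable A.
  by rewrite /A; apply: emeasurable_fun_infty_o.
have aeA : ae_plus A.
  apply/ae_plus_filter; have := @integrable_ae _ _ _ mu Rplus (measurable_itv _) S iS.
  apply: (@filterS _ _ (ae_filter_ringOfSetsType mu)) => x Sx Rx.
  by split => //=; rewrite -ge0_fin_numE // Sx.
have dA x j : A x -> `|d j x| <= Num.sqrt (fine (S x)) * 2^-1 ^+ j.
  move=> [_ /= Sx]; have hS : 4 ^+ j * d j x ^+ 2 <= fine (S x).
    rewrite -lee_fin fineK ?ge0_fin_numE //.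
    apply: le_trans (@nneseries_lim_ge R (h ^~ x) xpredT 0 j.+1 _) => //.
    rewrite big_nat_recr //= leeDr // sume_ge0 //.
  rewrite -(@ler_pXn2r _ 2) ?nnegrE ?mulr_ge0 ?sqrtr_ge0 ?exprn_ge0 ?invr_ge0 //.
  rewrite real_normK ?num_real // exprMn sqr_sqrtr ?fine_ge0 //.
  have -> : ((2^-1 ^+ j) ^+ 2 : R) = (4 ^+ j)^-1.
    by rewrite -exprM mulnC exprM -exprVn; congr (_ ^+ _); field.
  by rewrite ler_pdivlMr ?exprn_gt0 // mulrC.
(* Setting the sequence to [0] outside the conull set [A] where the series converges makes it
   converge at every point, so the limit is measurable. *)
pose gA j := g j \_ A.
have gA_step x j :
    `|gA j.+1 x - gA j x| <= (if x \in A then Num.sqrt (fine (S x)) else 0) * 2^-1 ^+ j.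
  rewrite /gA !patchE; case: ifPn => [/set_mem Ax|_]; first exact: dA.
  by rewrite subrr normr0 mul0r.
have c0 x : 0 <= (if x \in A then Num.sqrt (fine (S x)) else 0) :> R.
  by case: ifP => // _; exact: sqrtr_ge0.
have /choice[l lP] : forall x, exists l0 : R, (fun j => gA j x) @ \oo --> l0 /\
    forall j, `|gA j x - l0| <= 2 * (if x \in A then Num.sqrt (fine (S x)) else 0) * 2^-1 ^+ j.
  by move=> x; have [l ? ?] := geometric_cauchy (c0 x) (gA_step x); exists l.
have AR : A `<=` Rplus by move=> x [].
have mgA m : measurable_fun [set: R] (gA m).
  have [mg _] := gs m; apply/(measurable_restrictT _ _).1; first exact: mA.
  exact: measurable_funS mg.
have ml : measurable_fun Rplus l.
  apply: (@measurable_fun_cvg _ _ R _ gA).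
    by move=> m; exact: measurable_funS (mgA m).
  by move=> x _; have [] := lP x.
have bound j : ae_plus (fun x => (g j x - l x) ^+ 2 <= 4 * 4^-1 ^+ j * fine (S x)).
  apply: ae_plusS aeA => x _ Ax; have [_ /(_ j)] := lP x.
  rewrite /gA patchE mem_set //; set s := fine (S x) => le.
  have s0 : 0 <= s by exact: fine_ge0.
  have -> : 4 * 4^-1 ^+ j * s = (2 * Num.sqrt s * 2^-1 ^+ j) ^+ 2.
    rewrite !exprMn sqr_sqrtr // -exprM mulnC exprM.
    have -> : (2^-1 ^+ 2 : R) = 4^-1 by field.
    ring.
  by rewrite -(real_normK (num_real (g j x - l x))) ler_pXn2r ?nnegrE //.
have iSf : mu.-integrable Rplus (EFin \o (fun x => fine (S x))).
  apply/integrableP; split.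
    by apply/measurable_EFinP; apply: measurableT_comp.
  apply: le_lt_trans Sy; apply: ge0_le_integral => //.
    by apply: measurableT_comp => //; apply/measurable_EFinP; apply: measurableT_comp.
  by move=> x _ /=; rewrite ger0_norm ?fine_ge0 //; case: (S x) (S0 x) => //= _; rewrite leey.
have dls j : sq_int (fun x => g j x - l x).
  have mgl : measurable_fun Rplus (fun x => g j x - l x).
    by apply: measurable_funB => //; case: (gs j).
  split => //; apply: (ae_le_integrable (g := fun x => 4 * 4^-1 ^+ j * fine (S x))).
  - exact: measurable_funX.
  - apply: ae_plusS (bound j) => x _ le.
    by rewrite ger0_norm ?sqr_ge0 // (le_trans le) // ler_norm.
  - exact: integrableRZ.
exists l; split.
  have := sq_intB (gs 0%N) (dls 0%N).
  by under [X in sq_int X -> _]eq_fun do rewrite subKr.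
(* The pointwise error is at most [2 sqrt(S) 2^(- j)]; its square is [4 * 4^(- j) * S]. *)
exists (4 * \int[mu]_(x in Rplus) fine (S x)) => j.
rewrite mulrAC -RintegralZl //.
rewrite /Rintegral fine_le //.
- by apply: integrable_fin_num => //; case: (dls j).
- by apply: integrable_fin_num => //; exact: integrableRZ.
apply: ae_ge0_le_integral => //.
- by move=> x _; rewrite lee_fin sqr_ge0.
- by apply/measurable_EFinP; case: (dls j) => m _; exact: measurable_funX.
- by move=> x _; rewrite lee_fin mulr_ge0 ?mulr_ge0 ?exprn_ge0 ?invr_ge0 ?fine_ge0.
- by apply/measurable_EFinP; apply: measurable_funM => //; exact: integrable_measurable iSf.
apply/ae_plus_filter; apply: ae_plusS (bound j) => x _.
by rewrite lee_fin.
Qed.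

End Completeness.

Section L2Complete.
Context (R : realType).
Local Notation mu := (@lebesgue_measure R).
Local Notation Rplus := (`]0, +oo[%classic : set R).
Local Notation Re := (@complex.Re R).
Local Notation Im := (@complex.Im R).
Implicit Types (f h l : R -> R).

Definition sq_dist f h := \int[mu]_(x in Rplus) (f x - h x) ^+ 2.

Lemma sq_dist_ge0 f h : 0 <= sq_dist f h.
Proof. by apply: Rintegral_ge0 => x _; exact: sqr_ge0. Qed.

Lemma sq_dist_triangle f h l : sq_int f -> sq_int h -> sq_int l ->
  sq_dist f l <= 2 * sq_dist f h + 2 * sq_dist h l.
Proof.
move=> fs hs ls; have [_ fh] := sq_intB fs hs; have [_ hl] := sq_intB hs ls.
have [_ fl] := sq_intB fs ls.
rewrite -!RintegralZl // -RintegralD //; [|exact: integrableRZ..].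
apply: le_Rintegral => //; first by apply: integrableRD => //; exact: integrableRZ.
move=> x _; have := sqr_ge0 ((f x - h x) - (h x - l x)); nra.
Qed.

Lemma sq_int_complete (f : nat -> R -> R) : (forall n, sq_int (f n)) ->
  (forall e, 0 < e -> exists N, forall m n, (N <= m)%N -> (N <= n)%N ->
     sq_dist (f m) (f n) < e) ->
  exists l, sq_int l /\ forall e, 0 < e -> exists N, forall n, (N <= n)%N ->
     sq_dist (f n) l < e.
Proof.
move=> fs cau.
have /choice[k kP] : forall j, exists N, forall m n, (N <= m)%N -> (N <= n)%N ->
    sq_dist (f m) (f n) < 8^-1 ^+ j.
  by move=> j; apply: cau; rewrite exprn_gt0 // invr_gt0.
(* The maximum makes [K] monotone, so that [K j] and [K j.+1] both lie beyond [k j]; the summand [j]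
   makes [K] unbounded. *)
pose K j := (j + \max_(i < j.+1) k i)%N.
have kK j : (k j <= K j)%N by rewrite (leq_trans _ (leq_addl _ _)) // (leq_bigmax (@ord_max j)).
have KS j : (K j <= K j.+1)%N by rewrite /K leq_add // [leqRHS]big_ord_recr leq_maxl.
have [|l [ls [C lC]]] := @sq_int_fast_cauchy R (fun j => f (K j)) (fun j => fs _).
  by move=> j; apply: ltW; apply: kP; rewrite ?(leq_trans (kK j)) // KS.
exists l; split=> // e e0.
have e4 : 0 < e / 4 by rewrite divr_gt0.
have [N NP] := cau _ e4.
have h : `|4^-1| < 1 :> R by rewrite ger0_norm ?invr_ge0 // invf_lt1 // ltr1n.
have /cvgrPdist_lt/(_ _ e4)[M _ MP] := cvg_geometric C h.
set J := maxn M N.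
have JN : (N <= K J)%N by rewrite (leq_trans _ (leq_addr _ _)) // leq_maxr.
have CJ : C * 4^-1 ^+ J < e / 4.
  have := MP J (leq_maxl _ _); rewrite /= sub0r normrN; apply: le_lt_trans.
  exact: ler_norm.
exists N => n Nn; apply: le_lt_trans (sq_dist_triangle (fs n) (fs (K J)) ls) _.
have := NP n (K J) Nn JN; have : sq_dist (f (K J)) l < e / 4 by apply: le_lt_trans (lC J) CJ.
lra.
Qed.

Lemma hnorm_subE (u v : L2 R) : hnorm (@L2_ip R) (u - v) ^+ 2 =
  sq_dist (fun x => Re (u x)) (fun x => Re (v x)) +
  sq_dist (fun x => Im (u x)) (fun x => Im (v x)).
Proof.
have ip := L2_inner_product R; rewrite (hnorm_sqr ip) L2_ip_selfE.
have [uR uI] := L2_csq u; have [vR vI] := L2_csq v.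
have [m1 i1] := sq_intB uR vR; have [m2 i2] := sq_intB uI vI.
rewrite /sq_dist -RintegralD //; apply: eq_ae_plus_Rintegral.
- have [[mR _] [mI _]] := L2_csq (u - v).
  by apply: measurable_funD; exact: measurable_funX.
- by apply: measurable_funD; exact: measurable_funX.
have := L2_combE (-1) v u; rewrite scaleN1r addrC; apply: ae_plusS => x _ ->.
by rewrite !ReImE /=; ring.
Qed.

Lemma L2_complete : ip_complete (@L2_ip R).
Proof.
move=> u cau.
have ip := L2_inner_product R.
have sqcau e : 0 < e -> exists N, forall m n, (N <= m)%N -> (N <= n)%N ->
    hnorm (@L2_ip R) (u m - u n) ^+ 2 < e.
  move=> e0; have [|N NP] := cau (Num.sqrt e); first by rewrite sqrtr_gt0.
  exists N => m n Nm Nn; rewrite -[e]sqr_sqrtr ?(ltW e0) // ltr_pXn2r ?nnegrE ?sqrtr_ge0 //.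
  exact: NP.
have [||lR [lRs lRP]] := @sq_int_complete (fun n x => Re ((u n : L2 R) x)).
- by move=> n; case: (L2_csq (u n)).
- move=> e /sqcau[N NP]; exists N => m n Nm Nn; apply: le_lt_trans (NP m n Nm Nn).
  by rewrite hnorm_subE lerDl sq_dist_ge0.
have [||lI [lIs lIP]] := @sq_int_complete (fun n x => Im ((u n : L2 R) x)).
- by move=> n; case: (L2_csq (u n)).
- move=> e /sqcau[N NP]; exists N => m n Nm Nn; apply: le_lt_trans (NP m n Nm Nn).
  by rewrite hnorm_subE lerDr sq_dist_ge0.
have [l lE] : exists l : L2 R, ae_plus (fun x => l x = lR x +i* lI x) by exact: L2_of_fun.
exists l => e e0; have e2 : 0 < e ^+ 2 / 2 by rewrite divr_gt0 // exprn_gt0.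
have [N NP] := lRP _ e2; have [M MP] := lIP _ e2.
exists (maxn N M) => n; rewrite geq_max => /andP[Nn Mn].
rewrite -(@ltr_pXn2r _ 2) ?nnegrE ?sqrtr_ge0 ?(ltW e0) // hnorm_subE.
have [nR nI] := L2_csq (u n); have [llR llI] := L2_csq l.
have -> : sq_dist (fun x => Re ((u n : L2 R) x)) (fun x => Re (l x)) =
    sq_dist (fun x => Re ((u n : L2 R) x)) lR.
  apply: eq_ae_plus_Rintegral; [
    by have [_ /integrable_measurable] := sq_intB nR llR|
    by have [_ /integrable_measurable] := sq_intB nR lRs|].
  by apply: ae_plusS lE => x _ ->.
have -> : sq_dist (fun x => Im ((u n : L2 R) x)) (fun x => Im (l x)) =
    sq_dist (fun x => Im ((u n : L2 R) x)) lI.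
  apply: eq_ae_plus_Rintegral; [
    by have [_ /integrable_measurable] := sq_intB nI llI|
    by have [_ /integrable_measurable] := sq_intB nI lIs|].
  by apply: ae_plusS lE => x _ ->.
have := NP n Nn; have := MP n Mn; lra.
Qed.

End L2Complete.

(** * The Sobolev space H^2(R^+) *)

Section Infinity.
Context (R : realType).
Local Notation mu := (@lebesgue_measure R).
Local Notation Rplus := (`]0, +oo[%classic : set R).
Implicit Types (F f : R -> R).

Lemma not_integrable_ge F e N : 0 <= N -> 0 < e ->
  (forall x, N < x -> e <= `|F x|) -> ~ mu.-integrable Rplus (EFin \o F).
Proof.
move=> N0 e0 eF /integrableP[/measurable_EFinP mF Fy].
have sub : `]N, +oo[%classic `<=` Rplus by apply: subset_itvr; rewrite bnd_simp.
have : (\int[mu]_(x in `]N, +oo[) (cst e%:E) x <= \int[mu]_(x in Rplus) `|(F x)%:E|)%E.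
  apply: (@le_trans _ _ (\int[mu]_(x in `]N, +oo[) `|(F x)%:E|)%E).
    apply: ge0_le_integral => //.
    - by move=> x _; rewrite lee_fin ltW.
    - by apply: measurableT_comp => //; apply/measurable_EFinP; exact: measurable_funS mF.
    - by move=> x /=; rewrite in_itv /= andbT lee_fin => /eF.
  apply: ge0_subset_integral => //.
  by apply: measurableT_comp => //; exact/measurable_EFinP.
rewrite integral_cst // [X in (_ * X)%E]lebesgue_measure_itv /= ltry /= => h.
have := le_lt_trans h Fy; rewrite mulry gtr0_sg // mul1e.
by rewrite ltxx.
Qed.

(** Dominated convergence makes the integral of [|f|] beyond some integer [N] smaller than [e];
    tails of [|f|] decrease, so this [N] serves every larger [X]. *)
Lemma integral_tail f (e : R) : mu.-integrable Rplus (EFin \o f) -> 0 < e ->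
  exists N : R, 0 <= N /\ forall X, N <= X -> `|\int[mu]_(x in `]X, +oo[) f x| < e.
Proof.
move=> fi e0; have ni := integrable_norm fi.
have mf := integrable_measurable fi.
pose g (n : nat) x := `|f x| * \1_(`]n%:R, +oo[%classic : set R) x.
have mg n : measurable_fun Rplus (g n).
  by apply: measurable_funM; [exact: measurableT_comp|exact: measurable_indic].
have gf n x : `|g n x| <= `|f x|.
  by rewrite /g indicE; case: (_ \in _); rewrite ?mulr1 ?mulr0 ?normr_id ?normr0.
have [] := @dominated_convergence _ _ R mu Rplus (measurable_itv _)
  (fun n x => (g n x)%:E) (cst 0%E) (EFin \o (fun x => `|f x|)).
- by move=> n; apply/measurable_EFinP; exact: mg.
- by [].
- apply: aeW => x _; apply: cvg_near_cst.
  exists (Num.truncn `|x|).+1 => // n /= xn.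
  rewrite /g indicE memNset ?mulr0 //= in_itv /= andbT => nx.
  have := truncnS_gt `|x|; rewrite ltNge => /negP; apply.
  apply: le_trans (_ : n%:R <= _); first by rewrite ler_nat.
  by apply: le_trans (ltW nx) (ler_norm _).
- exact: ni.
- by apply: aeW => x n _ /=; rewrite lee_fin; exact: gf.
move=> _ _; rewrite integral0 => cg.
have gi n : mu.-integrable Rplus (EFin \o g n).
  apply: le_integrable ni => //; first by apply/measurable_EFinP; exact: mg.
  by move=> x _ /=; rewrite lee_fin normr_id; exact: gf.
have {}cg : \int[mu]_(x in Rplus) g n x @[n --> \oo] --> (0 : R) by exact: fine_cvg cg.
move/cvgrPdist_lt : cg => /(_ _ e0)[N _ NP]; exists N%:R; split=> // X NX.
have := NP N (leqnn _); rewrite /= sub0r normrN; apply: le_lt_trans.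
have X0 : 0 <= X by apply: le_trans NX.
have sub : `]X, +oo[%classic `<=` Rplus by apply: subset_itvr; rewrite bnd_simp.
apply: le_trans (ler_norm _).
apply: le_trans (le_normr_Rintegral _ _) _ => //; first exact: integrableS fi.
rewrite -[X in X <= _]/(Rintegral _ _ _) [leLHS](_ : _ =
  \int[mu]_(x in Rplus) (`|f x| * \1_(`]X, +oo[%classic : set R) x)).
  apply: le_Rintegral => //.
    apply: le_integrable ni => //.
      by apply/measurable_EFinP/measurable_funM; [exact: measurableT_comp|exact: measurable_indic].
    by move=> x _ /=; rewrite lee_fin indicE; case: (_ \in _);
      rewrite ?mulr1 ?mulr0 ?normr_id ?normr0.
  move=> x _; rewrite /g ler_wpM2l // !indicE; case: (boolP (x \in _)) => //.
  rewrite inE /= in_itv /= andbT => Xx; rewrite mem_set //= in_itv /= andbT.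
  exact: le_lt_trans Xx.
rewrite [LHS]Rintegral_mkcond [RHS]Rintegral_mkcond; congr (Rintegral _ _ _).
apply/funext => x; rewrite !patchE indicE.
case: (boolP (x \in `]X, +oo[%classic)) => [xX|_]; last by rewrite mulr0 if_same.
by rewrite mem_set ?mulr1 //; apply: sub; rewrite inE in xX.
Qed.

(** [F] has the limit [F 0 + I] at infinity, with [I] the integral of [f]. A non-zero limit would
    keep [|F|] away from [0] near infinity, against integrability. This removes the boundary terms
    at infinity. *)
Lemma is_primitive_integral_Rplus F f : is_primitive F f ->
  mu.-integrable Rplus (EFin \o F) -> mu.-integrable Rplus (EFin \o f) ->
  \int[mu]_(x in Rplus) f x = - F 0.
Proof.
move=> [fi FE] iF i_f; set I := \int[mu]_(x in _) f x.
suff : F 0 + I = 0 by move=> /eqP; rewrite addrC addr_eq0 => /eqP.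
apply: contrapT => /eqP l0; set l := F 0 + I in l0.
have e0 : 0 < `|l| / 2 by rewrite divr_gt0 // normr_gt0.
have [N [N0 NP]] := integral_tail i_f e0.
apply: (not_integrable_ge N0 e0 _ iF) => x Nx.
have x0 : 0 <= x by rewrite ltW // (le_lt_trans N0).
have lE : l = F x + \int[mu]_(t in `]x, +oo[) f t.
  rewrite /l (FE x x0) -addrA; congr (_ + _).
  rewrite -(Rintegral_itv_obnd_cbnd (r := 0)); last first.
    by apply: integrableS (fi x x0) => //; apply: subset_itvr; rewrite bnd_simp.
  have := @Rintegral_itvB R f (BRight 0) +oo%O x i_f.
  by rewrite !bnd_simp x0 => /(_ isT isT) <-; rewrite addrC subrK.
have := NP x (ltW Nx); have -> : F x = l - \int[mu]_(t in `]x, +oo[) f t by rewrite lE addrK.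
set y := \int[mu]_(t in _) f t => yl.
have := ler_distD 0 l (l - (l - y)); rewrite !subr0.
have := ler_normB l (l - y); rewrite opprB addrC subrK.
have := ler_normD (l - y) y; rewrite subrK.
lra.
Qed.

End Infinity.

(** * Square integrability of the intermediate derivative *)

Section SobolevR.
Context (R : realType).
Local Notation mu := (@lebesgue_measure R).
Local Notation Rplus := (`]0, +oo[%classic : set R).
Implicit Types (F f : R -> R).

Lemma integrable_bounded_primitive f (C : R) : (forall x, 0 <= f x) ->
  measurable_fun setT f ->
  (forall x, 0 <= x -> mu.-integrable `[0, x] (EFin \o f)) ->
  (forall x, 0 <= x -> \int[mu]_(t in `[0, x]) f t <= C) ->
  mu.-integrable Rplus (EFin \o f).
Proof.
move=> f0 mf fi fC.
have sub : Rplus `<=` `[0, +oo[%classic by apply: subset_itvr; rewrite bnd_simp.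
apply: (@integrableS _ _ _ mu `[0, +oo[%classic) => //.
apply/integrableP; split.
  by apply/measurable_EFinP; exact: measurable_funS mf.
apply: (@le_lt_trans _ _ (\int[mu]_(x in `[0%R, +oo[) (f x)%:E)%E).
  rewrite le_eqVlt; apply/orP; left; apply/eqP.
  by apply: eq_integral => x _ /=; rewrite ger0_norm.
have cv := @ge0_cvgn_integral R mu f f0 mf.
apply: (@le_lt_trans _ _ C%:E); last exact: ltry.
rewrite -(cvg_lim (@ereal_hausdorff R) cv); apply: lime_le; first by apply/cvg_ex; eexists;
  exact: cv.
apply: nearW => n; rewrite -[leLHS]fineK; last by apply: integrable_fin_num => //; exact: fi.
by rewrite lee_fin; exact: fC.
Qed.

(* If f1^2 were not integrable, f0 f1 = c + \int (f1^2 + f0 f2) would exceed 1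
   near infinity, and so f0^2 would grow linearly. *)
Lemma sq_int_derivative f0 f1 f2 : is_primitive f0 f1 -> is_primitive f1 f2 ->
  sq_int f0 -> sq_int f2 -> sq_int f1.
Proof.
move=> p01 p12 s0 s2.
have cf1 := is_primitive_continuous p12.
have mf1' : measurable_fun (`[0, +oo[%classic : set R) f1.
  exact: subspace_continuous_measurable_fun.
have sub : Rplus `<=` `[0, +oo[%classic by apply: subset_itvr; rewrite bnd_simp.
split; first exact: measurable_funS mf1'.
have [prodi prodE] := is_primitiveM p01 p12.
have f1i x : 0 <= x -> mu.-integrable `[0, x] (EFin \o (fun t => f1 t ^+ 2)).
  move=> x0; apply: continuous_compact_integrable; first exact: segment_compact.
  have c1 := is_primitive_continuous_itv (b := x) p12.
  by move=> y; apply: continuousM; exact: c1.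
have f02 := integrable_sq_mul s0 s2.
have f02i x : 0 <= x -> mu.-integrable `[0, x] (EFin \o (fun t => f0 t * f2 t)).
  move=> x0; apply: integrable_continuous_mul; first exact: is_primitive_continuous_itv p01.
  by have [fi _] := p12; exact: fi.
pose C := \int[mu]_(t in Rplus) `|f0 t * f2 t|.
have f02C x : 0 <= x -> - C <= \int[mu]_(t in `[0, x]) (f0 t * f2 t).
  move=> x0; rewrite lerNl; apply: le_trans (ler_norm _) _; rewrite normrN.
  have s' : `]0, x]%classic `<=` Rplus by apply: subset_itvl; rewrite bnd_simp.
  have i' : mu.-integrable `]0, x] (EFin \o (fun t => f0 t * f2 t)) by exact: integrableS f02.
  rewrite -Rintegral_itv_obnd_cbnd //.
  apply: le_trans (le_normr_Rintegral _ i') _ => //.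
  have n' := integrable_norm f02.
  rewrite /C /Rintegral fine_le //.
  - by apply: integrable_fin_num => //; exact: integrableS n'.
  - exact: integrable_fin_num.
  by apply: ge0_subset_integral => //; case/integrableP: n'.
(* The threshold is such that once the integral of [f1^2] exceeds [D], the product [f0 f1] is at
   least [f0 0 * f1 0 + D - C = 1]. *)
pose D := 1 + C - f0 0 * f1 0.
have [bnd|nbnd] := pselect (forall x, 0 <= x -> \int[mu]_(t in `[0, x]) (f1 t ^+ 2) <= D).
  pose g := (fun t => f1 t ^+ 2) \_ `[0, +oo[.
  have gE x : 0 <= x -> g x = f1 x ^+ 2 by move=> x0; rewrite /g patchE mem_set //= in_itv /= x0.
  have gi : mu.-integrable Rplus (EFin \o g).
    apply: (@integrable_bounded_primitive _ D).
    - by move=> x; rewrite /g patchE; case: ifP => // _; exact: sqr_ge0.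
    - by apply/(measurable_restrictT _ _).1 => //; exact: measurable_funX.
    - move=> x x0; apply: eq_integrable (f1i x x0) => // y /set_mem /=.
      by rewrite in_itv /= => /andP[y0 _]; rewrite gE.
    - move=> x x0; rewrite (@eq_Rintegral _ _ _ mu _ (fun t => f1 t ^+ 2)); first exact: bnd.
      by move=> y /set_mem /=; rewrite in_itv /= => /andP[y0 _]; rewrite gE.
  apply: eq_integrable gi => // y /set_mem /=.
  by rewrite in_itv /= andbT => /ltW y0; rewrite gE.
have [N [N0 DN]] : exists N, 0 <= N /\ D < \int[mu]_(t in `[0, N]) (f1 t ^+ 2).
  apply: contrapT => no; apply: nbnd => x x0; rewrite leNgt; apply/negP => h.
  by apply: no; exists x.
have ge1 x : N <= x -> 1 <= f0 x * f1 x.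
  move=> Nx; have x0 : 0 <= x by exact: le_trans Nx.
  rewrite (prodE x x0) RintegralD //; [|exact: f1i|exact: f02i].
  have : \int[mu]_(t in `[0, N]) (f1 t ^+ 2) <= \int[mu]_(t in `[0, x]) (f1 t ^+ 2).
    rewrite /Rintegral fine_le //.
    - by apply: integrable_fin_num => //; exact: f1i.
    - by apply: integrable_fin_num => //; exact: f1i.
    apply: ge0_subset_integral => //.
    - by have /integrableP[] := f1i x x0.
    - by move=> t _; rewrite lee_fin sqr_ge0.
    by apply: subset_itvl; rewrite bnd_simp.
  have := f02C x x0; rewrite /D in DN; lra.
have [sqi sqE] := is_primitiveM p01 p01.
(* Beyond [N] the derivative of [f0^2] is at least [2], so one unit further on [f0^2] is larger than
   [1]. *)
exfalso; apply: (@not_integrable_ge _ (fun x => f0 x * f0 x) 1 (N + 1)).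
- by rewrite addr_ge0.
- by [].
- move=> x Nx; have x0 : 0 <= x by lra.
  have NN : N <= x by lra.
  rewrite ger0_norm -?expr2 ?sqr_ge0 // expr2 (sqE x x0).
  have i2 := sqi x x0.
  have := @Rintegral_itvB R _ (BLeft 0) (BRight x) N i2.
  rewrite !bnd_simp N0 => /(_ isT NN) eq.
  have -> : \int[mu]_(t in `[0, x]) (f1 t * f0 t + f0 t * f1 t) =
    \int[mu]_(t in `[0, N]) (f1 t * f0 t + f0 t * f1 t) +
    \int[mu]_(t in `]N, x]) (f1 t * f0 t + f0 t * f1 t) by rewrite -eq addrC subrK.
  rewrite addrA -(sqE N N0).
  have sN : `]N, x]%classic `<=` `[0, x]%classic.
    by apply: subset_itvr; rewrite bnd_simp.
  have iN : mu.-integrable `]N, x] (EFin \o (fun t => f1 t * f0 t + f0 t * f1 t)).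
    exact: integrableS i2.
  have cst2 : mu.-integrable `]N, x] (EFin \o (fun _ : R => 2 : R)).
    apply: (@integrableS _ _ _ mu `[0, x]%classic) => //.
    apply: continuous_compact_integrable; first exact: segment_compact.
    by apply: continuous_subspaceT => y; exact: cvg_cst.
  have : \int[mu]_(t in `]N, x]) 2 <= \int[mu]_(t in `]N, x]) (f1 t * f0 t + f0 t * f1 t).
    apply: le_Rintegral => // t /=; rewrite in_itv /= => /andP[/ltW/ge1 ? _]; lra.
  rewrite Rintegral_cst // [X in fine X]lebesgue_measure_itv /= lte_fin.
  rewrite (_ : (N < x) = true) /=; last by lra.
  by have := sqr_ge0 (f0 N); rewrite expr2; lra.
by have [_] := s0.
Qed.

End SobolevR.

(** * Continuous representatives and Green's formula *)

Section Sobolev.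
Context (R : realType).
Local Notation mu := (@lebesgue_measure R).
Local Notation Rplus := (`]0, +oo[%classic : set R).
Local Notation Re := (@complex.Re R).
Local Notation Im := (@complex.Im R).
Implicit Types (F f : R -> R[i]) (u v : L2 R).

Definition is_cprimitive F f :=
  is_primitive (fun x => Re (F x)) (fun x => Re (f x)) /\
  is_primitive (fun x => Im (F x)) (fun x => Im (f x)).

Lemma is_cprimitiveM F f (G g : R -> R[i]) : is_cprimitive F f -> is_cprimitive G g ->
  is_cprimitive (fun x => F x * G x) (fun x => f x * G x + F x * g x).
Proof.
move=> [FR FI] [GR GI]; split.
  have := is_primitiveD (is_primitiveM FR GR) (is_primitiveZ (-1) (is_primitiveM FI GI)).
  by congr is_primitive; apply/funext => x; rewrite !ReImE; ring.
have := is_primitiveD (is_primitiveM FR GI) (is_primitiveM FI GR).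
by congr is_primitive; apply/funext => x; rewrite !ReImE; ring.
Qed.

Lemma is_cprimitive_comb a F f (G g : R -> R[i]) : is_cprimitive F f -> is_cprimitive G g ->
  is_cprimitive (fun x => a * F x + G x) (fun x => a * f x + g x).
Proof.
move=> [FR FI] [GR GI]; split.
  have := is_primitiveD (is_primitiveD (is_primitiveZ (Re a) FR) (is_primitiveZ (- Im a) FI)) GR.
  by congr is_primitive; apply/funext => x; rewrite !ReImE; ring.
have := is_primitiveD (is_primitiveD (is_primitiveZ (Re a) FI) (is_primitiveZ (Im a) FR)) GI.
by congr is_primitive; apply/funext => x; rewrite !ReImE; ring.
Qed.

Lemma is_cprimitiveJ F f : is_cprimitive F f ->
  is_cprimitive (fun x => conjc (F x)) (fun x => conjc (f x)).
Proof.
move=> [FR FI]; split.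
  by have := FR; congr is_primitive; apply/funext => x; rewrite ReJ.
have := is_primitiveZ (-1) FI.
by congr is_primitive; apply/funext => x; rewrite ImJ mulN1r.
Qed.

Lemma is_cprimitive_integral_Rplus F f : is_cprimitive F f ->
  cintegrable F -> cintegrable f -> cintegral f = - F 0.
Proof.
move=> [FR FI] [iFR iFI] [ifR ifI]; apply: complexP; rewrite !ReImE /=.
  exact: is_primitive_integral_Rplus iFR ifR.
exact: is_primitive_integral_Rplus iFI ifI.
Qed.

(* [f0] and [f1] are the continuous representatives of [u] and [u'], and
   [u2] is [u'']. *)
Definition H2_repr (u u2 : L2 R) (f0 f1 : R -> R[i]) :=
  [/\ is_cprimitive f0 f1, is_cprimitive f1 u2 & ae_plus (fun x => u x = f0 x)].

Lemma is_primitive_measurable (F f : R -> R) : is_primitive F f -> measurable_fun Rplus F.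
Proof.
move=> pF; have sub : Rplus `<=` `[0, +oo[%classic by apply: subset_itvr; rewrite bnd_simp.
have m : measurable_fun (`[0, +oo[%classic : set R) F.
  by apply: subspace_continuous_measurable_fun => //; exact: is_primitive_continuous pF.
exact: measurable_funS m.
Qed.

Lemma H2_repr_csq0 u u2 f0 f1 : H2_repr u u2 f0 f1 -> csq_int f0.
Proof.
move=> [[pR pI] _ uf]; have [uR uI] := L2_csq u; split.
  by apply: (sq_int_ae_eq _ uR); [exact: is_primitive_measurable pR|apply: ae_plusS uf => x _ ->].
by apply: (sq_int_ae_eq _ uI); [exact: is_primitive_measurable pI|apply: ae_plusS uf => x _ ->].
Qed.

Lemma H2_repr_csq1 u u2 f0 f1 : H2_repr u u2 f0 f1 -> csq_int f1.
Proof.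
move=> h; have [sR sI] := H2_repr_csq0 h; have [tR tI] := L2_csq u2.
have [[p01R p01I] [p12R p12I] _] := h; split.
  exact: sq_int_derivative p01R p12R sR tR.
exact: sq_int_derivative p01I p12I sI tI.
Qed.

Lemma cintegral_real f (phi : R -> R) :
  cintegral (fun x => f x * (phi x)%:C) =
  (\int[mu]_(x in Rplus) (Re (f x) * phi x)) +i* (\int[mu]_(x in Rplus) (Im (f x) * phi x)).
Proof.
apply: complexP => /=; apply: eq_Rintegral => x _; rewrite !ReImE /=; ring.
Qed.

Lemma weak_derivativeP u v : weak_derivative u v <->
  weak_derivativeR (fun x => Re (u x)) (fun x => Re (v x)) /\
  weak_derivativeR (fun x => Im (u x)) (fun x => Im (v x)).
Proof.
split=> [uv|[uvR uvI]].
  by split=> phi tp; have := uv phi tp; rewrite !cintegral_real => -[].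
by move=> phi tp; rewrite !cintegral_real uvR // uvI.
Qed.

Lemma H2_derivatives_repr u u1 u2 : H2_derivatives u u1 u2 ->
  exists f0 f1, H2_repr u u2 f0 f1 /\ ae_plus (fun x => u1 x = f1 x).
Proof.
move=> [/weak_derivativeP[R01 I01] /weak_derivativeP[R12 I12]].
have [uR uI] := L2_csq u; have [u1R u1I] := L2_csq u1; have [u2R u2I] := L2_csq u2.
have step (a b c : R -> R) : sq_int a -> sq_int b -> sq_int c ->
    weak_derivativeR a b -> weak_derivativeR b c ->
    exists f0 f1 : R -> R, [/\ is_primitive f0 f1, is_primitive f1 c,
      ae_plus (fun x => a x = f0 x) & ae_plus (fun x => b x = f1 x)].
  move=> sa sb sc ab bc.
  have [f1 p1 e1] := weak_derivative_is_primitive (sq_int_locally_int sb)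
    (fun x _ => sq_int_integrable0 x sc) bc.
  have s1 : sq_int f1.
    apply: (sq_int_ae_eq _ sb); first exact: is_primitive_measurable p1.
    by apply: ae_plusS e1 => x _ ->.
  (* The class [b] is replaced by its continuous representative before the second integration, so
     that [f0] has derivative [f1] itself and not merely a function equal to it almost
     everywhere. *)
  have ab' : weak_derivativeR a f1.
    move=> phi tp; rewrite ab //; congr (- _); apply: eq_ae_plus_Rintegral.
    - exact: integrable_measurable (integrable_test (sq_int_locally_int sb) tp).
    - exact: integrable_measurable (integrable_test (sq_int_locally_int s1) tp).
    by apply: ae_plusS e1 => x _ ->.
  have [f0 p0 e0] := weak_derivative_is_primitive (sq_int_locally_int sa)
    (fun x _ => sq_int_integrable0 x s1) ab'.
  by exists f0, f1.
have [r0 [r1 [pr0 pr1 er0 er1]]] := step _ _ _ uR u1R u2R R01 R12.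
have [s0 [s1 [ps0 ps1 es0 es1]]] := step _ _ _ uI u1I u2I I01 I12.
exists (fun x => r0 x +i* s0 x), (fun x => r1 x +i* s1 x); split; first split=> //.
  by apply: ae_plusS2 er0 es0 => x _; case: (u x) => a b /= -> ->.
by apply: ae_plusS2 er1 es1 => x _; case: (u1 x) => a b /= -> ->.
Qed.

Lemma H2_repr_derivatives u u2 f0 f1 : H2_repr u u2 f0 f1 ->
  exists u1, H2_derivatives u u1 u2 /\ ae_plus (fun x => u1 x = f1 x).
Proof.
move=> h; have [u1 e1] := L2_of_fun (H2_repr_csq1 h).
have [[p0R p0I] [p1R p1I] e0] := h; exists u1; split=> //.
have [uR uI] := L2_csq u; have [u1R u1I] := L2_csq u1; have [f1R f1I] := H2_repr_csq1 h.
have conv (a b : R -> R) : sq_int a -> sq_int b -> ae_plus (fun x => a x = b x) ->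
    forall v : R -> R, weak_derivativeR v b -> weak_derivativeR v a.
  move=> sa sb ab v vb phi tp; rewrite vb //; congr (- _); apply: eq_ae_plus_Rintegral.
  - exact: integrable_measurable (integrable_test (sq_int_locally_int sb) tp).
  - exact: integrable_measurable (integrable_test (sq_int_locally_int sa) tp).
  by apply: ae_plusS ab => x _ ->.
split; apply/weak_derivativeP; split.
- apply: (conv _ _ u1R f1R); first by apply: ae_plusS e1 => x _ ->.
  by apply: is_primitive_weak (sq_int_locally_int uR) p0R _; apply: ae_plusS e0 => x _ ->.
- apply: (conv _ _ u1I f1I); first by apply: ae_plusS e1 => x _ ->.
  by apply: is_primitive_weak (sq_int_locally_int uI) p0I _; apply: ae_plusS e0 => x _ ->.
- by apply: is_primitive_weak (sq_int_locally_int u1R) p1R _; apply: ae_plusS e1 => x _ ->.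
- by apply: is_primitive_weak (sq_int_locally_int u1I) p1I _; apply: ae_plusS e1 => x _ ->.
Qed.

(** The points of agreement accumulate at [0]. This makes the boundary value of a class independent
    of the continuous representative. *)
Lemma continuous_ae_eq0 (f h : R -> R) :
  {within `[0, +oo[, continuous f} -> {within `[0, +oo[, continuous h} ->
  ae_plus (fun x => f x = h x) -> f 0 = h 0.
Proof.
move=> /subspace_continuousP cf /subspace_continuousP ch fh.
have z : `[0, +oo[%classic (0 : R) by rewrite /= in_itv /= lexx.
have {}cf := cf 0 z; have {}ch := ch 0 z.
apply: contrapT => /eqP neq; have e0 : 0 < `|f 0 - h 0| / 2.
  by rewrite divr_gt0 // normr_gt0 subr_eq0.
move/cvgrPdist_lt : cf => /(_ _ e0) cf; move/cvgrPdist_lt : ch => /(_ _ e0) ch.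
have near0 : nbhs (0 : R) (fun x => 0 <= x -> `|f 0 - f x| < `|f 0 - h 0| / 2 /\
    `|h 0 - h x| < `|f 0 - h 0| / 2).
  have A1 : nbhs (0 : R) (fun x => `[0, +oo[%classic x -> `|f 0 - f x| < `|f 0 - h 0| / 2) := cf.
  have A2 : nbhs (0 : R) (fun x => `[0, +oo[%classic x -> `|h 0 - h x| < `|f 0 - h 0| / 2) := ch.
  apply: filterS (filterI A1 A2) => x [a1 a2] x0.
  by split; [apply: a1|apply: a2]; rewrite /= in_itv /= x0.
have [d /= d0 dP] := near0.
have [x [/andP[x0 xd] fx]] := ae_plus_exists (lexx 0) d0 fh.
have [|a1 a2] := dP x _ (ltW x0); first by rewrite /ball_ /= sub0r normrN gtr0_norm.
have : `|f 0 - h 0| <= `|f 0 - f x| + `|h 0 - h x|.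
  by rewrite (distrC (h 0)) -fx; exact: ler_distD.
lra.
Qed.

Lemma value_at0P u F f a : is_cprimitive F f -> ae_plus (fun x => u x = F x) ->
  value_at0 u a <-> F 0 = a.
Proof.
move=> [FR FI] uF; split=> [[h [hR hI uh <-]]|<-].
  have hF : ae_plus (fun x => F x = h x) by apply: ae_plusS2 uF uh => x _ -> ->.
  apply: complexP.
    apply: continuous_ae_eq0 (is_primitive_continuous FR) hR _.
    by apply: ae_plusS hF => x _ ->.
  apply: continuous_ae_eq0 (is_primitive_continuous FI) hI _.
  by apply: ae_plusS hF => x _ ->.
by exists F; split=> //; [exact: is_primitive_continuous FR|exact: is_primitive_continuous FI].
Qed.

(** The Wronskian [conj f0 * h1 - conj f1 * h0] has derivative [conj f0 * v2 - conj u2 * h0]. Both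
    are integrable, so only the boundary term at [0] survives. *)
Lemma green u u2 f0 f1 v v2 h0 h1 : H2_repr u u2 f0 f1 -> H2_repr v v2 h0 h1 ->
  L2_ip u v2 - L2_ip u2 v = conjc (f1 0) * h0 0 - conjc (f0 0) * h1 0.
Proof.
move=> hu hv; have [pu01 pu12 eu] := hu; have [pv01 pv12 ev] := hv.
have su0 := H2_repr_csq0 hu; have su1 := H2_repr_csq1 hu; have su2 := L2_csq u2.
have sv0 := H2_repr_csq0 hv; have sv1 := H2_repr_csq1 hv; have sv2 := L2_csq v2.
have refl (w : R -> R[i]) : ae_plus (fun x => w x = w x) by exact: aeW.
rewrite (L2_ip_ae su0 sv2 eu (refl v2)) (L2_ip_ae su2 sv0 (refl u2) ev).
have i1 := cintegrable_ip su0 sv2; have i2 := cintegrable_ip su2 sv0.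
have p := is_cprimitive_comb (-1) (is_cprimitiveM (is_cprimitiveJ pu12) pv01)
  (is_cprimitiveM (is_cprimitiveJ pu01) pv12).
have fE : (fun x => - 1 * (conjc (u2 x) * h0 x + conjc (f1 x) * h1 x) +
      (conjc (f1 x) * h1 x + conjc (f0 x) * v2 x)) =
    (fun x => conjc (f0 x) * v2 x + - (conjc (u2 x) * h0 x)).
  by apply/funext => x; ring.
rewrite fE in p.
have iF : cintegrable (fun x => -1 * (conjc (f1 x) * h0 x) + conjc (f0 x) * h1 x).
  by apply: cintegrable_comb; exact: cintegrable_ip.
have := is_cprimitive_integral_Rplus p iF (cintegrableD i1 (cintegrableN i2)).
rewrite cintegralD //; last exact: cintegrableN.
by rewrite cintegralN // => ->; ring.
Qed.

Lemma weak_second_derivative_repr (u q : L2 R) :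
  (forall phi, test_function phi ->
    cintegral (fun x => u x * (derive1 (derive1 phi) x)%:C) =
    cintegral (fun x => q x * (phi x)%:C)) ->
  exists f0 f1, H2_repr u q f0 f1.
Proof.
move=> uq; have [uR uI] := L2_csq u; have [qR qI] := L2_csq q.
have [|r0 [r1 [pr0 pr1 er]]] := weak_second_derivative (sq_int_locally_int uR)
    (fun x _ => sq_int_integrable0 x qR).
  by move=> phi tp; have := uq phi tp; rewrite !cintegral_real => -[].
have [|s0 [s1 [ps0 ps1 es]]] := weak_second_derivative (sq_int_locally_int uI)
    (fun x _ => sq_int_integrable0 x qI).
  by move=> phi tp; have := uq phi tp; rewrite !cintegral_real => -[].
exists (fun x => r0 x +i* s0 x), (fun x => r1 x +i* s1 x); split=> //.
by apply: ae_plusS2 er es => x _; case: (u x) => a b /= -> ->.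
Qed.

End Sobolev.

(** * Schroedinger operators with bounded potential *)

Section BoundedPotential.
Context (R : realType).
Local Notation mu := (@lebesgue_measure R).
Local Notation Rplus := (`]0, +oo[%classic : set R).
Local Notation Re := (@complex.Re R).
Local Notation Im := (@complex.Im R).
Implicit Types (W : R -> R[i]) (u v : L2 R).

Definition ess_bounded W := exists M, [/\ 0 <= M,
  measurable_fun Rplus (fun x => Re (W x)), measurable_fun Rplus (fun x => Im (W x)),
  ae_plus (fun x => `|Re (W x)| <= M) & ae_plus (fun x => `|Im (W x)| <= M)].

Lemma Lfun_oo_bounded (f : R -> R) : f \_ Rplus \in Lfun mu +oo%E ->
  measurable_fun Rplus f /\ exists2 M, 0 <= M & ae_plus (fun x => `|f x| <= M).
Proof.
move=> fL; have mf : measurable_fun setT (f \_ Rplus).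
  by have := sub_Lfun_mfun fL; rewrite inE.
split; first exact/(measurable_restrictT _ _).2.
have := sub_Lfun_finLfun fL; rewrite inE /= /finite_norm unlock /Lnorm.
(* The [L^oo] norm is the essential supremum under the guard that the total measure is positive. *)
have -> : (0 < mu [set: R])%E.
  apply: (@lt_le_trans _ _ (mu `[0, 1])).
    by rewrite /= lebesgue_measure_itv /= lte_fin ltr01 oppr0 adde0 lte_fin.
  by apply: le_measure; rewrite ?inE.
move=> supy; set s := ess_sup _ _ in supy.
have fs : {ae mu, forall x, (`|(f \_ Rplus) x|%:E <= s)%E} by exact: ess_sup_ge.
exists `|fine s| => //; apply/ae_plus_filter; move: fs.
apply: (@filterS _ _ (ae_filter_ringOfSetsType mu)) => x + Rx.
rewrite patchE mem_set //; case: s supy => //= r _; rewrite lee_fin => le.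
exact: le_trans le (ler_norm _).
Qed.

Lemma LpC_oo_bounded W : LpC +oo%E W -> ess_bounded W.
Proof.
move=> /andP[/Lfun_oo_bounded[mR [M M0 RM]] /Lfun_oo_bounded[mI [N N0 IN]]].
exists (M + N); split=> //; first by rewrite addr_ge0.
  by apply: ae_plusS RM => x _ le; rewrite (le_trans le) // lerDl.
by apply: ae_plusS IN => x _ le; rewrite (le_trans le) // lerDr.
Qed.

Lemma ess_boundedJ W : ess_bounded W -> ess_bounded (fun x => conjc (W x)).
Proof.
move=> [M [M0 mR mI RM IM]]; exists M; split=> //.
- by under [X in measurable_fun _ X]eq_fun do rewrite ReJ.
- by under [X in measurable_fun _ X]eq_fun do rewrite ImJ; exact: measurableT_comp.
- by apply: ae_plusS RM => x _; rewrite ReJ.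
by apply: ae_plusS IM => x _; rewrite ImJ normrN.
Qed.

Lemma ess_boundedB W (l : R) : ess_bounded W -> ess_bounded (fun x => W x - l%:C).
Proof.
move=> [M [M0 mR mI RM IM]]; exists (M + `|l|); split.
- by rewrite addr_ge0.
- by under [X in measurable_fun _ X]eq_fun do rewrite !ReImE /=; exact: measurable_funB.
- by under [X in measurable_fun _ X]eq_fun do rewrite !ReImE /= oppr0 addr0.
- apply: ae_plusS RM => x _ le; rewrite !ReImE /=.
  by apply: le_trans (ler_normB _ _) _; rewrite lerD2r.
by apply: ae_plusS IM => x _ le; rewrite !ReImE /= oppr0 addr0 (le_trans le) // lerDl.
Qed.

Lemma csq_int_mul W (f : R -> R[i]) : ess_bounded W -> csq_int f -> csq_int (fun x => W x * f x).
Proof.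
move=> [M [M0 mR mI RM IM]] [fR fI]; split.
  under [X in sq_int X]eq_fun do rewrite !ReImE.
  by apply: sq_intB; apply: sq_int_bounded_mul; eauto.
under [X in sq_int X]eq_fun do rewrite !ReImE.
by apply: sq_intD; apply: sq_int_bounded_mul; eauto.
Qed.

Lemma Rintegral_ae_le0 (g : R -> R) x : 0 <= x -> mu.-integrable `[0, x] (EFin \o g) ->
  ae_plus (fun t => g t <= 0) -> \int[mu]_(t in `[0, x]) g t <= 0.
Proof.
move=> x0 gi g0; have mg := integrable_measurable gi.
have i' : mu.-integrable `]0, x] (EFin \o g).
  by apply: integrableS gi => //; apply: subset_itvr; rewrite bnd_simp.
rewrite -Rintegral_itv_obnd_cbnd // -oppr_ge0 -mulN1r -RintegralZl //.
have -> : \int[mu]_(t in `]0, x]) (-1 * g t) = \int[mu]_(t in `]0, x]) `|g t|.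
  congr fine; apply: ae_eq_integral => //.
  - apply/measurable_EFinP; apply: measurable_funM => //; exact: integrable_measurable i'.
  - by apply/measurable_EFinP; apply: measurableT_comp => //; exact: integrable_measurable i'.
  apply: (@filterS _ _ (ae_filter_ringOfSetsType mu)) g0 => t gt0 /=.
  rewrite in_itv /= => /andP[t0 _]; rewrite ler0_norm ?mulN1r //; exact: gt0.
by apply: Rintegral_ge0.
Qed.

Lemma is_derive_expRZ (c x : R) : is_derive x 1 (fun y => expR (c * y)) (c * expR (c * x)).
Proof.
have dc : is_derive x 1 (fun y : R => c * y) c.
  by apply: is_derive_eq; rewrite /GRing.scale /= mulr1.
by have := @is_derive1_comp _ expR (fun y => c * y) x _ _ (is_derive_expR _) dc; rewrite mulrC.
Qed.

Lemma continuous_expRZ (c : R) : continuous (fun x => expR (c * x)).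
Proof.
move=> x; apply/differentiable_continuous/derivable1_diffP.
by have [] := is_derive_expRZ c x.
Qed.

Lemma is_primitive_expR (c : R) :
  is_primitive (fun x => expR (c * x)) (fun x => c * expR (c * x)).
Proof.
apply: is_primitive_C1; first by move=> x; exact: is_derive_expRZ.
by move=> x; apply: cvgM; [exact: cvg_cst|exact: continuous_expRZ].
Qed.

(** Expand [(M - p) (x + y)^2 + (M + p) (x - y)^2 >= 0]. *)
Lemma mul_bound (p M x y : R) : `|p| <= M -> 2 * (p * (x * y)) <= M * (x * x + y * y).
Proof.
rewrite ler_norml => /andP[Mp pM].
have := mulr_ge0 (_ : 0 <= M - p) (sqr_ge0 (x + y)).
have := mulr_ge0 (_ : 0 <= M + p) (sqr_ge0 (x - y)).
nra.
Qed.

(* Gronwall: N = |f0|^2 + |f1|^2 satisfies N' <= k N, so exp (- k x) N decreases. *)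
Lemma ode_unique W u u2 f0 f1 : ess_bounded W -> H2_repr u u2 f0 f1 ->
  ae_plus (fun x => u2 x = W x * u x) -> f0 0 = 0 -> f1 0 = 0 -> u = 0.
Proof.
move=> [M [M0 _ _ RM IM]] [[pa pb] [pc pd] uf] u2W f00 f10.
pose a x := Re (f0 x); pose b x := Im (f0 x); pose c x := Re (f1 x); pose d x := Im (f1 x).
pose N x := a x * a x + b x * b x + (c x * c x + d x * d x).
have pN := is_primitiveD (is_primitiveD (is_primitiveM pa pa) (is_primitiveM pb pb))
  (is_primitiveD (is_primitiveM pc pc) (is_primitiveM pd pd)).
(* In the derivative of [N], the terms [2 (a c + b d)] contribute at most [N]; the four products
   containing [Re W] or [Im W] contribute at most [2 M N] by [mul_bound]. *)
pose k := 1 + 2 * M.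
have [Ei EE] := is_primitiveM (is_primitive_expR (- k)) pN.
have N0 x : 0 <= x -> N x <= 0.
  move=> x0; have := EE x x0; rewrite !f00 !f10 /= !mulr0 !addr0 mulr0 add0r => E.
  have : expR (- k * x) * N x <= 0.
    rewrite [leLHS]E; apply: Rintegral_ae_le0 => //; first exact: Ei.
    have WP := ae_plusS2 (fun t _ p q => conj p q) RM IM.
    have uP := ae_plusS2 (fun t _ p q => conj p q) uf u2W.
    apply: ae_plusS2 WP uP => t t0 [RMt IMt] [ut u2t].
    rewrite u2t ut !ReImE -/(a t) -/(b t) -/(c t) -/(d t).
    have := @mul_bound (Re (W t)) M (c t) (a t) RMt.
    have := @mul_bound (- Im (W t)) M (c t) (b t) _; rewrite normrN => /(_ IMt).
    have := @mul_bound (Re (W t)) M (d t) (b t) RMt.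
    have := @mul_bound (Im (W t)) M (d t) (a t) IMt.
    have := sqr_ge0 (a t - c t); have := sqr_ge0 (b t - d t).
    move: (Re (W t)) (Im (W t)) (a t) (b t) (c t) (d t) => p q A B C D h1 h2 h3 h4 h5 h6.
    rewrite [- k * _]mulrC -mulrA -mulrDr pmulr_rle0 ?expR_gt0 // /k.
    nra.
  by rewrite pmulr_rle0 // expR_gt0.
apply/L2_eqP.
apply: ae_plusS2 uf (L2_zeroE R) => x x0 -> ->.
have := N0 x (ltW x0); rewrite /N /a /b => h.
have := sqr_ge0 (c x); have := sqr_ge0 (d x).
have := sqr_ge0 (Re (f0 x)); have := sqr_ge0 (Im (f0 x)); rewrite !expr2 => h1 h2 h3 h4.
by apply: complexP; apply/eqP; rewrite /= -sqrf_eq0 expr2; apply/eqP; lra.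
Qed.

End BoundedPotential.

(** * The maximal operator and its boundary form *)

Section Schroedinger.
Context (R : realType).
Local Notation mu := (@lebesgue_measure R).
Local Notation Rplus := (`]0, +oo[%classic : set R).
Local Notation Re := (@complex.Re R).
Local Notation Im := (@complex.Im R).
Local Notation ip := (@L2_ip R).
Implicit Types (W : R -> R[i]) (u v p q : L2 R).

Lemma conjcD (x y : R[i]) : conjc (x + y) = conjc x + conjc y.
Proof. exact: rmorphD. Qed.

Lemma conjcN (x : R[i]) : conjc (- x) = - conjc x.
Proof. exact: rmorphN. Qed.

Lemma is_primitive_ae (F f g : R -> R) : is_primitive F f -> sq_int g ->
  ae_plus (fun x => f x = g x) -> is_primitive F g.
Proof.
move=> [fi FE] gs fg; split=> x x0; first exact: sq_int_integrable0.
have gi := sq_int_integrable0 x gs.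
have s1 : `]0, x]%classic `<=` `[0, x]%classic by apply: subset_itvr; rewrite bnd_simp.
have fi' : mu.-integrable `]0, x] (EFin \o f) by exact: integrableS (fi x x0).
have gi' : mu.-integrable `]0, x] (EFin \o g) by exact: integrableS gi.
rewrite FE // -(Rintegral_itv_obnd_cbnd fi') -(Rintegral_itv_obnd_cbnd gi').
congr (_ + fine _); apply: ae_eq_integral => //.
- by case/integrableP: fi'.
- by case/integrableP: gi'.
apply: (@filterS _ _ (ae_filter_ringOfSetsType mu)) fg => t fgt /=.
by rewrite in_itv /= => /andP[t0 _]; rewrite fgt.
Qed.

Lemma is_cprimitive_ae (F f g : R -> R[i]) : is_cprimitive F f -> csq_int g ->
  ae_plus (fun x => f x = g x) -> is_cprimitive F g.
Proof.
move=> [FR FI] [gR gI] fg; split.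
  by apply: is_primitive_ae FR gR _; apply: ae_plusS fg => x _ ->.
by apply: is_primitive_ae FI gI _; apply: ae_plusS fg => x _ ->.
Qed.

Lemma ae_plusI (P Q : R -> Prop) : ae_plus P -> ae_plus Q -> ae_plus (fun x => P x /\ Q x).
Proof. by apply: ae_plusS2. Qed.

(* The operator - d^2/dx^2 + W on H^2(R^+), without boundary condition at 0;
   [a] and [b] are the boundary values of the function and of its derivative. *)
Definition schroedinger W (a b : R[i]) (p q : L2 R) := exists f0 f1 p2,
  [/\ H2_repr p p2 f0 f1, f0 0 = a, f1 0 = b &
      ae_plus (fun x => q x = - p2 x + W x * p x)].

(** For bounded [W] this is the adjoint of the minimal operator with the conjugate potential. *)
Definition A_max W : set (L2 R * L2 R) := [set r | exists a b, schroedinger W a b r.1 r.2].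

Lemma schroedinger_comb W c a b a' b' p q p' q' :
  schroedinger W a b p q -> schroedinger W a' b' p' q' ->
  schroedinger W (c * a + a') (c * b + b') (c *: p + p') (c *: q + q').
Proof.
move=> [f0 [f1 [p2 [[p01 p12 pf] <- <- qE]]]] [h0 [h1 [p2' [[p01' p12' pf'] <- <- qE']]]].
have e2 := L2_combE c p2 p2'; have e0 := L2_combE c p p'; have e := L2_combE c q q'.
exists (fun x => c * f0 x + h0 x), (fun x => c * f1 x + h1 x), (c *: p2 + p2').
split=> //; last first.
  apply: ae_plusS2 (ae_plusI (ae_plusI qE qE') (ae_plusI e0 e2)) e.
  by move=> x _ [[-> ->] [-> ->]] ->; ring.
split; first exact: is_cprimitive_comb.
  apply: (is_cprimitive_ae (is_cprimitive_comb c p12 p12')); first exact: L2_csq.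
  by apply: ae_plusS e2 => x _ ->.
by apply: ae_plusS2 (ae_plusI pf pf') e0 => x _ [-> ->] ->.
Qed.

Lemma schroedinger_intro W (F0 F1 F2 : R -> R[i]) : ess_bounded W ->
  is_cprimitive F0 F1 -> is_cprimitive F1 F2 -> csq_int F0 -> csq_int F2 ->
  exists p q, [/\ schroedinger W (F0 0) (F1 0) p q, ae_plus (fun x => p x = F0 x) &
    ae_plus (fun x => q x = - F2 x + W x * F0 x)].
Proof.
move=> bW p01 p12 s0 s2.
have [p pE] := L2_of_fun s0; have [p2 p2E] := L2_of_fun s2.
have sq : csq_int (fun x => - F2 x + W x * F0 x).
  have := csq_int_comb (-1) s2 (csq_int_mul bW s0).
  by under eq_fun do rewrite mulN1r.
have [q qE] := L2_of_fun sq; exists p, q; split=> //; exists F0, F1, p2; split=> //.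
  split=> //; apply: (is_cprimitive_ae p12); first exact: L2_csq.
  by apply: ae_plusS p2E => x _ ->.
by apply: ae_plusS2 (ae_plusI pE p2E) qE => x _ [-> ->] ->.
Qed.

Lemma test_csq_int (phi : R -> R) : test_function phi -> csq_int (fun x => (phi x)%:C).
Proof.
move=> tp; have cphi := smooth_continuous (test_smooth tp); split; last first.
  by split=> //=; under [X in _ \o X]eq_fun do rewrite expr0n; exact: integrable0.
have lp : locally_int phi.
  move=> a b _; apply: continuous_compact_integrable; first exact: segment_compact.
  exact: continuous_subspaceT.
have pp := integrable_test lp tp; split=> //.
have mphi : measurable_fun [set: R] phi by exact: continuous_measurable_fun.
exact: measurable_funS mphi.
Qed.

Lemma test_is_cprimitive (phi : R -> R) : test_function phi ->
  is_cprimitive (fun x => (phi x)%:C) (fun x => (derive1 phi x)%:C).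
Proof.
by move=> tp; split; [exact/smooth_is_primitive/test_smooth|exact: is_primitive_cst].
Qed.

Lemma test_schroedinger W phi : ess_bounded W -> test_function phi ->
  exists p q, [/\ schroedinger W 0 0 p q, ae_plus (fun x => p x = (phi x)%:C) &
    ae_plus (fun x => q x = - (derive1 (derive1 phi) x)%:C + W x * (phi x)%:C)].
Proof.
move=> bW tp; have tp' := test_derive1 tp; have tp'' := test_derive1 tp'.
have [p [q [pq pE qE]]] := schroedinger_intro bW (test_is_cprimitive tp)
  (test_is_cprimitive tp') (test_csq_int tp) (test_csq_int tp'').
exists p, q; split=> //; have zero psi : test_function psi -> psi 0 = 0.
  by case=> _ [a [b [a0 ab]]]; apply: ab; left.
by move: pq; rewrite zero // zero.
Qed.

Lemma A_minE V u v : A_min V (u, v) <-> schroedinger V 0 0 u v.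
Proof.
split=> [[u1 [u2 [hu v0 v1 vE]]]|[f0 [f1 [u2 [hu f00 f10 vE]]]]].
  have [f0 [f1 [hr u1f]]] := H2_derivatives_repr hu; have [p01 p12 uf] := hr.
  exists f0, f1, u2; split=> //.
    exact/(value_at0P _ p01 uf).
  exact/(value_at0P _ p12 u1f).
have [u1 [der u1f]] := H2_repr_derivatives hu; have [p01 p12 uf] := hu.
exists u1, u2; split=> //; first exact/(value_at0P _ p01 uf).
exact/(value_at0P _ p12 u1f).
Qed.

Lemma aerefl (F : R -> R[i]) : ae_plus (fun x => F x = F x).
Proof. exact: aeW. Qed.

Lemma ip_schroedinger W p q p2 v : ess_bounded W ->
  ae_plus (fun x => q x = - p2 x + W x * p x) ->
  ip v q = - ip v p2 + cintegral (fun x => conjc (v x) * (W x * p x)).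
Proof.
move=> bW qE; have sp := L2_csq p; have s2 := L2_csq p2; have sv := L2_csq v.
have sW := csq_int_mul bW sp.
have sq : csq_int (fun x => - p2 x + W x * p x).
  have := csq_int_comb (-1) s2 sW.
  by under eq_fun do rewrite mulN1r.
rewrite (L2_ip_ae sv sq (aerefl v) qE) -mulN1r -cintegral_comb; [|exact: cintegrable_ip..].
by congr cintegral; apply/funext => x; ring.
Qed.

(** The potentials are conjugate to each other, so their contributions cancel and the boundary form
    of [- d^2/dx^2] remains. *)
Lemma green_schroedinger V a b c d u v p q : ess_bounded V ->
  schroedinger V a b u v -> schroedinger (fun x => conjc (V x)) c d p q ->
  ip u q - ip v p = conjc a * d - conjc b * c.
Proof.
move=> bV [f0 [f1 [u2 [hu <- <- vE]]]] [h0 [h1 [p2 [hp <- <- qE]]]].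
have ipP := L2_inner_product R.
rewrite (ip_schroedinger _ (ess_boundedJ bV) qE) (ip_conj ipP p v) (ip_schroedinger _ bV vE).
rewrite conjcD conjcN -(ip_conj ipP) -cintegral_conj; last first.
  by apply: cintegrable_ip; [exact: L2_csq|apply: csq_int_mul => //; exact: L2_csq].
have -> : cintegral (fun x => conjc (conjc (p x) * (V x * u x))) =
    cintegral (fun x => conjc (u x) * (conjc (V x) * p x)).
  by congr cintegral; apply/funext => x; rewrite !conjcM conjcK; ring.
have := green hu hp; set X := cintegral _; move: (ip u p2) (ip u2 p) => A B gr.
by rewrite -[RHS]opprB -gr; ring.
Qed.

(** Green's formula with both arguments equal to [p] computes [<p, p''>] minus its conjugate, that
    is [2 i Im <p, p''>], from the boundary values. *)
Lemma Im_schroedinger W a b p q : ess_bounded W -> schroedinger W a b p q ->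
  Im (ip p q) = Im (conjc a * b) +
    \int[mu]_(x in Rplus) (Im (W x) * (Re (p x) ^+ 2 + Im (p x) ^+ 2)).
Proof.
move=> bW [f0 [f1 [p2 [hp <- <- qE]]]]; have ipP := L2_inner_product R.
rewrite (ip_schroedinger _ bW qE) ImD ImN.
have -> : Im (cintegral (fun x => conjc (p x) * (W x * p x))) =
    \int[mu]_(x in Rplus) (Im (W x) * (Re (p x) ^+ 2 + Im (p x) ^+ 2)).
  by apply: eq_Rintegral => x _; rewrite !ReImE; ring.
congr (_ + _); have := green hp hp; rewrite (ip_conj ipP p p2).
case: (ip p p2) (f0 0) (f1 0) => x y [s t] [s' t'] [_]; rewrite /= => h; lra.
Qed.

End Schroedinger.

Lemma adjoint_subspace (R : realType) (E : lmodType R[i]) (ip : E -> E -> R[i])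
  (T : set (E * E)) : inner_product ip -> Defs.subspace (adjoint_in ip setT T).
Proof.
move=> ipP; split=> [|a [u v] [u' v'] [_ _ uv] [_ _ uv']].
  by split=> // p q _; rewrite /= !(ip0l ipP).
split=> // p q Tpq /=; have /= e := uv _ _ Tpq; have /= e' := uv' _ _ Tpq.
by rewrite !(ipDl ipP) !(ipZl ipP) e e'.
Qed.

(** * The minimal and maximal operators as mutual adjoints *)

Section MinimalOperator.
Context (R : realType).
Local Notation mu := (@lebesgue_measure R).
Local Notation Rplus := (`]0, +oo[%classic : set R).
Local Notation Re := (@complex.Re R).
Local Notation Im := (@complex.Im R).
Local Notation ip := (@L2_ip R).
Implicit Types (u v p q : L2 R).

Lemma cintegral_test_eq0 u :
  (forall phi, test_function phi -> cintegral (fun x => u x * (phi x)%:C) = 0) -> u = 0.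
Proof.
move=> u0; have [uR uI] := L2_csq u.
have R0 : ae_plus (fun x => Re (u x) = 0).
  apply: fundamental_lemma; first exact: sq_int_locally_int.
  by move=> phi /u0; rewrite cintegral_real => -[].
have I0 : ae_plus (fun x => Im (u x) = 0).
  apply: fundamental_lemma; first exact: sq_int_locally_int.
  by move=> phi /u0; rewrite cintegral_real => -[].
apply/L2_eqP; apply: ae_plusS2 (ae_plusI R0 I0) (L2_zeroE R) => x _ [re im] ->.
exact: complexP.
Qed.

Lemma cintegrable_test u phi : test_function phi ->
  cintegrable (fun x => u x * (phi x)%:C).
Proof. by move=> tp; apply: cintegrable_mul; [exact: L2_csq|exact: test_csq_int]. Qed.

Lemma A_min_orthogonal V u : ess_bounded V ->
  (forall w, domain (A_min V) w -> ip w u = 0) -> u = 0.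
Proof.
move=> bV u0; apply: cintegral_test_eq0 => phi tp.
have [p [q [/A_minE pq pE _]]] := test_schroedinger bV tp.
rewrite -(u0 p); last by exists q.
rewrite (L2_ip_ae (test_csq_int tp) (L2_csq u) pE (aerefl u)).
by congr cintegral; apply/funext => x; rewrite conjcR mulrC.
Qed.

(** Pairing with test functions says that [u'' = V u - v] in the sense of distributions. The
    right-hand side is in [L^2] because [V] is bounded, so [u] is in [H^2]. *)
Lemma adjoint_A_min V u v : ess_bounded V ->
  (forall p q, A_min (fun x => conjc (V x)) (p, q) -> ip u q = ip v p) -> A_max V (u, v).
Proof.
move=> bV adj; have bW := ess_boundedJ bV.
have sq : csq_int (fun x => - v x + V x * u x).
  have := csq_int_comb (-1) (L2_csq v) (csq_int_mul bV (L2_csq u)).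
  by under eq_fun do rewrite mulN1r.
have [w wE] := L2_of_fun sq.
have [|f0 [f1 hr]] := @weak_second_derivative_repr R u w.
  move=> phi tp; have [p [q [pq pE qE]]] := test_schroedinger bW tp.
  have tp'' := test_derive1 (test_derive1 tp).
  move: pq => /A_minE/adj.
  have sp := test_csq_int tp; have sp'' := test_csq_int tp''.
  have sWp : csq_int (fun x => conjc (V x) * (phi x)%:C) by exact: csq_int_mul.
  have sqq : csq_int (fun x => - (derive1 (derive1 phi) x)%:C + conjc (V x) * (phi x)%:C).
    have := csq_int_comb (-1) sp'' sWp.
    by under eq_fun do rewrite mulN1r.
  rewrite (L2_ip_ae (L2_csq u) sqq (aerefl u) qE) (L2_ip_ae (L2_csq v) sp (aerefl v) pE).
  move=> /(congr1 conjc); rewrite -(cintegral_conj (cintegrable_ip (L2_csq u) sqq)).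
  rewrite -(cintegral_conj (cintegrable_ip (L2_csq v) sp)).
  have -> : (fun x => conjc (conjc (u x) *
      (- (derive1 (derive1 phi) x)%:C + conjc (V x) * (phi x)%:C))) =
    (fun x => -1 * (u x * (derive1 (derive1 phi) x)%:C) + (V x * u x) * (phi x)%:C).
    by apply/funext => x; rewrite conjcM conjcD conjcN conjcM !conjcK !conjcR; ring.
  have -> : (fun x => conjc (conjc (v x) * (phi x)%:C)) = (fun x => v x * (phi x)%:C).
    by apply/funext => x; rewrite conjcM conjcK conjcR.
  have iu : cintegrable (fun x => V x * u x * (phi x)%:C).
    by apply: cintegrable_mul => //; exact: csq_int_mul bV (L2_csq u).
  rewrite cintegral_comb //; last exact: cintegrable_test.
  have -> : cintegral (fun x => w x * (phi x)%:C) =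
      -1 * cintegral (fun x => v x * (phi x)%:C) + cintegral (fun x => V x * u x * (phi x)%:C).
    rewrite -cintegral_comb //; last exact: cintegrable_test.
    apply: cintegral_ae.
    - exact: cintegrable_test.
    - by apply: cintegrable_comb => //; exact: cintegrable_test.
    by apply: ae_plusS wE => x _ ->; ring.
  by move=> <-; ring.
exists (f0 0), (f1 0), f0, f1, w; split=> //.
by apply: ae_plusS wE => x _ ->; ring.
Qed.

(** One inclusion is Green's formula with zero boundary values. For the other, testing on the
    smaller minimal operator already places [(u, v)] in [A_max V]; Green's formula then turns
    adjointness into [conj a * d = conj b * c] for every attained boundary pair [(c, d)], which
    forces [a = b = 0]. *)
Lemma A_min_adjoint V : ess_bounded V ->
  A_min V = adjoint_in ip setT (A_max (fun x => conjc (V x))).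
Proof.
move=> bV; have bW := ess_boundedJ bV; have ipP := L2_inner_product R.
apply/seteqP; split=> -[u v].
  move=> /A_minE uv; split=> // p q [c [d pq]] /=.
  apply/eqP; rewrite -subr_eq0 (green_schroedinger bV uv pq).
  by rewrite conjc0 !mul0r subrr.
move=> [_ _ /= adj]; apply/A_minE.
have [a [b uv]] : A_max V (u, v).
  by apply: adjoint_A_min => // p q /A_minE pq; apply: adj; exists 0, 0.
suff [a0 b0] : a = 0 /\ b = 0 by move: uv; rewrite a0 b0.
(* Pairing with [exp (- c x)] for two values of [c] isolates the boundary values. *)
have expo (c : R) : 0 < c -> conjc a * (- c)%:C = conjc b.
  move=> c0; pose F (k x : R) : R[i] := (k * expR (- c * x))%:C.
  have prim k : is_cprimitive (F k) (F (k * - c)).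
    split; last exact: is_primitive_cst.
    have := is_primitiveZ k (is_primitive_expR (- c)).
    by congr is_primitive; apply/funext => x; rewrite /= mulrA.
  have sqF k : csq_int (F k).
    split; last by split=> //=; under [X in _ \o X]eq_fun do rewrite expr0n; exact: integrable0.
    apply: sq_intZ; split.
      have mexp : measurable_fun [set: R] (fun x => expR (- c * x)).
        by apply: continuous_measurable_fun; exact: continuous_expRZ.
      exact: measurable_funS mexp.
    have prim2 := is_primitive_expR (- (2 * c)).
    have sqE x : expR (- c * x) ^+ 2 = expR (- (2 * c) * x).
      by rewrite expr2 -expRD; congr expR; ring.
    under [X in _ \o X]eq_fun do rewrite sqE.
    have c20 : - (2 * c) != 0 by rewrite oppr_eq0 mulf_neq0 // gt_eqF.
    have [pI pE] : is_primitive (fun x => (- (2 * c))^-1 * expR (- (2 * c) * x))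
        (fun x => expR (- (2 * c) * x)).
      have := is_primitiveZ (- (2 * c))^-1 prim2.
      by congr is_primitive; apply/funext => x; rewrite /= mulKf.
    (* The bound is the integral of [exp (- 2 c x)] over the whole half-line. *)
    apply: (@integrable_bounded_primitive _ _ (2 * c)^-1) => //.
    - by apply: continuous_measurable_fun; exact: continuous_expRZ.
    - move=> x x0; have /eqP := pE x x0.
      rewrite addrC -subr_eq => /eqP <-; rewrite mulr0 expR0 mulr1 invrN.
      rewrite mulNr opprK gerDr oppr_le0.
      by rewrite mulr_ge0 ?invr_ge0 ?mulr_ge0 // ?ltW // expR_gt0.
  have [p [q [pq _ _]]] := schroedinger_intro bW (prim 1) (prim (1 * - c)) (sqF 1) (sqF _).
  have pqm : A_max (fun x => conjc (V x)) (p, q) by do 2 eexists; exact: pq.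
  have := green_schroedinger bV uv pq; rewrite (adj _ _ pqm).
  by rewrite subrr /F !mulr0 expR0 !mulr1 mul1r => /esym/subr0_eq.
have e1 := expo 1 ltr01; have e2 := expo 2 (ltr0n _ 2).
have a0 : conjc a = 0.
  have : conjc a * (- 1)%:C - conjc a * (- 2)%:C = 0 by rewrite e1 e2 subrr.
  rewrite -mulrBr -rmorphB /=.
  by rewrite (_ : -1 - -2 = 1 :> R); [rewrite mulr1|ring].
rewrite a0 mul0r in e1.
by split; apply/eqP; rewrite -conjc_eq0 ?a0 -?e1.
Qed.

End MinimalOperator.

Lemma ge0_affine (R : realType) (x y : R) : (forall t, 0 <= t * x + y) -> x = 0.
Proof.
move=> ge; apply/eqP; apply/negPn/negP => x0; have := ge (- (y + 1) / x).
by rewrite divfK //; lra.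
Qed.

(* If [K] contains [(0, z)] then [Im <w, y + c z>] is non-negative for all
   scalars [c], so [z] is orthogonal to the domain. *)
Lemma dissipative_single_valued (R : realType) (E : lmodType R[i]) (ip : E -> E -> R[i])
  (K : set (E * E)) : inner_product ip -> Defs.subspace K ->
  (forall w y, K (w, y) -> 0 <= complex.Im (ip w y)) ->
  (forall z, (forall w, domain K w -> ip w z = 0) -> z = 0) -> linear_operator K.
Proof.
move=> ipP Ks Kd dense; split=> // u v v' uv uv'.
apply/eqP; rewrite -subr_eq0; apply/eqP; set z := v - v'.
have Kz : K (0, z) by rewrite -(subrr u); exact: subspaceB Ks uv uv'.
apply: dense => w [y wy].
have ge c : 0 <= complex.Im (c * ip w z + ip w y).
  have [_ /(_ c _ _ Kz wy)/Kd] := Ks.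
  by rewrite /= scaler0 add0r (ipDr ipP) (ipZr ipP).
apply: complexP => /=.
  apply: (@ge0_affine _ _ (complex.Im (ip w y))) => t; have := ge (t *i).
  by case: (ip w z) (ip w y) => a b [c d] /=; lra.
apply: (@ge0_affine _ _ (complex.Im (ip w y))) => t; have := ge t%:C.
by case: (ip w z) (ip w y) => a b [c d] /=; lra.
Qed.

Section Potential.
Context (R : realType).
Local Notation mu := (@lebesgue_measure R).
Local Notation Rplus := (`]0, +oo[%classic : set R).
Local Notation Re := (@complex.Re R).
Local Notation Im := (@complex.Im R).
Local Notation ip := (@L2_ip R).
Implicit Types (W : R -> R[i]) (u v p q : L2 R).

Lemma L2_scaleE (a : R[i]) u : ae_plus (fun x => (a *: u : L2 R) x = a * u x).
Proof.
have := L2_combE a u 0; rewrite addr0 => e.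
by apply: ae_plusS2 e (L2_zeroE R) => x _ -> ->; rewrite addr0.
Qed.

Lemma eigenfunction_eq0 W (l : R) u : ess_bounded W ->
  schroedinger W 0 0 u (l%:C *: u) -> u = 0.
Proof.
move=> bW [f0 [f1 [u2 [hr f00 f10 qE]]]]; apply: (ode_unique (ess_boundedB l bW) hr _ f00 f10).
by apply: ae_plusS2 qE (L2_scaleE l%:C u) => x _ -> e; rewrite mulrBl -e; ring.
Qed.

Lemma ess_bounded_ImM W p : ess_bounded W ->
  mu.-integrable Rplus (EFin \o (fun x => Im (W x) * (Re (p x) ^+ 2 + Im (p x) ^+ 2))).
Proof.
move=> bW; have sp := L2_csq p; have [_] := cintegrable_ip sp (csq_int_mul bW sp).
by congr (integrable _ _ (_ \o _)); apply/funext => x; rewrite !ReImE; ring.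
Qed.

Lemma Im_potential_ge0 W p : ess_bounded W -> ae_plus (fun x => 0 <= Im (W x)) ->
  0 <= \int[mu]_(x in Rplus) (Im (W x) * (Re (p x) ^+ 2 + Im (p x) ^+ 2)).
Proof.
move=> bW W0; have mW := integrable_measurable (ess_bounded_ImM p bW).
rewrite (@eq_ae_plus_Rintegral _ _
  (fun x => `|Im (W x) * (Re (p x) ^+ 2 + Im (p x) ^+ 2)|)) //.
- by apply: Rintegral_ge0.
- exact: measurableT_comp.
apply: ae_plusS W0 => x _ W0; rewrite ger0_norm //.
by rewrite mulr_ge0 // addr_ge0 // sqr_ge0.
Qed.

Lemma Im_potentialJ W p : ess_bounded W ->
  \int[mu]_(x in Rplus) (Im (conjc (W x)) * (Re (p x) ^+ 2 + Im (p x) ^+ 2)) =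
  - \int[mu]_(x in Rplus) (Im (W x) * (Re (p x) ^+ 2 + Im (p x) ^+ 2)).
Proof.
move=> bW; rewrite -mulN1r -RintegralZl //; last exact: ess_bounded_ImM.
by apply: eq_Rintegral => x _; rewrite !ReImE; ring.
Qed.

End Potential.

(** * The extension determined by an eigenfunction of the adjoint *)

Section Extension.
Context (R : realType) (V : R -> R[i]) (l : R) (g : L2 R) (a1 b1 : R[i]).
Local Notation Re := (@complex.Re R).
Local Notation Im := (@complex.Im R).
Local Notation ip := (@L2_ip R).
Local Notation W := (fun x => conjc (V x)).
Local Notation lg := (l%:C *: g).
Context (bV : ess_bounded V) (V0 : ae_plus (fun x => 0 <= Im (V x))) (g0 : g <> 0)
  (gW : schroedinger W a1 b1 g lg).
Implicit Types (u v w z p q : L2 R).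

Let ipP := L2_inner_product R.
Let bW := ess_boundedJ bV.

(** The graph [K] of the overview. It is given as a sum of subspaces of pairs, so that it is the
    graph of a function has to be proved; this follows from dissipativity and density of the
    domain. *)
Definition A_ext : set (L2 R * L2 R) := [set r | exists u v a,
  [/\ A_min V (u, v), r.1 = u + a *: g & r.2 = v + a *: lg]].

Lemma A_min_symmetric u v p q : A_min V (u, v) -> A_max W (p, q) -> ip u q = ip v p.
Proof. by rewrite (A_min_adjoint bV) => -[_ _ uv] /uv. Qed.

Lemma A_max_g : A_max W (g, lg).
Proof. by exists a1, b1. Qed.

Lemma A_min0 : A_min V (0, 0).
Proof. by rewrite (A_min_adjoint bV); have [] := adjoint_subspace (A_max W) ipP. Qed.

Lemma A_min_ext : A_min V `<=` A_ext.
Proof. by move=> [u v] uv; exists u, v, 0; rewrite !scale0r !addr0. Qed.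

Lemma A_ext_g : A_ext (g, lg).
Proof. by exists 0, 0, 1; rewrite !scale1r !add0r; split=> //; exact: A_min0. Qed.

Lemma boundary_neq0 : ~ (a1 = 0 /\ b1 = 0).
Proof. by move=> [a0 b0]; move: gW; rewrite a0 b0 => /(eigenfunction_eq0 bW). Qed.

(** Otherwise [(g, lg)] would lie in the adjoint of [A_max W], which is [A_min V]; then [g] would be
    an eigenfunction with zero Cauchy data, hence zero. *)
Lemma A_max_asymmetric : exists p q, A_max W (p, q) /\ ip g q - ip lg p != 0.
Proof.
apply: contrapT => none; apply: g0; apply: (@eigenfunction_eq0 _ V l) => //.
apply/A_minE; rewrite (A_min_adjoint bV); split=> // p q pq /=.
by apply/eqP; rewrite -subr_eq0; apply/negPn/negP => ne; apply: none; exists p, q.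
Qed.

(** Restricting to the kernel of a non-zero functional enlarges the adjoint by one dimension, here
    by [(g, lg)]. The pair [(p0, q0)] spans a complement of that kernel in [A_max W]. *)
Lemma A_ext_adjoint : A_ext = adjoint_in ip setT
  [set r | A_max W r /\ ip g r.2 = ip lg r.1].
Proof.
apply/seteqP; split=> -[w z].
  move=> [u [v [a [uv /= -> ->]]]]; split=> // p q [pq /= gpq] /=.
  by rewrite !(ipDl ipP) !(ipZl ipP a) (A_min_symmetric uv pq) gpq.
move=> [_ _ /= adj]; have [p0 [q0 [pq0]]] := A_max_asymmetric.
(* Chosen so that [(w - a g, z - a lg)] also satisfies the adjoint relation against [(p0, q0)]; the
   conjugate appears because the form is antilinear in its first argument. *)
set D := ip g q0 - _ => D0; set a := conjc ((ip w q0 - ip z p0) / D).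
exists (w - a *: g), (z - a *: lg), a; rewrite !subrK; split=> //.
rewrite (A_min_adjoint bV); split=> // p q pq /=.
(* With this [c] the pair [c (p0, q0) + (p, q)] falls into the kernel of the functional, where the
   hypothesis applies. *)
pose c := - ((ip g q - ip lg p) / D).
have S : A_max W (c *: p0 + p, c *: q0 + q).
  have [c0 [d0 s0]] := pq0; have [c1 [d1 s1]] := pq.
  by do 2 eexists; exact: (schroedinger_comb c s0 s1).
have /(adj _ _) : A_max W (c *: p0 + p, c *: q0 + q) /\
    ip g (c *: q0 + q) = ip lg (c *: p0 + p).
  split=> //; apply/eqP; rewrite -subr_eq0; apply/eqP.
  rewrite !(ipDr ipP) !(ipZr ipP _ c).
  have -> : c * ip g q0 + ip g q - (c * ip lg p0 + ip lg p) = c * D + (ip g q - ip lg p).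
    by rewrite /D; ring.
  by rewrite /c mulNr divfK // addNr.
rewrite !(ipDr ipP) !(ipZr ipP _ c) !(ipBl ipP) !(ipZl ipP a) /a conjcK /c.
move: (ip g q) (ip lg p) (ip w q) (ip z p) (ip w q0) (ip z p0) => A B C F G H e.
apply/eqP; rewrite -subr_eq0; apply/eqP.
have -> : C - (G - H) / D * A - (F - (G - H) / D * B) =
   (- ((A - B) / D) * G + C) - (- ((A - B) / D) * H + F) by ring.
by rewrite e subrr.
Qed.

Lemma A_ext_symmetric w z : A_ext (w, z) -> ip g z = l%:C * ip g w.
Proof.
move=> [u [v [a [uv /= -> ->]]]]; have := A_min_symmetric uv A_max_g.
rewrite (ipZr ipP) => /(congr1 conjc); rewrite conjcM conjcR -!(ip_conj ipP) => e.
by rewrite !(ipDr ipP) !(ipZr ipP) -e; ring.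
Qed.

Lemma A_min_dissipative u v : A_min V (u, v) -> 0 <= Im (ip u v).
Proof.
move=> /A_minE uv; rewrite (Im_schroedinger bV uv) mulr0 add0r.
exact: Im_potential_ge0.
Qed.

(** For [w = u + a g], symmetry turns the cross terms into [l (a <u, g> + conj (a <u, g>))], which
    is real, as is [l |a g|^2]. The imaginary part is therefore that of [<u, v>]. *)
Lemma A_ext_Im w z : A_ext (w, z) -> 0 <= Im (ip w z).
Proof.
move=> [u [v [a [uv we ze]]]]; rewrite [w]we [z]ze {we ze}.
have e := A_min_symmetric uv A_max_g.
have := A_min_dissipative uv; move: e.
rewrite !(ipDr ipP) !(ipDl ipP) !(ipZr ipP) !(ipZl ipP) (ip_conj ipP v g) => <-.
rewrite conjcM conjcR (ip_self ipP g).
case: (ip u v) (ip u g) a (Re _) => x1 x2 [y1 y2] [z1 z2] N /= h; lra.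
Qed.

Lemma A_ext_subspace : Defs.subspace A_ext.
Proof. rewrite A_ext_adjoint; exact: adjoint_subspace. Qed.

Lemma domain_A_ext_orthogonal z : (forall w, domain A_ext w -> ip w z = 0) -> z = 0.
Proof.
move=> z0; apply: (A_min_orthogonal bV) => w [y wy]; apply: z0.
by exists y; exact: A_min_ext.
Qed.

Lemma A_ext_linear : linear_operator A_ext.
Proof.
apply: (dissipative_single_valued ipP A_ext_subspace A_ext_Im).
exact: domain_A_ext_orthogonal.
Qed.

Lemma A_ext_dissipative : dissipative ip A_ext.
Proof.
split; [exact: A_ext_linear| |exact: A_ext_Im].
apply: (dense_of_orthogonal ipP (@L2_complete R)); last exact: domain_A_ext_orthogonal.
have [K0 KL] := A_ext_subspace; split; first by exists 0.
by move=> a u v [u' uu] [v' vv]; exists (a *: u' + v'); exact: KL uu vv.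
Qed.

Lemma A_ext_deficiency p : (forall w z, A_ext (w, z) -> ip (z + 'i *: w) p = 0) -> p = 0.
Proof.
move=> p0; have [c [d pW]] : A_max W (p, 'i *: p).
  apply: adjoint_A_min => // u v.
  have -> : (fun x => conjc (W x)) = V by apply/funext => x; rewrite conjcK.
  move=> /A_min_ext/p0; rewrite (ipDl ipP) !(ipZl ipP) => e.
  rewrite (ip_conj ipP u p) (ip_conj ipP v p) -conjcM; congr conjc; move: e.
  by case: (ip u p) (ip v p) => x y [x' y'] [h1 h2]; apply: complexP => /=; lra.
(* The pair [(g, lg)] is in [A_ext], so [(l - i) <g, p> = 0], and [l - i] is non-zero since [l] is
   real. *)
have gp : ip g p = 0.
  have := p0 _ _ A_ext_g; rewrite (ipDl ipP) !(ipZl ipP) conjcR -mulrDl => /eqP.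
  rewrite mulf_eq0 => /orP[|/eqP //] /eqP/(congr1 Im) /= e; exfalso; lra.
(* Adding [t g] can cancel the derivative at [0] if [b1] is non-zero, and the value at [0]
   otherwise; either way the product vanishes. *)
have [t tE] : exists t, Im (conjc (t * a1 + c) * (t * b1 + d)) = 0.
  have [b0|b0] := eqVneq b1 0; last first.
    by exists (- d / b1); rewrite divfK // addNr mulr0.
  have a0 : a1 != 0 by apply/eqP => a0; apply: boundary_neq0.
  by exists (- c / a1); rewrite divfK // addNr conjc0 mul0r.
have := Im_schroedinger bW (schroedinger_comb t gW pW).
rewrite tE add0r Im_potentialJ //.
have := Im_potential_ge0 (t *: g + p) bV V0.
(* As [<g, p> = 0], the form is [|t|^2 l |g|^2 + i |p|^2], with imaginary part [|p|^2]; on the other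
   side stands minus a non-negative integral. *)
rewrite !(ipDr ipP) !(ipDl ipP) !(ipZr ipP) !(ipZl ipP) (ip_conj ipP g p) gp.
rewrite (ip_self ipP g) (ip_self ipP p).
move: (Rintegral _ _ _) (Re (ip g g)) => I N I0 e.
apply: (ip_eq0 ipP); apply/eqP; rewrite eq_le (ip_ge0 ipP) andbT.
by move: (Re (ip p p)) e; case: t {tE} => x y P /=; lra.
Qed.

Lemma A_ext_maximally_dissipative : maximally_dissipative ip A_ext.
Proof.
apply: (maximally_dissipative_adjoint ipP (@L2_complete R)) A_ext_adjoint _.
  exact: A_ext_dissipative.
exact: A_ext_deficiency.
Qed.

(** If [u + a g] is an eigenvector for [l], then so is its [A_min] part [u], or [u] is zero; zero
    Cauchy data exclude the former. *)
Lemma A_ext_eigenspace : op_ker A_ext l%:C = span1 g.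
Proof.
apply/seteqP; split=> [w [u [v [a [uv /= we lwe]]]]|_ [a ->]]; last first.
  rewrite /op_ker /= scalerA mulrC -scalerA.
  exact: (subspaceZ a A_ext_subspace A_ext_g).
suff u0 : u = 0 by exists a; rewrite we u0 add0r.
apply: (@eigenfunction_eq0 _ V l) => //; apply/A_minE.
suff -> : l%:C *: u = v by [].
by move: lwe; rewrite we scalerDr scalerA mulrC -scalerA => /addIr.
Qed.

Lemma A_ext_minimal A : Defs.subspace A -> A_min V `<=` A -> A (g, lg) -> A_ext `<=` A.
Proof.
move=> As VA Ag [w z] [u [v [a [/VA uv /= -> ->]]]].
exact: (subspaceD As uv (subspaceZ a As Ag)).
Qed.

End Extension.

Theorem theorem3p15 (R : realType) (V : R -> R[i]) (lambda : R)
    (hV : LpC +oo%E V)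
    (hVI : ae_plus (fun x => 0 <= complex.Im (V x)))
    (hVI0 : ~ ae_plus (fun x => complex.Im (V x) = 0))
    (g : L2 R) (hg0 : g <> 0)
    (hg : exists g1 g2 : L2 R, H2_derivatives g g1 g2 /\
      ae_plus (fun x => - g2 x + (complex.Re (V x))%:C * g x
                          - 'i%C * (complex.Im (V x))%:C * g x
                        = lambda%:C * g x)) :
  exists! A : set (L2 R * L2 R),
    [/\ maximally_dissipative (@L2_ip R) A,
        A_min V `<=` A,
        op_ker A lambda%:C = span1 g,
        op_ker A lambda%:C <> [set 0] &
        reducing_selfadjoint (@L2_ip R) (op_ker A lambda%:C) A].
Proof.
have ipP := L2_inner_product R; have bV := LpC_oo_bounded hV.
(* [V_R - i V_I] is [conj V], so the equation says that [g] is an eigenfunction of the maximal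
   operator for the conjugate potential; [a] and [b] are the values of [g] and [g'] at [0]. *)
have [a [b gW]] : exists a b, schroedinger (fun x => conjc (V x)) a b g (lambda%:C *: g).
  have [g1 [g2 [/H2_derivatives_repr[f0 [f1 [hr _]]] eq]]] := hg.
  exists (f0 0), (f1 0), f0, f1, g2; split=> //.
  apply: ae_plusS2 eq (L2_scaleE lambda%:C g) => x _ e ->; rewrite -e.
  by case: (V x) (g x) (g2 x) => s t [y z] [c d]; apply: complexP => /=; ring.
have ker := A_ext_eigenspace lambda bV hg0.
have max := A_ext_maximally_dissipative bV hVI hg0 gW.
exists (A_ext V lambda g); split.
  split=> //; first exact: A_min_ext.
    rewrite ker => e; apply: hg0; have : span1 g g by exists 1; rewrite scale1r.
    by rewrite e.
  rewrite ker; apply: (span1_reducing_selfadjoint ipP hg0 _ (A_ext_g _ _ bV)).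
    by case: max => -[].
  by move=> w z; exact: (A_ext_symmetric bV gW).
move=> A [[Ad _] VA kerA _ _]; have [[As _] _ _] := Ad.
have [_ /(_ A Ad) -> //] := max; apply: A_ext_minimal => //.
have : span1 g g by exists 1; rewrite scale1r.
by rewrite -kerA.
Qed.
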